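(* Let $n\ge1$ and for $i=1,\dots,n$ let $\omega^{(i)},\sigma^{(i)}\in\mathbb{Z}^n_{\geqslant}$ be such that $A^{(i)}=\{\omega^{(i)},\sigma^{(i)},\bar 0\}$ has three elements, and assume the matrix $\omega$ with columns $\omega^{(1)},\dots,\omega^{(n)}$ is nondegenerate; let $\sigma$ be the matrix with columns $\sigma^{(1)},\dots,\sigma^{(n)}$. Consider the reduced system $$ y^{\omega^{(i)}}+x_i\,y^{\sigma^{(i)}}-1=0,\qquad i=1,\dots,n,$$ with unknown $y=(y_1,\dots,y_n)$ and complex coefficients $x=(x_1,\dots,x_n)$, let $y(x)$ be its principal solution (the branch with $y_i(0)=1$ for all $i$), and for $d\in\mathbb{Z}^n_+$ let $y^d(x)=y_1^{d_1}(x)\cdots y_n^{d_n}(x)$, which is given near the origin by a Taylor series. Choose, for each $i$, an ordered pair $\mu^{(i)},\nu^{(i)}\in A^{(i)}$ of one of the three forms $(\mu^{(i)},\nu^{(i)})=(\omega^{(i)},\bar0)$, $(\sigma^{(i)},\bar0)$ or $(\omega^{(i)},\sigma^{(i)})$, and accordingly partition $\{1,\dots,n\}$ into $J=\{j:\nu^{(j)}=\bar0,\ \mu^{(j)}=\omega^{(j)}\}$, $L=\{l:\nu^{(l)}=\bar0,\ \mu^{(l)}=\sigma^{(l)}\}$, $T=\{t:\nu^{(t)}=\sigma^{(t)},\ \mu^{(t)}=\omega^{(t)}\}$. Let $\varkappa$ be the matrix with columns $\mu^{(i)}-\nu^{(i)}$ and assume it is nondegenerate. Let $\beta^{(i)}$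 be the third element of $A^{(i)}$ (i.e. $\beta^{(i)}=\sigma^{(i)}$ for $i\in J$, $\omega^{(i)}$ for $i\in L$, $\bar 0$ for $i\in T$), let $\overline{\beta}$ be the matrix with columns $\beta^{(i)}-\nu^{(i)}$, and define for $k\in\mathbb{Z}^n_{\geqslant}$ $$ c_k=\frac{(-1)^{|k|}}{k!}\,\frac{\Gamma\left(\varkappa^{-1}d+\varkappa^{-1}\overline{\beta}k\right)}{\Gamma\left(\varkappa^{-1}d+\varkappa^{-1}\overline{\beta}k-k+I\right)}\,\det\left(\operatorname{diag}\left[\varkappa^{-1}d+\varkappa^{-1}\overline{\beta}k\right]-\varkappa^{-1}\overline{\beta}\,\operatorname{diag}[k]\right).$$ Let $\Phi=\varkappa^{-1}\sigma$ and $\Psi=\varkappa^{-1}\omega$ with rows $\varphi_1,\dots,\varphi_n$ and $\psi_1,\dots,\psi_n$, and let $\varkappa^{-1}_i$ denote the $i$-th row of $\varkappa^{-1}$. For a row or vector $v$ and $S\in\{J,L,T\}$, let $v^S$ be the truncated vector consisting of the entries of $v$ indexed by $S$. Then there exists an analytic continuation of the Taylor series of $y^d(x)$ in the form of the Puiseux series $$\sum_{k\in\mathbb{Z}^n_{\geqslant}}\tilde c_k\,x^{m(k)},$$ whose support consists of the points $m(k)=(m_1(k),\dots,m_n(k))$ with $$m_j(k)=k_j,\quad j\in J,$$ $$m_l(k)=-\langle\varphi_l^J,k^J\rangle-\langle\psi_l^L,k^L\rangle+\langle\psi_l^T,k^T\rangle-\langle d,\varkappa^{-1}_l\rangle,\quad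 l\in L,$$ $$m_t(k)=\langle\varphi_t^J,k^J\rangle+\langle\psi_t^L,k^L\rangle-\langle\psi_t^T,k^T\rangle+\langle d,\varkappa^{-1}_t\rangle,\quad t\in T,$$ and whose coefficients are $$\tilde c_k=e^{i\pi\sum_{t\in T}\left(k_t+m_t(k)\right)}\,c_k.$$
   Context: $y^\alpha=y_1^{\alpha_1}\cdots y_n^{\alpha_n}$ and $x^{m}=x_1^{m_1}\cdots x_n^{m_n}$ (with rational exponents, giving Puiseux series). $\mathbb{Z}^n_{\geqslant}$ denotes vectors with nonnegative integer entries; $\langle\cdot,\cdot\rangle$ is the standard scalar product. For a vector $b$, $\Gamma(b)=\prod_k\Gamma(b_k)$ and $\operatorname{diag}[b]$ is the diagonal matrix with entries of $b$; $I=(1,\dots,1)$, $k!=k_1!\cdots k_n!$, $|k|=k_1+\dots+k_n$. A ratio of products of Gamma functions is understood as the meromorphic function with removable singularities removed (e.g. $\Gamma(-1)/\Gamma(0)=-1$). *)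

(* Defs.v *)
From mathcomp Require Import all_boot all_order all_algebra.
From mathcomp Require Import all_classical all_reals all_analysis.
From mathcomp Require Import complex.
Set Implicit Arguments.
Unset Strict Implicit.
Unset Printing Implicit Defensive.
Import Order.TTheory GRing.Theory Num.Theory ComplexField.
Local Open Scope ring_scope.
Local Open Scope complex_scope.

Section Defs.
Variable R : realType.
Local Notation C := R[i].

Definition cabs (z : C) : R := complex.Re `|z|.

Definition vnorm n (x : 'I_n -> C) : R := \big[Num.max/0]_(i < n) cabs (x i).

Definition vsub n (x y : 'I_n -> C) : 'I_n -> C := fun i => x i - y i.
Definition vadd n (x y : 'I_n -> C) : 'I_n -> C := fun i => x i + y i.

Definition open_set n (D : ('I_n -> C) -> Prop) : Prop :=
  forall x, D x -> exists2 e : R, 0 < e &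
    forall y, vnorm (vsub y x) < e -> D y.

Definition connected_set n (D : ('I_n -> C) -> Prop) : Prop :=
  forall U V : ('I_n -> C) -> Prop, open_set U -> open_set V ->
    (forall x, D x -> U x \/ V x) ->
    (forall x, D x -> U x -> V x -> False) ->
    (exists x, D x /\ U x) -> (exists x, D x /\ V x) -> False.

Definition holomorphic_on n (D : ('I_n -> C) -> Prop) (F : ('I_n -> C) -> C) : Prop :=
  forall x, D x -> exists a : 'I_n -> C, forall e : R, 0 < e ->
    exists2 dl : R, 0 < dl & forall h : 'I_n -> C, vnorm h < dl ->
      cabs (F (vadd x h) - F x - \sum_(i < n) a i * h i) <= e * vnorm h.

Definition continuous_on n (D : ('I_n -> C) -> Prop) (F : ('I_n -> C) -> C) : Prop :=
  forall x, D x -> forall e : R, 0 < e -> exists2 dl : R, 0 < dl &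
    forall y, D y -> vnorm (vsub y x) < dl -> cabs (F y - F x) < e.

Definition cexp (z : C) : C :=
  (expR (complex.Re z))%:C * ((cos (complex.Im z))%:C + 'i * (sin (complex.Im z))%:C).

Definition mono n (y : 'I_n -> C) (a : 'I_n -> nat) : C :=
  \prod_(i < n) y i ^+ a i.

Definition principal_solution n (om sg : 'I_n -> 'I_n -> nat) (r0 : R)
    (Y : ('I_n -> C) -> 'I_n -> C) : Prop :=
  [/\ forall i, holomorphic_on (fun x => vnorm x < r0) (fun x => Y x i),
      forall i, Y (fun _ => 0) i = 1 &
      forall x, vnorm x < r0 -> forall i,
        mono (Y x) (om i) + x i * mono (Y x) (sg i) - 1 = 0].

Definition box_sum n (t : ('I_n -> nat) -> C) (N : nat) : C :=
  \sum_(f : {ffun 'I_n -> 'I_N}) t (fun i => nat_of_ord (f i)).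

Definition abs_summable n (t : ('I_n -> nat) -> C) : Prop :=
  exists M : R, forall N : nat,
    \sum_(f : {ffun 'I_n -> 'I_N}) cabs (t (fun i => nat_of_ord (f i))) <= M.

Definition has_sum n (t : ('I_n -> nat) -> C) (s : C) : Prop :=
  forall e : R, 0 < e -> exists N0 : nat, forall N : nat, (N0 <= N)%N ->
    cabs (box_sum t N - s) < e.

(* the type of the pair (mu^(i), nu^(i)) : J = (omega,0), L = (sigma,0), T = (omega,sigma) *)
Inductive kind := KJ | KL | KT.
Definition isJ (k : kind) : bool := if k is KJ then true else false.
Definition isL (k : kind) : bool := if k is KL then true else false.
Definition isT (k : kind) : bool := if k is KT then true else false.

Section Data.
Variables (n : nat) (om sg : 'I_n -> 'I_n -> nat) (kd : 'I_n -> kind).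

Definition mx_of (v : 'I_n -> 'I_n -> nat) : 'M[R]_n := \matrix_(r, c) ((v c r)%:R : R).
Definition omega_mx := mx_of om.
Definition sigma_mx := mx_of sg.

Definition mu_col (i r : 'I_n) : R :=
  match kd i with KJ | KT => (om i r)%:R | KL => (sg i r)%:R end.
Definition nu_col (i r : 'I_n) : R :=
  match kd i with KJ | KL => 0 | KT => (sg i r)%:R end.
Definition beta_col (i r : 'I_n) : R :=
  match kd i with KJ => (sg i r)%:R | KL => (om i r)%:R | KT => 0 end.

Definition kappa : 'M[R]_n := \matrix_(r, c) (mu_col c r - nu_col c r).
Definition betabar : 'M[R]_n := \matrix_(r, c) (beta_col c r - nu_col c r).
Definition kinv : 'M[R]_n := invmx kappa.

Definition natcol (k : 'I_n -> nat) : 'cV[R]_n := \col_i ((k i)%:R : R).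

Variable d : 'I_n -> nat.

Definition avec (k : 'I_n -> nat) : 'cV[R]_n :=
  kinv *m natcol d + kinv *m betabar *m natcol k.
Definition Bmx : 'M[R]_n := kinv *m betabar.

(* c_k = (-1)^|k|/k! * Gamma(a)/Gamma(a-k+I) * det(diag[a] - B diag[k]),
   with the Gamma ratio understood as the meromorphic function with removable
   singularities removed:  Gamma(a_i)/Gamma(a_i-k_i+1) = prod_{j=1}^{k_i-1}(a_i-j)
   if k_i >= 1, and = 1/a_i if k_i = 0; in the latter case the i-th column of
   diag[a]-B diag[k] is a_i e_i, and the factor a_i is cancelled against 1/a_i
   (so that the column becomes e_i). *)
Definition ck (k : 'I_n -> nat) : R :=
  let a := avec k in
  (-1) ^+ (\sum_(i < n) k i) / ((\prod_(i < n) (k i)`!)%:R)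
  * (\prod_(i < n | k i != 0%N) \prod_(1 <= j < k i) (a i 0 - j%:R))
  * \det (\matrix_(r, c) (if k c == 0%N then (r == c)%:R
                          else (r == c)%:R * a c 0 - Bmx r c * (k c)%:R)).

Definition Phi : 'M[R]_n := kinv *m sigma_mx.
Definition Psi : 'M[R]_n := kinv *m omega_mx.

Definition rowdot (P : kind -> bool) (M : 'M[R]_n) (i : 'I_n) (k : 'I_n -> nat) : R :=
  \sum_(c < n | P (kd c)) M i c * (k c)%:R.

Definition dkinv (i : 'I_n) : R := \sum_(c < n) (d c)%:R * kinv i c.

Definition mexp (k : 'I_n -> nat) (i : 'I_n) : R :=
  match kd i with
  | KJ => (k i)%:R
  | KL => - rowdot isJ Phi i k - rowdot isL Psi i k + rowdot isT Psi i k - dkinv i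
  | KT => rowdot isJ Phi i k + rowdot isL Psi i k - rowdot isT Psi i k + dkinv i
  end.

Definition ctilde (k : 'I_n -> nat) : C :=
  cexp ('i * (pi * \sum_(t < n | isT (kd t)) ((k t)%:R + mexp k t))%:C) * (ck k)%:C.

(* the k-th term  tilde c_k x^{m(k)}, where x_i^{m_i} = exp(m_i * ell_i(x))
   for a chosen branch ell_i of log x_i *)
Definition puiseux_term (ell : 'I_n -> C) (k : 'I_n -> nat) : C :=
  ctilde k * \prod_(i < n) cexp ((mexp k i)%:C * ell i).

End Data.
End Defs.

(* Main.v *)
Require Import Defs.
From mathcomp Require Import all_boot all_order all_algebra.
From mathcomp Require Import all_classical all_reals all_analysis.
From mathcomp Require Import perm complex.
From mathcomp Require Import ring lra zify.
Set Implicit Arguments.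
Unset Strict Implicit.
Unset Printing Implicit Defensive.
Import Order.TTheory GRing.Theory Num.Theory ComplexField.
Import numFieldNormedType.Exports.
Local Open Scope ring_scope.
Local Open Scope complex_scope.

(** With M = sigma^T omega^{-T} and y = exp (omega^{-T} t), so that t_i is the
logarithm of y^omega^(i), the system becomes the explicit entire map
  x_i = (1 - e^{t_i}) e^{-(M t)_i},
written [Emap M]. The principal branch is its local inverse at t = 0, and y^d is
the exponential of a linear form in t. A continuation of y^d is therefore a
connected open set P of points t containing 0 on which [Emap M] is injective with
nonzero Jacobian: the domain in x-space is the image of P.

P is a thin tube around a ray t = (s + i e) la, where la_i is 0, -1, 1 for i in
J, L, T, together with a ball around 0. Along the ray the Jacobian is, up to units,
a nonzero polynomial in e^{s + i e}, so it does not vanish for a generic small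
shift e. The shift also makes the ray injective: if la_i <> 0 then, up to a positive
factor and a constant phase, x_i is 1 - e^{la_i s} e^{i la_i e}, whose argument is
strictly monotone in s.

Far along the ray the unknowns p_i = e^{T_i} (y^omega, x y^sigma or -y^(omega-sigma)/x,
according to the kind of i) are close to 1 and satisfy p_i = 1 - X_i p^{B_i}, with X_i
a Puiseux monomial in x and B = kappa^{-1} betabar; that is X = [Emap B^T T]. The
expansion of p^a in powers of X is found without contour integrals. Its coefficients
c_k(a) satisfy c_k(a) - c_k(a + e_i) = c_{k-e_i}(a + B_i) and c_k(0) = 0 for k <> 0.
Both properties determine them among functions polynomial in a, which gives the
convolution identity for a + b. Hence the sum is a character of a, so it equals
exp <a, t>, and the recurrence at a = 0 says that t solves [Emap B^T t = X]. *)

(** * Complex numbers and the complex exponential *)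

(** Solutions of the system are multivalued in x, whereas the continuation has to be one function on
    one domain. In the coordinates t the discriminant shows up only as zeros of a Jacobian, and
    multivaluedness only as coincidences of values. Both are excluded with explicit lower bounds,
    because a tube of positive thickness needs radii uniform along the path; this is why local
    inversion is a Newton iteration with tracked constants.

    A finite piece of the ray is enough: the series in X converges as soon as every log p_i is below
    a radius that depends on B only. The phase in the coefficients records one choice of logarithm:
    for i in T, 1 - e^{t_i} = -e^{t_i} (1 - e^{-t_i}), and -1 is written e^{-i pi}. On the ray x_j =
    0 for j in J, so logarithms of x are taken on a small ball moved off these hyperplanes.

    The exponents a are arbitrary real vectors, so identities between coefficients cannot be
    obtained by counting; polynomiality in a carries them over from integer shifts. Likewise no
    continuity in a is available for the character, and smallness on the unit cube takes its
    place. *)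

Section ComplexBasics.
Variable R : realType.
Local Notation C := R[i].
Implicit Types z w : C.

Lemma cabsE z : `|z| = (cabs z)%:C.
Proof. by rewrite /cabs normc_def. Qed.

Lemma cabs_ge0 z : 0 <= cabs z.
Proof. by rewrite -ler0c -cabsE. Qed.

Lemma cabs0 : cabs (0 : C) = 0.
Proof. by apply: complexI; rewrite -cabsE normr0. Qed.

Lemma cabs1 : cabs (1 : C) = 1.
Proof. by apply: complexI; rewrite -cabsE normr1. Qed.

Lemma cabsM z w : cabs (z * w) = cabs z * cabs w.
Proof. by apply: complexI; rewrite -cabsE normrM !cabsE rmorphM. Qed.

Lemma cabsX z k : cabs (z ^+ k) = cabs z ^+ k.
Proof. by elim: k => [|k IH]; rewrite ?expr0 ?cabs1 // !exprS cabsM IH. Qed.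

Lemma cabsN z : cabs (- z) = cabs z.
Proof. by apply: complexI; rewrite -!cabsE normrN. Qed.

Lemma cabsBC z w : cabs (z - w) = cabs (w - z).
Proof. by rewrite -cabsN opprB. Qed.

Lemma ler_cabsD z w : cabs (z + w) <= cabs z + cabs w.
Proof. by rewrite -lecR rmorphD -!cabsE ler_normD. Qed.

Lemma ler_cabsB z w : cabs (z - w) <= cabs z + cabs w.
Proof. by rewrite -(cabsN w) ler_cabsD. Qed.

Lemma ler_cabs_dist u z w : cabs (z - w) <= cabs (z - u) + cabs (u - w).
Proof. by rewrite (_ : z - w = (z - u) + (u - w)) ?ler_cabsD //; ring. Qed.

Lemma ler_cabs_sub z w : cabs z - cabs w <= cabs (z - w).
Proof. by rewrite lerBlDr; apply: le_trans (ler_cabsD _ _); rewrite subrK. Qed.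

Lemma cabs_eq0 z : (cabs z == 0) = (z == 0).
Proof. by rewrite -(inj_eq (@complexI R)) -cabsE normr_eq0. Qed.

Lemma cabsV z : cabs z^-1 = (cabs z)^-1.
Proof.
case: (eqVneq z 0) => [->|z0]; first by rewrite invr0 cabs0 invr0.
apply: (@mulfI _ (cabs z)); first by rewrite cabs_eq0.
by rewrite -cabsM !divff ?cabs1 ?cabs_eq0.
Qed.

Lemma cabs_real (x : R) : cabs x%:C = `|x|.
Proof. by rewrite /cabs normc_def /= expr0n addr0 sqrtr_sqr. Qed.

Lemma cabs_i : cabs ('i : C) = 1.
Proof. by rewrite /cabs normc_def /= expr0n add0r expr1n sqrtr1. Qed.

Lemma cabs_nat k : cabs (k%:R : C) = k%:R.
Proof. by rewrite -(rmorph_nat (real_complex R)) cabs_real ger0_norm. Qed.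

Lemma ler_cabs_sum I (r : seq I) (P : pred I) (f : I -> C) :
  cabs (\sum_(i <- r | P i) f i) <= \sum_(i <- r | P i) cabs (f i).
Proof.
elim/big_rec2: _ => [|i x y _ h]; first by rewrite cabs0.
by apply: le_trans (ler_cabsD _ _) _; rewrite lerD2l.
Qed.

Lemma cabs_prod I (r : seq I) (P : pred I) (f : I -> C) :
  cabs (\prod_(i <- r | P i) f i) = \prod_(i <- r | P i) cabs (f i).
Proof. by elim/big_rec2: _ => [|i x y _ <-]; rewrite ?cabs1 ?cabsM. Qed.

Lemma Re_le_cabs z : `|complex.Re z| <= cabs z.
Proof. by rewrite -lecR -cabsE normc_ge_Re. Qed.

Lemma Im_le_cabs z : `|complex.Im z| <= cabs z.
Proof.
by have := Re_le_cabs (z * 'i); rewrite cabsM cabs_i mulr1 ReiNIm normrN.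
Qed.

Lemma cabs_le_ReIm z : cabs z <= `|complex.Re z| + `|complex.Im z|.
Proof.
rewrite {1}[z]complexE; apply: le_trans (ler_cabsD _ _) _.
by rewrite cabsM cabs_i mul1r !cabs_real.
Qed.

Lemma complex_eq z w : complex.Re z = complex.Re w -> complex.Im z = complex.Im w -> z = w.
Proof. by case: z w => a b [c e] /= -> ->. Qed.

Lemma ReD z w : complex.Re (z + w) = complex.Re z + complex.Re w.
Proof. by case: z w => a b [c e]. Qed.
Lemma ImD z w : complex.Im (z + w) = complex.Im z + complex.Im w.
Proof. by case: z w => a b [c e]. Qed.
Lemma ReN z : complex.Re (- z) = - complex.Re z. Proof. by case: z. Qed.
Lemma ImN z : complex.Im (- z) = - complex.Im z. Proof. by case: z. Qed.

Lemma cexp0 : cexp (0 : C) = 1.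
Proof. by rewrite /cexp /= expR0 cos0 sin0 mulr0 addr0 mulr1. Qed.

Lemma cexpD z w : cexp (z + w) = cexp z * cexp w.
Proof.
rewrite /cexp ReD ImD expRD cosD sinD.
case: z w => a b [c e] /=; apply: complex_eq => /=; ring.
Qed.

Lemma cexpN z : cexp (- z) = (cexp z)^-1.
Proof.
have h : cexp z * cexp (- z) = 1 by rewrite -cexpD subrr cexp0.
have z0 : cexp z != 0 by apply/eqP => e; move: h; rewrite e mul0r => /eqP; rewrite eq_sym oner_eq0.
by apply: (mulfI z0); rewrite h divff.
Qed.

Lemma cexp_neq0 z : cexp z != 0.
Proof.
apply/eqP => e; have : cexp z * cexp (- z) = 1 by rewrite -cexpD subrr cexp0.
by rewrite e mul0r => /eqP; rewrite eq_sym oner_eq0.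
Qed.

Lemma cexp_sum I (r : seq I) (P : pred I) (f : I -> C) :
  cexp (\sum_(i <- r | P i) f i) = \prod_(i <- r | P i) cexp (f i).
Proof. by elim/big_rec2: _ => [|i x y _ <-]; rewrite ?cexp0 ?cexpD. Qed.

Lemma cexpMn z k : cexp (k%:R * z) = cexp z ^+ k.
Proof.
elim: k => [|k IH]; first by rewrite mul0r cexp0.
by rewrite -natr1 mulrDl mul1r cexpD IH exprSr.
Qed.

Lemma cabs_cexp z : cabs (cexp z) = expR (complex.Re z).
Proof.
rewrite /cexp cabsM cabs_real ger0_norm ?expR_ge0 // -[RHS]mulr1; congr (_ * _).
by rewrite /cabs normc_def /= !(mul0r, mul1r, mulr0, addr0, add0r, subr0) cos2Dsin2 sqrtr1.
Qed.

Lemma cexp_real (x : R) : cexp x%:C = (expR x)%:C.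
Proof. by rewrite /cexp /= cos0 sin0 mulr0 addr0 mulr1. Qed.

Lemma cexp_ipi : cexp ('i * (pi : R)%:C) = -1.
Proof.
rewrite /cexp; apply: complex_eq => /=;
by rewrite !(mul0r, mul1r, mulr0, addr0, add0r, subr0, expR0, cospi, sinpi, mulr1, oppr0).
Qed.

End ComplexBasics.

(** * Taylor bounds for the exponential with explicit constants *)

Section ExpEstimates.
Variable R : realType.
Local Notation C := R[i].
Implicit Types z w h : C.

Lemma sin_le (y : R) : 0 <= y -> `|sin y| <= y.
Proof.
rewrite le_eqVlt => /orP[/eqP <-|y0]; first by rewrite sin0 normr0.
have [|c _] := @MVT R sin cos 0 y y0 (fun x _ => is_derive_sin x).
  exact/continuous_subspaceT/continuous_sin.
rewrite sin0 !subr0 => ->; rewrite normrM (ger0_norm (ltW y0)).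
by rewrite -[leRHS]mul1r ler_wpM2r ?cos_max // ltW.
Qed.

Lemma cos_ge_sqr (y : R) : 1 - cos y <= y ^+ 2.
Proof.
wlog y0 : y / 0 <= y.
  move=> H; have [/H //|y0] := leP 0 y.
  by rewrite -cosN -sqrrN; apply: H; rewrite oppr_ge0 ltW.
move: y0; rewrite le_eqVlt => /orP[/eqP <-|y0]; first by rewrite cos0 subrr expr0n.
have [|c] := @MVT R cos (fun x => - sin x) 0 y y0 (fun x _ => is_derive_cos x).
  exact/continuous_subspaceT/continuous_cos.
rewrite in_itv /= => /andP[c0 cy] e.
have := sin_le (ltW c0); rewrite ler_norml => /andP[_ h].
have : (c - sin c) * y >= 0 by rewrite mulr_ge0 ?subr_ge0 // ltW.
have : (y - c) * y >= 0 by rewrite mulr_ge0 ?subr_ge0 // ltW.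
by move: e; rewrite cos0 expr2; nra.
Qed.

Lemma sin_sub_le (y : R) : `|y| <= 2^-1 -> `|sin y - y| <= y ^+ 2.
Proof.
wlog y0 : y / 0 <= y.
  move=> H; have [/H //|y0 hy] := leP 0 y.
  have := H (- y); rewrite oppr_ge0 (ltW y0) normrN => /(_ isT hy).
  by rewrite sqrrN sinN -opprD normrN.
rewrite ger0_norm //.
move: y0; rewrite le_eqVlt => /orP[/eqP <-|y0]; first by rewrite sin0 subr0 normr0 expr0n.
have [|c] := @MVT R sin cos 0 y y0 (fun x _ => is_derive_sin x).
  exact/continuous_subspaceT/continuous_sin.
rewrite in_itv /= sin0 !subr0 => /andP[c0 cy] -> y1.
have h1 := cos_le1 c; have h2 := cos_ge_sqr c.
have h3 : c ^+ 2 <= 1 by rewrite expr_le1 // ?ltW //; lra.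
have h4 : c ^+ 2 <= y by rewrite expr2; nra.
rewrite ler_norml expr2; apply/andP; split; nra.
Qed.

Lemma expR_taylor2 (x : R) : `|x| <= 2^-1 -> 0 <= expR x - 1 - x <= 2 * x ^+ 2.
Proof.
rewrite ler_norml => /andP[x1 x2]; apply/andP; split.
  by rewrite subr_ge0 lerBrDl expR_ge1Dx.
have := expR_ge1Dx (- x); rewrite expRN => h.
have e0 := expR_gt0 x.
have : (1 - x) * expR x <= 1.
  by rewrite -ler_pdivlMr // div1r.
have h5 := expR_ge1Dx x.
rewrite expr2 => h6.
have : (1-x) * (expR x - 1 - x - 2 * (x * x)) <= 0.
  have h8 : 0 <= (x * x) * (1 - 2 * x) by rewrite mulr_ge0 ?subr_ge0 -?expr2 ?sqr_ge0 //; lra.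
  rewrite (_ : _ * _ = (1 - x) * expR x - 1 - x * x * (1 - 2 * x) * 1); last by ring.
  lra.
move=> h7; rewrite -subr_le0.
by move: h7; rewrite pmulr_rle0 //; lra.
Qed.

Lemma expR_le2 (x : R) : `|x| <= 2^-1 -> expR x <= 2.
Proof.
move=> h; have /andP[_ h1] := expR_taylor2 h; move: h h1.
by rewrite ler_norml => /andP[a b]; rewrite expr2; nra.
Qed.

Lemma cexp_taylor2 h : cabs h <= 2^-1 -> cabs (cexp h - 1 - h) <= 8 * cabs h ^+ 2.
Proof.
move=> hh; apply: le_trans (cabs_le_ReIm _) _.
have := Re_le_cabs h; have := Im_le_cabs h; move: (cabs_ge0 h) hh.
rewrite /cexp !ReD !ImD !ReN !ImN.
move: (cabs h) => r r0 r1; case: h => x y /= hy hx.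
rewrite !(mul0r, mul1r, mulr0, addr0, add0r, subr0, oppr0).
have x1 : `|x| <= 2^-1 by apply: le_trans r1.
have y1 : `|y| <= 2^-1 by apply: le_trans r1.
have /andP[a1 a2] := expR_taylor2 x1; have a3 := expR_le2 x1.
have b1 := cos_ge_sqr y; have b2 := cos_le1 y; have b3 := sin_sub_le y1.
have e0 := expR_gt0 x.
have x2 : x ^+ 2 <= r ^+ 2 by rewrite -[x^+2]real_normK ?num_real // lerXn2r // nnegrE.
have y2 : y ^+ 2 <= r ^+ 2 by rewrite -[y^+2]real_normK ?num_real // lerXn2r // nnegrE.
have H1 : `|expR x * cos y - 1 - x| <= 4 * r ^+ 2.
  rewrite (_ : _ - x = (expR x - 1 - x) - expR x * (1 - cos y)); last by ring.
  have : 0 <= expR x * (1 - cos y) by rewrite mulr_ge0 ?subr_ge0 // ltW.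
  have : expR x * (1 - cos y) <= 2 * y ^+ 2 by apply: ler_pM; rewrite ?subr_ge0 // ltW.
  by rewrite ler_norml => h1 h2; apply/andP; split; lra.
have H2 : `|expR x * sin y - y| <= 4 * r ^+ 2.
  rewrite (_ : _ - y = expR x * (sin y - y) + (expR x - 1) * y); last by ring.
  have h1 : `|expR x * (sin y - y)| <= 2 * r ^+ 2.
    rewrite normrM (ger0_norm (ltW e0)); apply: ler_pM => //.
    exact: le_trans y2.
  have h2 : `|(expR x - 1) * y| <= 2 * r ^+ 2.
    rewrite normrM expr2 mulrA; apply: ler_pM => //.
    have : `|expR x - 1| <= 2 * `|x|.
      rewrite (_ : expR x - 1 = (expR x - 1 - x) + x); last by ring.
      apply: le_trans (ler_normD _ _) _; rewrite (ger0_norm a1).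
      suff : 2 * x ^+ 2 <= `|x| by lra.
      by rewrite -[x^+2]real_normK ?num_real // expr2; have := normr_ge0 x; nra.
    lra.
  by apply: le_trans (ler_normD _ _) _; lra.
lra.
Qed.

Lemma cexp_taylor1 h : cabs h <= 2^-1 -> cabs (cexp h - 1) <= 5 * cabs h.
Proof.
move=> hh; have := cexp_taylor2 hh; have := cabs_ge0 h.
have := ler_cabsD (cexp h - 1 - h) h; rewrite subrK expr2.
nra.
Qed.

(** Strict differentiability: increments are compared with the derivative at a third point v,
    uniformly over |e^v| <= K, as a Newton iteration with frozen derivative requires. The
    factorisation e^z = e^v e^f e^e with e = z - w, f = w - v reduces it to Taylor bounds at 0. *)
Lemma cexp_strict (K r : R) v z w : r <= 4^-1 -> cabs (cexp v) <= K ->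
  cabs (z - v) <= r -> cabs (w - v) <= r ->
  cabs (cexp z - cexp w - cexp v * (z - w)) <= 64 * K * r * cabs (z - w).
Proof.
move=> r4 hK hz hw.
have r0 : 0 <= r by apply: le_trans hz; apply: cabs_ge0.
have K0 : 0 <= K by apply: le_trans hK; apply: cabs_ge0.
set e := z - w; set f := w - v.
have he : cabs e <= 2 * r.
  by rewrite /e; apply: le_trans (ler_cabs_dist v _ _) _; rewrite (cabsBC v); lra.
have -> : cexp z - cexp w - cexp v * e
  = cexp v * (cexp f * (cexp e - 1 - e) + (cexp f - 1) * e).
  have -> : cexp z = cexp v * cexp f * cexp e.
    by rewrite -!cexpD; congr cexp; rewrite /e /f; ring.
  have -> : cexp w = cexp v * cexp f.
    by rewrite -!cexpD; congr cexp; rewrite /f; ring.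
  ring.
rewrite cabsM.
have hf1 : cabs (cexp f - 1) <= 5 * r.
  by apply: le_trans (cexp_taylor1 _) _; [lra|rewrite ler_pM2l //].
have hf2 : cabs (cexp f) <= 3.
  by have := ler_cabsD (cexp f - 1) 1; rewrite subrK cabs1; lra.
have he2 : cabs (cexp e - 1 - e) <= 16 * r * cabs e.
  apply: le_trans (cexp_taylor2 _) _; first lra.
  by rewrite expr2; have := cabs_ge0 e; nra.
have h1 : cabs (cexp f * (cexp e - 1 - e) + (cexp f - 1) * e) <= 53 * r * cabs e.
  apply: le_trans (ler_cabsD _ _) _; rewrite (cabsM (cexp f)) (cabsM (cexp f - 1)).
  have : cabs (cexp f) * cabs (cexp e - 1 - e) <= 3 * (16 * r * cabs e).
    by apply: ler_pM => //; exact: cabs_ge0.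
  have : cabs (cexp f - 1) * cabs e <= 5 * r * cabs e.
    by apply: ler_pM => //; exact: cabs_ge0.
  move=> h1 h2.  apply: le_trans (lerD h2 h1) _.
  by rewrite le_eqVlt; apply/orP; left; apply/eqP; ring.
apply: le_trans (_ : K * (53 * r * cabs e) <= _).
  by apply: ler_pM => //; exact: cabs_ge0.
have : 0 <= K * r * cabs e by rewrite !mulr_ge0 // cabs_ge0.
by move=> h2; lra.
Qed.

End ExpEstimates.

(** * Newton iteration in C^n *)

Section Vectors.
Variable R : realType.
Local Notation C := R[i].

Lemma geo_small (c e : R) : 0 < e -> exists N : nat, forall k, (N <= k)%N -> c / 2 ^+ k < e.
Proof.
move=> e0; exists (Num.bound (c / e)) => k hk.
rewrite ltr_pdivrMr ?exprn_gt0 // mulrC -ltr_pdivrMr //.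
apply: le_lt_trans (ler_norm _) _; apply: lt_le_trans (archi_boundP (normr_ge0 _)) _.
have -> : Num.bound `|c / e| = Num.bound (c / e) by rewrite /Num.bound normr_id.
by rewrite -natrX ler_nat (leq_trans hk) // ltnW // ltn_expl.
Qed.

Lemma le0_geo (x c : R) : (forall k, x <= c / 2 ^+ k) -> x <= 0.
Proof.
move=> h; rewrite leNgt; apply/negP => x0.
have [N hN] := geo_small c x0.
by have := lt_le_trans (hN N (leqnn N)) (h N); rewrite ltxx.
Qed.

(** The intervals with centre u k and radius 2d/2^k are nested, so the supremum of their left ends
    lies in all of them. *)
Lemma geo_cauchy_real (u : nat -> R) (d : R) :
  (forall k, `|u k.+1 - u k| <= d / 2 ^+ k) ->
  exists l, forall k, `|l - u k| <= 2 * d / 2 ^+ k.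
Proof.
move=> h; set e := fun k => 2 * d / 2 ^+ k : R.
have eS k : e k = d / 2 ^+ k + e k.+1.
  have : (2 : R) ^+ k != 0 by rewrite expf_neq0.
  by rewrite /e exprS => h0; field.
have lo k m : u k - e k <= u (k + m)%N - e (k + m)%N.
  elim: m => [|m IH]; first by rewrite addn0.
  apply: le_trans IH _; rewrite addnS (eS (k + m)%N).
  by have := h (k + m)%N; rewrite ler_norml => /andP[]; lra.
have hi k m : u (k + m)%N + e (k + m)%N <= u k + e k.
  elim: m => [|m IH]; first by rewrite addn0.
  apply: le_trans _ IH; rewrite addnS (eS (k + m)%N).
  by have := h (k + m)%N; rewrite ler_norml => /andP[]; lra.
have d0 : 0 <= d by have := le_trans (normr_ge0 _) (h 0%N); rewrite expr0 divr1.
have e0 k : 0 <= e k by rewrite /e divr_ge0 ?exprn_ge0 ?mulr_ge0.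
have lohi k m : u k - e k <= u m + e m.
  have h1 := lo k m; have h2 := hi m k; rewrite addnC in h2.
  by have := e0 (k + m)%N; lra.
pose S := [set x | exists k, x = u k - e k]%classic.
have hub k : ubound S (u k + e k) by move=> _ [m ->].
exists (sup S) => k; rewrite ler_norml; apply/andP; split.
  rewrite -/(e k) -lerBlDr opprK addrC.
  by apply: ub_le_sup; [exists (u 0%N + e 0%N); apply: hub | exists k].
rewrite lerBlDl; apply: ge_sup; last exact: hub.
by exists (u 0%N - e 0%N); exists 0%N.
Qed.

Lemma geo_cauchy (u : nat -> C) (d : R) :
  (forall k, cabs (u k.+1 - u k) <= d / 2 ^+ k) ->
  exists l, forall k, cabs (l - u k) <= 4 * d / 2 ^+ k.
Proof.
move=> h.
have [|a ha] := @geo_cauchy_real (fun k => complex.Re (u k)) d.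
  by move=> k; rewrite -ReN -ReD; apply: le_trans (Re_le_cabs _) (h k).
have [|b hb] := @geo_cauchy_real (fun k => complex.Im (u k)) d.
  by move=> k; rewrite -ImN -ImD; apply: le_trans (Im_le_cabs _) (h k).
exists (a +i* b) => k; apply: le_trans (cabs_le_ReIm _) _.
rewrite ReD ImD ReN ImN /=; have := ha k; have := hb k; lra.
Qed.

Section Norm.
Variable n : nat.
Local Notation V := ('I_n -> C).
Implicit Types x y z v : V.

Lemma vnorm_ge0 x : 0 <= vnorm x.
Proof. exact: bigmax_ge_id. Qed.

Lemma le_vnorm x i : cabs (x i) <= vnorm x.
Proof. exact: (le_bigmax _ (fun i => cabs (x i))). Qed.

Lemma vnorm_le x e : 0 <= e -> (forall i, cabs (x i) <= e) -> vnorm x <= e.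
Proof. by move=> e0 h; apply: bigmax_le. Qed.

Lemma ler_vnormD x y : vnorm (vadd x y) <= vnorm x + vnorm y.
Proof.
apply: vnorm_le => [|i]; first by rewrite addr_ge0 ?vnorm_ge0.
by apply: le_trans (ler_cabsD _ _) _; rewrite lerD ?le_vnorm.
Qed.

Lemma vnormBC x y : vnorm (vsub x y) = vnorm (vsub y x).
Proof. by apply: eq_bigr => i _; rewrite cabsBC. Qed.

Lemma ler_vdist z x y : vnorm (vsub x y) <= vnorm (vsub x z) + vnorm (vsub z y).
Proof.
rewrite (_ : vsub x y = vadd (vsub x z) (vsub z y)) ?ler_vnormD //.
by apply/funext => i; rewrite /vadd /vsub; ring.
Qed.

Lemma vsubxx x : vnorm (vsub x x) = 0.
Proof.
apply/eqP; rewrite eq_le vnorm_ge0 andbT.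
by apply: vnorm_le => // i; rewrite /vsub subrr cabs0.
Qed.

Lemma vnorm_le0 x y : vnorm (vsub x y) <= 0 -> x = y.
Proof.
move=> h; apply/funext => i; apply/eqP; rewrite -subr_eq0 -cabs_eq0.
by rewrite eq_le cabs_ge0 andbT; apply: le_trans (le_vnorm (vsub x y) i) h.
Qed.

Lemma vnorm0 : vnorm (fun _ : 'I_n => 0 : C) = 0.
Proof.
apply/eqP; rewrite eq_le vnorm_ge0 andbT; apply: vnorm_le => // i.
by rewrite cabs0.
Qed.

Lemma vsubx0 x : vsub x (fun _ => 0) = x.
Proof. by apply/funext => i; rewrite /vsub subr0. Qed.

Lemma vaddKx x y : vsub (vadd x y) x = y.
Proof. by apply/funext => i; rewrite /vadd /vsub; ring. Qed.

Lemma vnormZ (c : C) x : vnorm (fun i => c * x i) = cabs c * vnorm x.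
Proof.
apply/eqP; rewrite eq_le; apply/andP; split.
  apply: vnorm_le => [|i]; first by rewrite mulr_ge0 ?cabs_ge0 ?vnorm_ge0.
  by rewrite cabsM ler_wpM2l ?cabs_ge0 ?le_vnorm.
have [->|c0] := eqVneq c 0; first by rewrite cabs0 mul0r vnorm_ge0.
have cp : 0 < cabs c by rewrite lt_neqAle eq_sym cabs_eq0 c0 cabs_ge0.
rewrite mulrC -ler_pdivlMr //; apply: vnorm_le => [|i].
  by rewrite divr_ge0 ?vnorm_ge0 ?cabs_ge0.
by rewrite ler_pdivlMr // mulrC -cabsM; exact: (le_vnorm (fun i => c * x i)).
Qed.

Lemma vgeo_cauchy (u : nat -> V) (d : R) :
  (forall k, vnorm (vsub (u k.+1) (u k)) <= d / 2 ^+ k) ->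
  exists l, forall k, vnorm (vsub l (u k)) <= 4 * d / 2 ^+ k.
Proof.
move=> h.
have H i : exists l, forall k, cabs (l - u k i) <= 4 * d / 2 ^+ k.
  by apply: geo_cauchy => k; apply: le_trans (h k); exact: (le_vnorm (vsub _ _)).
have [l hl] := choice H; exists l => k; apply: vnorm_le => [|i]; last exact: hl.
have := le_trans (vnorm_ge0 _) (h k).
by rewrite -mulrA; apply: mulr_ge0.
Qed.

Definition mv (A : 'M[C]_n) v : V := fun i => \sum_j A i j * v j.

Lemma mvM A B v : mv (A *m B) v = mv A (mv B v).
Proof.
apply/funext => i; rewrite /mv.
under eq_bigr do rewrite mxE big_distrl /=.
rewrite exchange_big /=; apply: eq_bigr => j _.
by rewrite big_distrr /=; apply: eq_bigr => k _; rewrite mulrA.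
Qed.

Lemma mv1 v : mv 1%:M v = v.
Proof.
apply/funext => i; rewrite /mv (bigD1 i) //= mxE eqxx mul1r big1 ?addr0 // => j ji.
by rewrite mxE eq_sym (negbTE ji) mul0r.
Qed.

Lemma mvB A v w : mv A (vsub v w) = vsub (mv A v) (mv A w).
Proof.
apply/funext => i; rewrite /mv /vsub -sumrB; apply: eq_bigr => j _; by rewrite mulrBr.
Qed.

Lemma mv_bound (A : 'M[C]_n) (a : R) v : (forall i j, cabs (A i j) <= a) ->
  vnorm (mv A v) <= n%:R * a * vnorm v.
Proof.
move=> ha; apply: vnorm_le => [|i].
  have [n0|n0] := posnP n.
    by rewrite (_ : n%:R = 0 :> R) ?mul0r // n0.
  have a0 : 0 <= a by apply: le_trans (ha (Ordinal n0) (Ordinal n0)); exact: cabs_ge0.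
  by rewrite !mulr_ge0 ?vnorm_ge0.
apply: le_trans (ler_cabs_sum _ _ _) _.
apply: (@le_trans _ _ (\sum_(j < n) a * vnorm v)).
  apply: ler_sum => j _; rewrite cabsM; apply: ler_pM => //; rewrite ?cabs_ge0 //.
  exact: le_vnorm.
by rewrite sumr_const card_ord -[leLHS]mulr_natl mulrA.
Qed.

Lemma mv_bounded (A : 'M[C]_n) : exists2 L, 0 <= L & forall v, vnorm (mv A v) <= L * vnorm v.
Proof.
set a := \sum_i \sum_j cabs (A i j).
have a0 : 0 <= a by apply: sumr_ge0 => i _; apply: sumr_ge0 => j _; exact: cabs_ge0.
exists (n%:R * a); first by rewrite mulr_ge0.
move=> v; apply: mv_bound => i j; rewrite /a (bigD1 i) //= (bigD1 j) //= -addrA lerDl.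
rewrite addr_ge0 //; first by apply: sumr_ge0 => k _; exact: cabs_ge0.
by apply: sumr_ge0 => k _; apply: sumr_ge0 => l _; exact: cabs_ge0.
Qed.

(** The hypothesis of a quantitative inverse function theorem: K bounds the inverse of A, and the
    deviation of f from A on the ball has Lipschitz constant at most half of 1/K. Carrying rho and K
    explicitly lets one pair serve every centre on the path. *)
Definition near_linear (f : V -> V) (t0 : V) (A : 'M[C]_n) (rho K : R) : Prop :=
  [/\ A \in unitmx, 0 < K, (forall v, vnorm (mv (invmx A) v) <= K * vnorm v) &
   forall s t, vnorm (vsub s t0) <= rho -> vnorm (vsub t t0) <= rho ->
    vnorm (vsub (vsub (f s) (f t)) (mv A (vsub s t))) <= (2 * K)^-1 * vnorm (vsub s t)].

Section Newton.
Variables (f : V -> V) (t0 : V) (A : 'M[C]_n) (rho K : R).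
Hypothesis H : near_linear f t0 A rho K.

Lemma mvK v : mv (invmx A) (mv A v) = v.
Proof. by case: H => uA _ _ _; rewrite -mvM mulVmx // mv1. Qed.
Lemma mvVK v : mv A (mv (invmx A) v) = v.
Proof. by case: H => uA _ _ _; rewrite -mvM mulmxV // mv1. Qed.

Lemma near_linear_inj s t : vnorm (vsub s t0) <= rho -> vnorm (vsub t t0) <= rho ->
  vnorm (vsub s t) <= 2 * K * vnorm (vsub (f s) (f t)).
Proof.
case: H => uA K0 hB hf hs ht.
have h1 := hf s t hs ht.
have h2 := hB (mv A (vsub s t)); rewrite mvK in h2.
have h3 : vnorm (mv A (vsub s t)) <= vnorm (vsub (f s) (f t)) + (2 * K)^-1 * vnorm (vsub s t).
  rewrite -[mv A _]vsubx0; apply: le_trans (ler_vdist (vsub (f s) (f t)) _ _) _.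
  by rewrite vsubx0 vnormBC addrC lerD2l.
have h4 : K * ((2 * K)^-1 * vnorm (vsub s t)) = vnorm (vsub s t) / 2 by field; rewrite gt_eqF.
have h5 := ler_wpM2l (ltW K0) h3; rewrite mulrDr h4 in h5.
lra.
Qed.

(** Newton iteration with the derivative frozen at A. The first correction is at most rho/4 and each
    later one at most half of its predecessor, so all iterates stay within rho/2 of t0. *)
Lemma near_linear_surj x : 0 <= rho -> vnorm (vsub x (f t0)) <= rho / (4 * K) ->
  exists2 t, vnorm (vsub t t0) <= rho & f t = x.
Proof.
case: H => uA K0 hB hf rho0 hx.
pose N t := vsub t (mv (invmx A) (vsub (f t) x)).
pose u k := iter k N t0.
set d := rho / 4.
have d0 : 0 <= d by rewrite /d divr_ge0.
have rhoE : rho = 4 * d by rewrite /d; field.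
have stepA t : vsub (f t) x = mv A (vsub t (N t)).
  rewrite (_ : vsub t (N t) = mv (invmx A) (vsub (f t) x)) ?mvVK //.
  by apply/funext => i; rewrite /N /vsub; ring.
have p2 k : 0 < (2 : R) ^+ k by rewrite exprn_gt0.
(* Since A (N a - a) cancels the residual x - f a, the next correction consists only of the
   linearisation error of f between a and N a; the halving follows. *)
have dbl a : vsub (N (N a)) (N a)
  = mv (invmx A) (vsub (fun=> 0) (vsub (vsub (f (N a)) (f a)) (mv A (vsub (N a) a)))).
  have := stepA a; have := stepA (N a); move: (N a) => b; move: (N b) => c s2 s1.
  rewrite -[LHS]mvK; congr (mv _ _); rewrite (mvB _ c b) (mvB _ b a).
  rewrite (mvB _ b c) in s2; rewrite (mvB _ a b) in s1.
  apply/funext => i; move/(congr1 (@^~ i)): s1; move/(congr1 (@^~ i)): s2.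
  rewrite /vsub; move: (mv A a i) (mv A b i) (mv A c i) => A1 A2 A3 s2 s1.
  have -> : f b i - f a i = (f b i - x i) - (f a i - x i) by ring.
  by rewrite s1 s2; ring.
have step k : vnorm (vsub (u k) t0) <= 2 * d - 2 * d / 2 ^+ k /\
    vnorm (vsub (u k.+1) (u k)) <= d / 2 ^+ k.
  elim: k => [|k [IH1 IH2]].
    rewrite /u /= vsubxx expr0 !divr1 subrr; split=> //.
    rewrite (_ : vsub (N t0) t0 = mv (invmx A) (vsub x (f t0))).
      apply: le_trans (hB _) _; apply: le_trans (ler_wpM2l (ltW K0) hx) _.
      by rewrite /d le_eqVlt; apply/orP; left; apply/eqP; field; rewrite gt_eqF.
    rewrite (_ : vsub x (f t0) = vsub (fun=> 0) (vsub (f t0) x)); last first.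
      by apply/funext => i; rewrite /vsub; ring.
    rewrite mvB; apply/funext => i; rewrite /N /vsub.
    by rewrite [mv _ (fun=> 0) i]big1 ?[mv _ _ i in RHS]/= => [|j _]; [ring|rewrite mulr0].
  have e1 : 2 * d / 2 ^+ k = d / 2 ^+ k + d / 2 ^+ k by ring.
  have e2 : 2 * d / 2 ^+ k.+1 = d / 2 ^+ k by rewrite exprS; field; rewrite gt_eqF.
  have e3 : d / 2 ^+ k.+1 = d / 2 ^+ k / 2 by rewrite exprS; field; rewrite gt_eqF.
  have q0 : 0 <= d / 2 ^+ k by rewrite divr_ge0 // ltW.
  have i1 : vnorm (vsub (u k.+1) t0) <= 2 * d - 2 * d / 2 ^+ k.+1.
    by apply: le_trans (ler_vdist (u k) _ _) _; rewrite e2; lra.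
  split=> //; rewrite e3.
  have in1 : vnorm (vsub (u k) t0) <= rho by rewrite rhoE; lra.
  have in2 : vnorm (vsub (u k.+1) t0) <= rho by rewrite rhoE; lra.
  have := hf _ _ in2 in1.
  set w := vsub (u k.+1) (u k) => hw.
  have -> : vsub (u k.+2) (u k.+1) = _ := dbl (u k).
  apply: le_trans (hB _) _; rewrite vnormBC vsubx0.
  apply: le_trans (ler_wpM2l (ltW K0) hw) _.
  have -> : K * ((2 * K)^-1 * vnorm w) = vnorm w / 2 by field; rewrite gt_eqF.
  by rewrite ler_pM2r ?invr_gt0.
have [t ht] := @vgeo_cauchy u d (fun k => (step k).2).
have htr : vnorm (vsub t t0) <= rho.
  by have := ht 0%N; rewrite /u /= expr0 divr1 rhoE; lra.
exists t => //; apply: vnorm_le0.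
have [L L0 hL] := mv_bounded A.
(* The first summand is the Lipschitz constant of f on the ball times the distance from the limit to
   u k; the second bounds the residual at u k, which is A applied to a correction. *)
apply: (@le0_geo _ ((L + (2 * K)^-1) * (4 * d) + L * d)) => k.
have in1 : vnorm (vsub (u k) t0) <= rho.
  have q0 : 0 <= d / 2 ^+ k by rewrite divr_ge0 // ltW.
  apply: le_trans (step k).1 _; by rewrite rhoE -mulrA; lra.
apply: le_trans (ler_vdist (f (u k)) _ _) _; rewrite [leRHS]mulrDl; apply: lerD.
  apply: (@le_trans _ _ ((L + (2 * K)^-1) * vnorm (vsub t (u k)))).
    rewrite -[vsub (f t) _]vsubx0.
    apply: le_trans (ler_vdist (mv A (vsub t (u k))) _ _) _.
    by rewrite vsubx0 addrC mulrDl; apply: lerD; [exact: hL | exact: hf].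
  rewrite -mulrA; apply: ler_wpM2l; last exact: ht.
  by apply: addr_ge0 => //; rewrite invr_ge0; apply: mulr_ge0 => //; exact: ltW.
rewrite stepA; apply: le_trans (hL _) _; rewrite -mulrA ler_wpM2l //.
by rewrite vnormBC; exact: (step k).2.
Qed.

End Newton.
End Norm.
End Vectors.

(** * The map [Emap] *)

Section Emap.
Variable R : realType.
Local Notation C := R[i].

Lemma det_bound n (A : 'M[C]_n) (a : R) : (forall i j, cabs (A i j) <= a) ->
  cabs (\det A) <= (n`!)%:R * a ^+ n.
Proof.
move=> ha; apply: le_trans (ler_cabs_sum _ _ _) _.
apply: (@le_trans _ _ (\sum_(s : 'S_n) a ^+ n)); last first.
  by rewrite sumr_const card_Sn -[leLHS]mulr_natl.
apply: ler_sum => s _; rewrite cabsM cabsX cabsN cabs1 expr1n mul1r cabs_prod.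
apply: le_trans (_ : \prod_(i < n) a <= _); last by rewrite prodr_const card_ord.
by apply: ler_prod => i _; rewrite cabs_ge0 ha.
Qed.

Lemma invmx_bound n (A : 'M[C]_n) (a c : R) : (forall i j, cabs (A i j) <= a) ->
  0 < c -> c <= cabs (\det A) ->
  forall i j, cabs (invmx A i j) <= (n.-1)`!%:R * a ^+ n.-1 / c.
Proof.
move=> ha c0 hc i j.
have d0 : \det A != 0 by rewrite -cabs_eq0 gt_eqF // (lt_le_trans c0).
rewrite /invmx unitmxE unitfE d0 !mxE cabsM cabsV mulrC.
have a0 : 0 <= a by apply: le_trans (ha i j); exact: cabs_ge0.
apply: ler_pM; rewrite ?cabs_ge0 ?invr_ge0 ?cabs_ge0 //.
  rewrite /cofactor cabsM cabsX cabsN cabs1 expr1n mul1r.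
  by apply: det_bound => k l; rewrite !mxE.
by rewrite lef_pV2 // posrE // (lt_le_trans c0).
Qed.

Variable n : nat.
Local Notation V := ('I_n -> C).
Implicit Types (s t v : V) (M : 'M[R]_n).

Definition lf M t : V := mv (map_mx (real_complex R) M) t.

Definition Emap M t : V := fun i => (1 - cexp (t i)) * cexp (- lf M t i).

(** The Jacobian matrix of [Emap M], with the nonvanishing factor -e^{-(Mt)_i} taken out of row i;
    its determinant then vanishes exactly with that of a matrix built from the e^{t_i} and M. *)
Definition dE M t : 'M[C]_n :=
  \matrix_(i, j) (- cexp (- lf M t i) *
     ((1 - cexp (t i)) * (M i j)%:C + (i == j)%:R * cexp (t i))).

Lemma lfB M s t i : lf M (vsub s t) i = lf M s i - lf M t i.
Proof. by rewrite /lf mvB. Qed.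

Lemma lf_bound M : exists2 m : R, 0 < m & forall t i, cabs (lf M t i) <= m * vnorm t.
Proof.
have [L L0 hL] := mv_bounded (map_mx (real_complex R) M).
exists (L + 1) => [|t i]; first by rewrite ltr_wpDl.
apply: le_trans (le_vnorm _ _) _; apply: le_trans (hL t) _.
by rewrite ler_wpM2r ?vnorm_ge0 // lerDl.
Qed.

Lemma EmapE M t i : Emap M t i = cexp (- lf M t i) - cexp (t i - lf M t i).
Proof. by rewrite /Emap mulrBl mul1r -cexpD. Qed.

Lemma dE_mv M t v i : mv (dE M t) v i =
  cexp (- lf M t i) * (- lf M v i) - cexp (t i - lf M t i) * (v i - lf M v i).
Proof.
rewrite /mv; under eq_bigr do rewrite mxE -mulrA mulrDl.
rewrite -big_distrr /= big_split /=.
have -> : \sum_(j < n) (1 - cexp (t i)) * (M i j)%:C * v j = (1 - cexp (t i)) * lf M v i.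
  by rewrite /lf /mv big_distrr /=; apply: eq_bigr => j _; rewrite mxE mulrA.
rewrite [X in _ + X](bigD1 i) //= eqxx mul1r big1 ?addr0; last first.
  by move=> j ji; rewrite eq_sym (negbTE ji) !mul0r.
by rewrite cexpD; ring.
Qed.

Lemma dE_bound M (Rb : R) : exists a : R, forall t, vnorm t <= Rb ->
  forall i j, cabs (dE M t i j) <= a.
Proof.
have [m m0 hm] := lf_bound M.
pose b := \sum_i \sum_j `|M i j|.
have hb i j : `|M i j| <= b.
  rewrite /b (bigD1 i) //= (bigD1 j) //= -addrA lerDl.
  rewrite addr_ge0 //; first by apply: sumr_ge0 => k _.
  by apply: sumr_ge0 => k _; apply: sumr_ge0 => l _.
exists (expR (m * Rb) * ((1 + expR Rb) * b + expR Rb)) => t ht i j.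
have e1 : cabs (cexp (t i)) <= expR Rb.
  rewrite cabs_cexp ler_expR; apply: le_trans (ler_norm _) _.
  by apply: le_trans (Re_le_cabs _) _; apply: le_trans (le_vnorm _ _) ht.
rewrite mxE cabsM cabsN; apply: ler_pM; rewrite ?cabs_ge0 //.
  rewrite cabs_cexp ler_expR; apply: le_trans (ler_norm _) _.
  apply: le_trans (Re_le_cabs _) _; rewrite cabsN; apply: le_trans (hm _ _) _.
  by rewrite ler_wpM2l // ltW.
apply: le_trans (ler_cabsD _ _) _; apply: lerD; rewrite (cabsM _ _).
  apply: ler_pM; rewrite ?cabs_ge0 ?cabs_real //.
  by apply: le_trans (ler_cabsB _ _) _; rewrite cabs1 lerD2l.
apply: le_trans e1; rewrite -[leRHS]mul1r ler_wpM2r ?cabs_ge0 // cabs_nat.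
by case: (i == j).
Qed.

(** Each coordinate is a difference of two exponentials of linear forms, so [cexp_strict] applies to
    both. The error is linear in rho, hence shrinking the ball meets any contraction constant,
    uniformly over bounded sets of centres. *)
Lemma Emap_strict M : exists2 rho0 : R, 0 < rho0 & forall Rb : R, exists2 L : R, 0 < L &
  forall t0, vnorm t0 <= Rb -> forall rho, rho <= rho0 ->
  forall s t, vnorm (vsub s t0) <= rho -> vnorm (vsub t t0) <= rho ->
  vnorm (vsub (vsub (Emap M s) (Emap M t)) (mv (dE M t0) (vsub s t)))
    <= L * rho * vnorm (vsub s t).
Proof.
have [m m0 hm] := lf_bound M.
have m1 : 0 < 1 + m by rewrite addr_gt0.
exists (4 * (1 + m))^-1; first by rewrite invr_gt0 mulr_gt0.
move=> Rb; set K := expR ((1 + m) * Rb).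
have K0 : 0 < K by exact: expR_gt0.
(* Two exponentials contribute 64 each; one factor 1 + m turns the radius of the ball into a radius
   for the exponents, the other does so for the increment. *)
exists (128 * K * (1 + m) ^+ 2); first by rewrite !mulr_gt0 ?exprn_gt0.
move=> t0 ht0 rho hrho s t hs ht.
have rho0 : 0 <= rho by apply: le_trans hs; exact: vnorm_ge0.
apply: vnorm_le => [|i].
  by rewrite !mulr_ge0 ?vnorm_ge0 ?exprn_ge0 // ltW.
have hr : (1 + m) * rho <= 4^-1.
  apply: le_trans (ler_wpM2l (ltW m1) hrho) _.
  by rewrite le_eqVlt; apply/orP; left; apply/eqP; field; rewrite gt_eqF.
rewrite -[vsub (vsub _ _) _ i]/(Emap M s i - Emap M t i - mv (dE M t0) (vsub s t) i).
rewrite dE_mv !EmapE.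
have A1 v : cabs (- lf M v i) <= (1 + m) * vnorm v.
  rewrite cabsN; apply: le_trans (hm v i) _.
  by rewrite ler_wpM2r ?vnorm_ge0 // lerDr.
have A2 v : cabs (v i - lf M v i) <= (1 + m) * vnorm v.
  apply: le_trans (ler_cabsB _ _) _; rewrite mulrDl mul1r lerD //.
  exact: le_vnorm.
have hK z : cabs z <= (1 + m) * vnorm t0 -> cabs (cexp z) <= K.
  move=> hz; rewrite cabs_cexp ler_expR; apply: le_trans (ler_norm _) _.
  apply: le_trans (Re_le_cabs _) _; apply: le_trans hz _.
  by rewrite ler_wpM2l // ltW.
have B (u1 u2 u0 : C) w : u1 - u2 = w -> cabs w <= (1 + m) * vnorm (vsub s t) ->
   cabs (cexp u0) <= K ->
   cabs (u1 - u0) <= (1 + m) * rho -> cabs (u2 - u0) <= (1 + m) * rho ->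
   cabs (cexp u1 - cexp u2 - cexp u0 * w) <= 64 * K * (1 + m) ^+ 2 * rho * vnorm (vsub s t).
  move=> <- hw hu0 h1 h2; apply: le_trans (cexp_strict hr hu0 h1 h2) _.
  have -> : 64 * K * (1 + m) ^+ 2 * rho * vnorm (vsub s t) =
     64 * K * ((1 + m) * rho) * ((1 + m) * vnorm (vsub s t)) by ring.
  by rewrite ler_wpM2l // !mulr_ge0 // ltW.
have C1 : cabs (- lf M s i - - lf M t0 i) <= (1 + m) * rho.
  rewrite (_ : _ - _ = - lf M (vsub s t0) i); last by rewrite lfB; ring.
  by apply: le_trans (A1 _) _; rewrite ler_wpM2l // ltW.
have C2 : cabs (- lf M t i - - lf M t0 i) <= (1 + m) * rho.
  rewrite (_ : _ - _ = - lf M (vsub t t0) i); last by rewrite lfB; ring.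
  by apply: le_trans (A1 _) _; rewrite ler_wpM2l // ltW.
have C3 : cabs (s i - lf M s i - (t0 i - lf M t0 i)) <= (1 + m) * rho.
  rewrite (_ : _ - _ = vsub s t0 i - lf M (vsub s t0) i); last by rewrite lfB /vsub; ring.
  by apply: le_trans (A2 _) _; rewrite ler_wpM2l // ltW.
have C4 : cabs (t i - lf M t i - (t0 i - lf M t0 i)) <= (1 + m) * rho.
  rewrite (_ : _ - _ = vsub t t0 i - lf M (vsub t t0) i); last by rewrite lfB /vsub; ring.
  by apply: le_trans (A2 _) _; rewrite ler_wpM2l // ltW.
have D1 := B _ _ _ (- lf M (vsub s t) i) _ (A1 _) (hK _ (A1 t0)) C1 C2.
have D2 := B _ _ _ (vsub s t i - lf M (vsub s t) i) _ (A2 _) (hK _ (A2 t0)) C3 C4.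
have {}D1 := D1 ltac:(by rewrite lfB; ring).
have {}D2 := D2 ltac:(by rewrite lfB /vsub; ring).
set x1 := cexp (- lf M s i) in D1 *; set x2 := cexp (- lf M t i) in D1 *.
set y1 := cexp (s i - _) in D2 *; set y2 := cexp (t i - _) in D2 *.
set w1 := cexp _ * _ in D1 *; set w2 := cexp _ * _ in D2 *.
rewrite (_ : _ - _ - _ = (x1 - x2 - w1) - (y1 - y2 - w2)).
  by apply: le_trans (ler_cabsB _ _) _; lra.
by rewrite /x1 /x2 /y1 /y2 /w1 /w2; ring.
Qed.

(** A lower bound on the determinant and an upper bound on the entries control the inverse through
    cofactors. One radius therefore works for all such centres in a bounded set, which gives the
    tube a constant thickness. *)
Lemma Emap_near_linear M (Rb c : R) : 0 < c ->
  exists rho K : R, [/\ 0 < rho, 0 < K & forall t0, vnorm t0 <= Rb ->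
    c <= cabs (\det (dE M t0)) -> near_linear (Emap M) t0 (dE M t0) rho K].
Proof.
move=> c0.
have [rho0 rho00 /(_ Rb) [L L0 hL]] := Emap_strict M.
have [a ha] := dE_bound M Rb.
pose b := (n.-1)`!%:R * a ^+ n.-1 / c.
pose K := n%:R * `|b| + 1.
have K0 : 0 < K by rewrite /K ltr_wpDl // mulr_ge0.
exists (Num.min rho0 (2 * K * L)^-1), K; split => //.
  by rewrite lt_min rho00 invr_gt0 !mulr_gt0.
move=> t0 ht0 hc; split => //.
- by rewrite unitmxE unitfE -cabs_eq0 gt_eqF // (lt_le_trans c0).
- move=> v; have := mv_bound v (invmx_bound (ha _ ht0) c0 hc).
  move/le_trans; apply; rewrite ler_wpM2r ?vnorm_ge0 //.
  by rewrite -/b /K -[leLHS]addr0 lerD // ler_wpM2l // ler_norm.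
move=> s t hs ht; set rho := Num.min _ _ in hs ht *.
have h1 : rho <= rho0 by rewrite ge_min lexx.
have h2 : rho <= (2 * K * L)^-1 by rewrite ge_min lexx orbT.
apply: le_trans (hL t0 ht0 rho h1 s t hs ht) _; rewrite ler_wpM2r ?vnorm_ge0 //.
apply: le_trans (ler_wpM2l (ltW L0) h2) _.
by rewrite le_eqVlt; apply/orP; left; apply/eqP; field; rewrite !gt_eqF.
Qed.

Lemma near_linear_sub (f : V -> V) t0 A rho K rho' : rho' <= rho ->
  near_linear f t0 A rho K -> near_linear f t0 A rho' K.
Proof.
move=> h [h1 h2 h3 h4]; split => // s t hs ht.
by apply: h4; [apply: le_trans hs h | apply: le_trans ht h].
Qed.

(* An estimate [|s - t| <= 2K |f s - f t|] forbids a kernel for the derivative. *)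
Lemma Emap_det_neq0 M t0 A rho K t : near_linear (Emap M) t0 A rho K ->
  vnorm (vsub t t0) < rho -> \det (dE M t) != 0.
Proof.
move=> H ht; apply/negP; rewrite -det_tr => /det0P [v v0 hv].
have [_ K0 _ _] := H.
pose w : V := fun i => v 0 i.
have hw : mv (dE M t) w = fun=> 0.
  apply/funext => i; move/matrixP/(_ 0 i): hv; rewrite !mxE => <-.
  by apply: eq_bigr => j _; rewrite !mxE mulrC.
have w0 : 0 < vnorm w.
  rewrite lt_neqAle vnorm_ge0 andbT eq_sym; apply: contra v0 => /eqP h.
  apply/eqP/rowP => i; rewrite mxE; apply/eqP; rewrite -cabs_eq0 eq_le cabs_ge0 andbT.
  by rewrite -h; exact: (le_vnorm w i).
have [rho0 rho00 /(_ (vnorm t)) [L L0 hL]] := Emap_strict M.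
pose e := Num.min (rho - vnorm (vsub t t0)) (Num.min rho0 (4 * K * L)^-1).
have e0 : 0 < e by rewrite !lt_min subr_gt0 ht rho00 invr_gt0 !mulr_gt0.
pose u : V := fun i => (e / vnorm w)%:C * w i.
have hu : vnorm u = e.
  by rewrite vnormZ cabs_real ger0_norm ?divfK ?gt_eqF // divr_ge0 // ltW.
have in1 : vnorm (vsub (vadd t u) t0) <= rho.
  apply: le_trans (ler_vdist t _ _) _; rewrite vaddKx hu.
  have : e <= rho - vnorm (vsub t t0) by rewrite ge_min lexx.
  lra.
have h1 := near_linear_inj H in1 (ltW ht); rewrite vaddKx hu in h1.
have e1 : e <= rho0 by rewrite !ge_min lexx orbT.
have e2 : e <= (4 * K * L)^-1 by rewrite !ge_min lexx !orbT.
have := hL t (lexx _) e e1 (vadd t u) t; rewrite vaddKx hu vsubxx => /(_ (lexx _) (ltW e0)).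
have -> : mv (dE M t) u = fun=> 0.
  apply/funext => i; move/(congr1 (@^~ i)): hw; rewrite /mv /u /= => hw.
  under eq_bigr do rewrite mulrCA.
  by rewrite -big_distrr /= hw mulr0.
rewrite vsubx0 => h2.
have h3 : e <= 2 * K * (L * e * e) by apply: le_trans h1 _; rewrite ler_wpM2l // mulr_ge0 // ltW.
have h4 : 4 * K * L * e <= 1.
  rewrite mulrC -ler_pdivlMr ?div1r //; by rewrite !mulr_gt0.
have : 2 * K * (L * e * e) = (4 * K * L * e) * e / 2 by field.
by move=> h5; rewrite h5 in h3; nra.
Qed.

Lemma Emap_local M t : \det (dE M t) != 0 -> exists rho K : R,
  [/\ 0 < rho, 0 < K & near_linear (Emap M) t (dE M t) rho K].
Proof.
move=> h; have c0 : 0 < cabs (\det (dE M t)).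
  by rewrite lt_neqAle eq_sym cabs_eq0 h cabs_ge0.
have [rho [K [h1 h2 h3]]] := @Emap_near_linear M (vnorm t) _ c0.
by exists rho, K; split => //; exact: h3.
Qed.

Lemma Emap0 M : Emap M (fun _ : 'I_n => 0 : C) = fun _ => 0.
Proof. by apply/funext => i; rewrite /Emap cexp0 subrr mul0r. Qed.

Lemma det_dE_0 M : \det (dE M (fun _ => 0)) != 0.
Proof.
have -> : dE M (fun _ => 0) = - 1%:M.
  apply/matrixP => i j; rewrite !mxE cexp0 subrr mul0r add0r mulr1.
  have -> : lf M (fun _ : 'I_n => 0) i = 0 by rewrite /lf /mv big1 // => k _; rewrite mulr0.
  by rewrite oppr0 cexp0 mulN1r.
by rewrite -scaleN1r detZ det1 mulr1 expf_neq0 // oppr_eq0 oner_eq0.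
Qed.

Section Inverse.
Variables (M : 'M[R]_n) (P : V -> Prop).
Hypothesis Popen : open_set P.
Hypothesis Pdet : forall t, P t -> \det (dE M t) != 0.
Let D x := exists2 t, P t & Emap M t = x.

(** K is fixed before r, so the preimages found near t depend on x in a Lipschitz manner at Emap t,
    with a constant that survives shrinking r. *)
Lemma Emap_image_near t : P t -> exists2 K : R, 0 < K & forall r : R, 0 < r ->
  exists2 dl : R, 0 < dl & forall x, vnorm (vsub x (Emap M t)) < dl ->
  exists2 s, [/\ P s, vnorm (vsub s t) <= r & Emap M s = x] &
     vnorm (vsub s t) <= 2 * K * vnorm (vsub x (Emap M t)).
Proof.
move=> Pt; have [e e0 he] := Popen Pt.
have [rho [K [rho0 K0 H]]] := Emap_local (Pdet Pt).
exists K => // r r0.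
pose r' := Num.min r (Num.min rho (e / 2)).
have r'0 : 0 < r' by rewrite !lt_min r0 rho0 divr_gt0.
exists (r' / (4 * K)) => [|x hx]; first by rewrite divr_gt0 // mulr_gt0.
have r'1 : r' <= rho by rewrite !ge_min lexx orbT.
have H' := near_linear_sub r'1 H.
have [s hs Es] := near_linear_surj H' (ltW r'0) (ltW hx).
exists s.
  split => //; last by apply: le_trans hs _; rewrite ge_min lexx.
  apply: he; apply: le_lt_trans hs _.
  by rewrite /r' !gt_min; apply/orP; right; apply/orP; right; rewrite ltr_pdivrMr // ltr_pMr // ltr1n.
rewrite -Es; apply: (near_linear_inj H') => //.
by rewrite vsubxx ltW.
Qed.

Lemma Emap_image_open : open_set D.
Proof.
move=> x [t Pt <-]; have [K K0 /(_ 1 ltr01) [dl dl0 h]] := Emap_image_near Pt.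
by exists dl => // y hy; have [s [Ps _ Es] _] := h y hy; exists s.
Qed.

(** The derivative is that of e^{<c, t>} composed with the inverse Jacobian. Nearby values of F are
    computed at the preimage supplied by local inversion. *)
Lemma Emap_inverse_holo (F : V -> C) (c : V) :
  (forall t, P t -> F (Emap M t) = cexp (\sum_i c i * t i)) -> holomorphic_on D F.
Proof.
move=> HF x [t Pt <-].
have ut : dE M t \in unitmx by rewrite unitmxE unitfE Pdet.
have [K K0 hK] := Emap_image_near Pt.
have [KB KB0 hKB] := mv_bounded (invmx (dE M t)).
have [rho0 rho00 /(_ (vnorm t)) [L L0 hL]] := Emap_strict M.
pose cc := \sum_i cabs (c i).
have cc0 : 0 <= cc by apply: sumr_ge0 => i _; exact: cabs_ge0.
have hcc v : cabs (\sum_i c i * v i) <= cc * vnorm v.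
  apply: le_trans (ler_cabs_sum _ _ _) _; rewrite /cc mulr_suml.
  by apply: ler_sum => i _; rewrite cabsM ler_wpM2l ?cabs_ge0 ?le_vnorm.
pose phi := cexp (\sum_i c i * t i).
pose B := invmx (dE M t).
exists (fun i => phi * \sum_j c j * B j i) => e e0.
(* The two quadratic errors in w = s - t: the Taylor remainder of the exponential, and the
   linearisation error of [Emap] carried through the inverse Jacobian. The later factor (2K)^2
   converts |w|^2 into |h|^2. *)
pose Q := cabs phi * (8 * cc ^+ 2 + cc * (KB * L)).
have Q0 : 0 <= Q.
  by rewrite !(mulr_ge0, addr_ge0, cabs_ge0, exprn_ge0) // ltW.
pose r := Num.min rho0 (2 * (cc + 1))^-1.
have r0 : 0 < r by rewrite lt_min rho00 invr_gt0 mulr_gt0 // ltr_wpDl.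
have [dl dl0 hdl] := hK r r0.
exists (Num.min dl (e / (Q * (2 * K) ^+ 2 + 1))).
  by rewrite lt_min dl0 divr_gt0 // ltr_wpDl // mulr_ge0 // exprn_ge0 // mulr_ge0 // ltW.
move=> h; rewrite lt_min => /andP[h1 h2].
have [|s [Ps hsr Es] hs] := hdl (vadd (Emap M t) h); first by rewrite vaddKx.
rewrite vaddKx in hs; rewrite -Es !HF // -/phi.
set w := vsub s t in hs hsr.
have hw2 : cabs (\sum_i c i * w i) <= 2^-1.
  apply: le_trans (hcc w) _; apply: le_trans (ler_wpM2l cc0 hsr) _.
  have : r <= (2 * (cc + 1))^-1 by rewrite ge_min lexx orbT.
  move/(ler_wpM2l cc0)/le_trans; apply.
  by rewrite ler_pdivrMr ?mulr_gt0 ?ltr_wpDl //; lra.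
have -> : cexp (\sum_i c i * s i) = phi * cexp (\sum_i c i * w i).
  rewrite /phi -cexpD; congr cexp; rewrite -big_split /=; apply: eq_bigr => i _.
  by rewrite /w /vsub; ring.
have -> : \sum_i (phi * \sum_j c j * B j i) * h i = phi * \sum_j c j * mv B h j.
  rewrite /mv; under eq_bigr do rewrite -mulrA big_distrl.
  rewrite -big_distrr /= exchange_big /=; congr (_ * _); apply: eq_bigr => i _.
  by rewrite big_distrr; apply: eq_bigr => j _; rewrite /= mulrA.
have -> : phi * cexp (\sum_i c i * w i) - phi - phi * (\sum_j c j * mv B h j)
  = phi * ((cexp (\sum_i c i * w i) - 1 - \sum_i c i * w i)
           + \sum_j c j * (vsub w (mv B h)) j).
  have -> : \sum_j c j * vsub w (mv B h) j
    = \sum_i c i * w i - \sum_j c j * mv B h j.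
    by rewrite -sumrB; apply: eq_bigr => j _; rewrite /vsub mulrBr.
  ring.
have hz : vnorm (vsub w (mv B h)) <= KB * L * vnorm w ^+ 2.
  have -> : vsub w (mv B h) = mv B (vsub (fun=> 0) (vsub h (mv (dE M t) w))).
    rewrite -{1}[w]mv1 -(mulVmx ut) mvM -mvB; congr (mv _ _).
    by apply/funext => i; rewrite /vsub; ring.
  apply: le_trans (hKB _) _; rewrite -mulrA ler_wpM2l // vnormBC vsubx0.
  have hr : vnorm w <= rho0 by apply: le_trans hsr _; rewrite ge_min lexx.
  have := hL t (lexx _) (vnorm w) hr s t (lexx _).
  rewrite vsubxx => /(_ (vnorm_ge0 _)); rewrite -/w Es vaddKx.
  by rewrite expr2 mulrA.
have step : cabs (phi * ((cexp (\sum_i c i * w i) - 1 - \sum_i c i * w i)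
           + \sum_j c j * (vsub w (mv B h)) j)) <= Q * vnorm w ^+ 2.
  rewrite /Q (cabsM phi) -mulrA ler_wpM2l ?cabs_ge0 //.
  apply: le_trans (ler_cabsD _ _) _; rewrite mulrDl; apply: lerD.
    apply: le_trans (cexp_taylor2 hw2) _; rewrite -mulrA -exprMn ler_wpM2l //.
    by rewrite lerXn2r // nnegrE ?cabs_ge0 ?mulr_ge0 ?vnorm_ge0.
  apply: le_trans (hcc _) _; rewrite -mulrA ler_wpM2l //.
apply: le_trans step _.
have g0 : 0 < Q * (2 * K) ^+ 2 + 1.
  by rewrite ltr_wpDl // mulr_ge0 // exprn_ge0 // mulr_ge0 // ltW.
move: h2; rewrite ltr_pdivlMr // => h2.
have n0 := vnorm_ge0 h.
have hw3 : vnorm w ^+ 2 <= (2 * K * vnorm h) ^+ 2.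
  by rewrite lerXn2r // nnegrE ?vnorm_ge0 // mulr_ge0 // mulr_ge0 // ltW.
apply: le_trans (ler_wpM2l Q0 hw3) _.
have -> : Q * (2 * K * vnorm h) ^+ 2 = (vnorm h * (Q * (2 * K) ^+ 2 + 1) - vnorm h) * vnorm h.
  by ring.
by rewrite ler_wpM2r //; lra.
Qed.

End Inverse.
End Emap.

(** * The coefficients and their difference equations *)

Section Coefficients.
Variable R : realType.
Local Notation C := R[i].
Variable n : nat.
Variable B : 'M[R]_n.
Implicit Types (A a b : 'cV[R]_n) (k : 'I_n -> nat).

(* [ck_at A k] is [ck] with [avec k] replaced by a free vector [A]; in this form the
   dependence on [A] for fixed [k] obeys a difference equation. *)
Definition dmx A k : 'M[R]_n :=
  \matrix_(r, c) (if k c == 0%N then (r == c)%:R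
                  else (r == c)%:R * A c 0 - B r c * (k c)%:R).

Definition ck_at A k : R :=
  (-1) ^+ (\sum_(i < n) k i) / ((\prod_(i < n) (k i)`!)%:R)
  * (\prod_(i < n | k i != 0%N) \prod_(1 <= j < k i) (A i 0 - j%:R))
  * \det (dmx A k).

Definition dcol (i : 'I_n) : 'cV[R]_n := delta_mx i 0.

Definition kdec (i : 'I_n) k : 'I_n -> nat := fun j => (k j - (j == i))%N.

(** The part of [ck_at] that sees x = A_i and m = k_i. Expanding the determinant along column i
    gives x U - W m, where U is the diagonal cofactor and W the determinant with column i replaced
    by that of B; for m = 0 the cancelled column e_i leaves U. *)
Definition coef_fac (m : nat) (x U W : R) : R :=
  (-1) ^+ m / m`!%:R * (\prod_(1 <= j < m) (x - j%:R))
  * (if m == 0%N then U else x * U - W * m%:R).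

(* Telescoping in [x], the one-variable shadow of [1 - p = x p^b]. *)
Lemma coef_fac_rec m x U W :
  coef_fac m.+1 x U W - coef_fac m.+1 (x + 1) U W = coef_fac m x U W.
Proof.
rewrite /coef_fac /= exprS factS natrM.
have f0 : (m`!%:R : R) != 0 by rewrite pnatr_eq0 -lt0n fact_gt0.
have m0 : (m.+1%:R : R) != 0 by rewrite pnatr_eq0.
case: m f0 m0 => [|m] f0 m0.
  by rewrite !big_geq // !(fact0, expr0, mulr1n, mulr1, invr1, mul1r) /=; ring.
rewrite [in X in _ - X * _]big_nat_recl // [in X in X * _ - _]big_nat_recr //=.
have -> : \prod_(1 <= i < m.+1) (x + 1 - i.+1%:R) = \prod_(1 <= j < m.+1) (x - j%:R).
  by apply: eq_bigr => j _; rewrite -natr1; ring.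
move: m0 f0; rewrite -[m.+2%:R]natr1 => m0 f0.
by field; rewrite f0 [1 + _]addrC natr1 m0.
Qed.

Definition rest_fac A k i : R :=
  (-1) ^+ (\sum_(j < n | j != i) k j) / ((\prod_(j < n | j != i) (k j)`!)%:R)
  * (\prod_(l < n | l != i) \prod_(1 <= j < k l) (A l 0 - j%:R)).

Definition rest_U A k i : R := cofactor (dmx A k) i i.
Definition rest_W A k i : R := \sum_r B r i * cofactor (dmx A k) r i.

Lemma ck_atE A k i : ck_at A k =
  rest_fac A k i * coef_fac (k i) (A i 0) (rest_U A k i) (rest_W A k i).
Proof.
have -> : ck_at A k = (-1) ^+ (\sum_(i < n) k i) / ((\prod_(i < n) (k i)`!)%:R)
  * (\prod_(i < n) \prod_(1 <= j < k i) (A i 0 - j%:R)) * \det (dmx A k).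
  rewrite /ck_at; congr (_ * _ * _); rewrite big_mkcond; apply: eq_bigr => l _.
  by case: eqP => //= ->; rewrite big_geq.
rewrite (bigD1 i) //= (bigD1 i (F := fun i => (k i)`!)) //=.
rewrite (bigD1 i (F := fun i => \prod_(1 <= j < k i) (A i 0 - j%:R))) //=.
rewrite exprD natrM (expand_det_col _ i) /rest_fac /coef_fac.
have -> : \sum_r dmx A k r i * cofactor (dmx A k) r i
  = if k i == 0%N then rest_U A k i else A i 0 * rest_U A k i - rest_W A k i * (k i)%:R.
  case: (boolP (k i == 0%N)) => ki.
    rewrite (bigD1 i) //= big1 ?addr0 => [|r ri]; first by rewrite !mxE ki eqxx mul1r.
    by rewrite !mxE ki (negbTE ri) mul0r.
  rewrite /rest_W mulr_suml /rest_U (bigD1 i) //= [X in _ = _ - X](bigD1 i) //=.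
  rewrite mxE (negbTE ki) eqxx mul1r.
  have -> : \sum_(r < n | r != i) dmx A k r i * cofactor (dmx A k) r i =
     - \sum_(r < n | r != i) B r i * cofactor (dmx A k) r i * (k i)%:R.
    rewrite -sumrN; apply: eq_bigr => r ri.
    by rewrite mxE (negbTE ki) (negbTE ri) mul0r sub0r; ring.
  by ring.
rewrite invfM; ring.
Qed.

(** A_i and k_i enter [dmx] only through column i, which the cofactors of that column delete. *)
Lemma rest_ext A A' k k' i :
  (forall j, j != i -> A j 0 = A' j 0) -> (forall j, j != i -> k j = k' j) ->
  [/\ rest_fac A k i = rest_fac A' k' i, rest_U A k i = rest_U A' k' i &
      rest_W A k i = rest_W A' k' i].
Proof.
move=> hA hk.
have hcof r : cofactor (dmx A k) r i = cofactor (dmx A' k') r i.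
  rewrite /cofactor; congr (_ * \det _); apply/matrixP => x y; rewrite !mxE.
  have hl : lift i y != i by rewrite eq_sym neq_lift.
  by rewrite hk // hA.
split; last 2 first.
- exact: hcof.
- by apply: eq_bigr => r _; rewrite hcof.
rewrite /rest_fac; congr (_ ^+ _ / _%:R * _).
- exact: eq_bigr.
- by apply: eq_bigr => j ji; rewrite hk.
by apply: eq_bigr => j ji; rewrite hk // hA.
Qed.

Lemma addcolE a i (s : R) j : (a + s *: dcol i) j 0 = a j 0 + s * (j == i)%:R.
Proof. by rewrite !mxE eqxx andbT. Qed.

Lemma ck_at_step0 A k i : k i = 0%N -> ck_at (A + dcol i) k = ck_at A k.
Proof.
move=> ki; rewrite !(ck_atE _ _ i) ki -[dcol i]scale1r.
have [|//|-> -> ->] := @rest_ext (A + 1 *: dcol i) A k k i.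
  by move=> j ji; rewrite addcolE (negbTE ji) mulr0 addr0.
by rewrite /coef_fac !big_geq.
Qed.

Lemma ck_at_step A k i : k i != 0%N -> ck_at A k - ck_at (A + dcol i) k = ck_at A (kdec i k).
Proof.
move=> ki; rewrite !(ck_atE _ _ i) -[dcol i]scale1r.
have [|//|-> -> ->] := @rest_ext (A + 1 *: dcol i) A k k i.
  by move=> j ji; rewrite addcolE (negbTE ji) mulr0 addr0.
have [//||-> -> ->] := @rest_ext A A (kdec i k) k i.
  by move=> j ji; rewrite /kdec (negbTE ji) subn0.
rewrite addcolE eqxx mulr1 -mulrBr; congr (_ * _).
by rewrite /kdec eqxx; case: (k i) ki => // m _; rewrite coef_fac_rec subn1.
Qed.

Lemma ck_at0 A : ck_at A (fun _ => 0%N) = 1.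
Proof.
rewrite /ck_at big1 // expr0 big1 ?divr1 // big_pred0 ?mul1r => [|i]; last by [].
rewrite (_ : dmx _ _ = 1%:M) ?det1 //.
by apply/matrixP => i j; rewrite !mxE /=.
Qed.

(** For A = B k the rows of diag[A] - B diag[k] sum to 0, so the all-ones vector lies in the kernel.
    In the columns with k_c = 0 the factor A_c has been cancelled, and the vector carries A_c there
    instead. *)
Lemma ck_at_Bk k i : k i != 0%N -> ck_at (B *m natcol R k) k = 0.
Proof.
move=> ki; rewrite /ck_at -det_tr; apply/eqP; rewrite mulf_eq0; apply/orP; right.
set A := B *m _.
apply/det0P; exists (\row_c (if k c == 0%N then A c 0 else 1)).
  apply/negP => /eqP/rowP/(_ i); rewrite !mxE (negbTE ki) => /eqP.
  by rewrite oner_eq0.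
apply/rowP => r; rewrite !mxE.
rewrite (eq_bigr (fun c => (r == c)%:R * A c 0 - B r c * (k c)%:R)); last first.
  move=> c _; rewrite !mxE; case: eqP => [->|_]; last by rewrite mul1r.
  by rewrite mulr0 subr0 mulrC.
rewrite sumrB (bigD1 r) //= eqxx mul1r big1 ?addr0; last first.
  by move=> c cr; rewrite eq_sym (negbTE cr) mul0r.
by rewrite /A mxE; apply/eqP; rewrite subr_eq0; apply/eqP; apply: eq_bigr => c _; rewrite mxE.
Qed.

(** The coefficient of X^k in the expansion of p^a; the numbers c_k of the theorem are the case a =
    kappa^{-1} d. *)
Definition lag_coef a k : R := ck_at (a + B *m natcol R k) k.

Lemma lag_coef_step0 a k i : k i = 0%N -> lag_coef (a + dcol i) k = lag_coef a k.
Proof. by move=> ki; rewrite /lag_coef addrAC ck_at_step0. Qed.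

Lemma natcol_dec k i : k i != 0%N -> natcol R k = dcol i + natcol R (kdec i k).
Proof.
move=> ki; apply/colP => j; rewrite !mxE /kdec eqxx andbT -natrD; congr _%:R.
by case: eqP => [->|_]; [rewrite subnKC // lt0n | rewrite subn0].
Qed.

Lemma lag_coef_step a k i : k i != 0%N ->
  lag_coef a k - lag_coef (a + dcol i) k = lag_coef (a + B *m dcol i) (kdec i k).
Proof.
move=> ki; rewrite /lag_coef addrAC ck_at_step // (natcol_dec ki) mulmxDr addrA; congr ck_at.
Qed.

Lemma lag_coef_poly a k i : exists p : {poly R}, forall s : R, lag_coef (a + s *: dcol i) k = p.[s].
Proof.
set A := a + B *m natcol R k.
have H s : lag_coef (a + s *: dcol i) k
  = rest_fac A k i * coef_fac (k i) (A i 0 + s) (rest_U A k i) (rest_W A k i).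
  rewrite /lag_coef addrAC -/A (ck_atE _ _ i).
  have [|//|-> -> ->] := @rest_ext (A + s *: dcol i) A k k i.
    by move=> j ji; rewrite addcolE (negbTE ji) mulr0 addr0.
  by rewrite addcolE eqxx mulr1.
exists ((rest_fac A k i)%:P * ((-1) ^+ (k i) / (k i)`!%:R)%:P *
  (\prod_(1 <= j < k i) ((A i 0 - j%:R)%:P + 'X)) *
  (if k i == 0%N then (rest_U A k i)%:P
   else ((A i 0)%:P + 'X) * (rest_U A k i)%:P - (rest_W A k i * (k i)%:R)%:P)).
move=> s; rewrite H /coef_fac !hornerM !hornerC horner_prod -!mulrA; congr (_ * (_ * _)).
have -> : \prod_(1 <= j < k i) (A i 0 + s - j%:R) =
          \prod_(1 <= i0 < k i) ((A i 0 - i0%:R)%:P + 'X).[s].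
  by apply: eq_bigr => j _; rewrite hornerD hornerC hornerX; ring.
by congr (_ * _); case: (k i == 0%N); rewrite ?hornerC // !hornerE.
Qed.

Section Periodic.
Variable f : 'cV[R]_n -> C.
Hypothesis fpoly : forall a i, exists p : {poly C}, forall s : R, f (a + s *: dcol i) = p.[s%:C].
Hypothesis fper : forall a i, f (a + dcol i) = f a.

(** Along a coordinate direction f is a polynomial taking one value at all natural numbers, hence
    constant; a is then reached from 0 one coordinate at a time. *)
Lemma poly_periodic_const a : f a = f 0.
Proof.
have fnat c i m : f (c + m%:R *: dcol i) = f c.
  elim: m => [|m IH]; first by rewrite scale0r addr0.
  by rewrite -natr1 scalerDl scale1r addrA fper.
have fs c i s : f (c + s *: dcol i) = f c.
  have [p hp] := fpoly c i.
  have : p - (f c)%:P = 0.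
    apply: (@roots_geq_poly_eq0 _ _ [seq (m%:R : C) | m <- iota 0 (size (p - (f c)%:P))]).
    - apply/allP => _ /mapP[m _ ->]; rewrite /root hornerD hornerN hornerC subr_eq0.
      by rewrite -(fnat c i m) hp rmorph_nat.
    - by rewrite map_inj_uniq ?iota_uniq // => x y /eqP; rewrite eqr_nat => /eqP.
    - by rewrite size_map size_iota.
  move/eqP; rewrite subr_eq0 => /eqP e; by rewrite hp e hornerC.
have -> : a = \sum_i a i 0 *: dcol i.
  by rewrite {1}[a]matrix_sum_delta; apply: eq_bigr => i _; rewrite big_ord1.
elim/big_rec: _ => // i c _ <-; by rewrite addrC fs.
Qed.
End Periodic.

Section Graded.
Variable X : 'I_n -> C.

Definition gterm a k : C := (lag_coef a k)%:C * \prod_i X i ^+ k i.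

(** The homogeneous part of degree N of the series for p^a. Entries of a multi-index of total degree
    N are at most N, so a finite box holds them all. *)
Definition hom_part a (N : nat) : C :=
  \sum_(f : {ffun 'I_n -> 'I_N.+1} | (\sum_i f i == N)%N) gterm a (fun i => f i).

Lemma gterm_ext a k k' : k =1 k' -> gterm a k = gterm a k'.
Proof. by move=> /funext ->. Qed.

(** Terms with k_i = 0 do not change under a -> a + e_i and cancel; the others are matched with
    degree N by lowering k_i by one. *)
Lemma hom_part_step a i N : hom_part a N.+1 - hom_part (a + dcol i) N.+1 = X i * hom_part (a + B *m dcol i) N.
Proof.
rewrite /hom_part -sumrB big_distrr /=.
rewrite (bigID (fun f : {ffun 'I_n -> 'I_N.+2} => f i == ord0)) /= big1 ?add0r; last first.
  move=> f /andP[_ /eqP fi]; rewrite /gterm lag_coef_step0 ?subrr //.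
  by rewrite fi.
pose up (f : {ffun 'I_n -> 'I_N.+1}) : {ffun 'I_n -> 'I_N.+2} :=
  [ffun j => inord (f j + (j == i))].
pose dn (f : {ffun 'I_n -> 'I_N.+2}) : {ffun 'I_n -> 'I_N.+1} :=
  [ffun j => inord (f j - (j == i))].
have upE f j : up f j = (f j + (j == i))%N :> nat.
  by rewrite ffunE inordK //; have := ltn_ord (f j); case: (j == i); lia.
rewrite (reindex_onto up dn) /=; last first.
  move=> f /andP[/eqP fN fi]; apply/ffunP => j; apply: ord_inj; rewrite upE ffunE.
  have fi0 : (0 < f i)%N by rewrite lt0n; apply: contra fi => /eqP h; apply/eqP/ord_inj.
  have [->|ji] := eqVneq j i; first by rewrite inordK ?subnK //; have := ltn_ord (f i); lia.
  rewrite addn0 subn0 inordK //; move: fN; rewrite (bigD1 i) //= (bigD1 j) //=; lia.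
have sumup f : (\sum_j up f j = (\sum_j f j).+1)%N.
  under eq_bigr do rewrite upE.
  rewrite big_split /= -[in RHS]addn1; congr (_ + _)%N.
  rewrite (bigD1 i) //= eqxx big1 ?addn0 // => j ji.
  by rewrite (negbTE ji).
apply: eq_big => [f|f /andP[/andP[/eqP fN fi] _]].
  rewrite sumup eqSS.
  have -> : up f i != ord0.
    by apply/negP => /eqP/(congr1 val) /=; rewrite upE eqxx addn1.
  rewrite andbT; case: (_ == N) / eqP => //= fN.
  apply/eqP/ffunP => j; apply: ord_inj; rewrite ffunE upE addnK inordK //.
have fi' : up f i != 0%N :> nat by rewrite upE eqxx addn1.
rewrite /gterm -mulrBl -rmorphB lag_coef_step // mulrCA; congr (_ * _).
  congr (lag_coef _ _)%:C; apply/funext => j; by rewrite /kdec upE addnK.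
rewrite (bigD1 i) //= [in RHS](bigD1 i) //= upE eqxx addn1 exprS mulrA; congr (_ * _).
by apply: eq_bigr => j ji; rewrite upE (negbTE ji) addn0.
Qed.

Lemma hom_part0 a : hom_part a 0 = 1.
Proof.
rewrite /hom_part (big_pred1 [ffun=> ord0]) => [|f].
  rewrite (@gterm_ext _ _ (fun _ => 0%N)) /gterm /lag_coef => [|i]; last by rewrite ffunE.
  by rewrite ck_at0 big1 ?mulr1.
rewrite -[RHS](_ : true = _) => [|/=].
  rewrite big1 // => i _; by case: (f i) => [[]].
apply/esym/eqP/ffunP => i; rewrite ffunE; apply: ord_inj; by case: (f i) => [[]].
Qed.

Lemma hom_part0S N : hom_part 0 N.+1 = 0.
Proof.
rewrite /hom_part big1 // => f /eqP fN.
have [i fi] : exists i, f i != 0%N :> nat.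
  apply/existsP; rewrite -negb_forall; apply/negP => /forallP h.
  by move: fN; rewrite big1 // => i _; apply/eqP.
by rewrite /gterm /lag_coef add0r (ck_at_Bk (i := i)) // mul0r.
Qed.

Lemma hom_part_poly a i N : exists p : {poly C}, forall s : R, hom_part (a + s *: dcol i) N = p.[s%:C].
Proof.
have [P hP] := choice (fun f : {ffun 'I_n -> 'I_N.+1} => lag_coef_poly a (fun j => f j) i).
exists (\sum_(f : {ffun 'I_n -> 'I_N.+1} | (\sum_i f i == N)%N)
   (map_poly (real_complex R) (P f) * (\prod_i X i ^+ f i)%:P)) => s.
rewrite /hom_part horner_sum; apply: eq_bigr => f _.
by rewrite /gterm hP hornerM hornerC horner_map.
Qed.

(** Induction on the degree: shifting a by e_i changes both sides by X_i times the identity of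
    degree N at a + B e_i, so their difference is periodic in a, hence constant, and it vanishes at
    a = 0. *)
Lemma hom_part_conv N a b : \sum_(0 <= m < N.+1) hom_part a m * hom_part b (N - m) = hom_part (a + b) N.
Proof.
elim: N a => [|N IH] a; first by rewrite big_nat1 !hom_part0 mulr1.
pose f a := \sum_(0 <= m < N.+2) hom_part a m * hom_part b (N.+1 - m) - hom_part (a + b) N.+1.
suff : f a = f 0.
  move/eqP; rewrite {2}/f add0r big_nat_recl // hom_part0 mul1r big1 ?addr0 ?subrr ?subr_eq0 => [/eqP //|].
  by move=> m _; rewrite hom_part0S mul0r.
apply: poly_periodic_const => {}a i.
  have [P hP] := choice (hom_part_poly a i).
  have [Q hQ] := hom_part_poly (a + b) i N.+1.
  exists (\sum_(0 <= m < N.+2) P m * (hom_part b (N.+1 - m))%:P - Q) => s.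
  rewrite /f hornerD hornerN horner_sum addrAC hQ; congr (_ - _).
  by apply: eq_bigr => m _; rewrite hornerM hornerC hP.
have e1 : \sum_(0 <= m < N.+2) hom_part a m * hom_part b (N.+1 - m)
    - \sum_(0 <= m < N.+2) hom_part (a + dcol i) m * hom_part b (N.+1 - m)
    = hom_part (a + b) N.+1 - hom_part (a + b + dcol i) N.+1.
  rewrite -sumrB; under eq_bigr do rewrite -mulrBl.
  rewrite big_nat_recl // !hom_part0 subrr mul0r add0r.
  under eq_bigr do rewrite hom_part_step -mulrA subSS.
  rewrite -mulr_sumr IH hom_part_step; congr (_ * hom_part _ _); by rewrite addrAC.
apply/eqP; rewrite eq_sym -subr_eq0 /f [a + dcol i + b]addrAC.
move: e1; set S1 := \sum_(_ <= _ < _) _; set S2 := \sum_(_ <= _ < _) _ => e1.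
rewrite (_ : _ - _ = (S1 - S2) - (hom_part (a + b) N.+1 - hom_part (a + b + dcol i) N.+1)).
  by rewrite e1 subrr.
by ring.
Qed.
End Graded.
End Coefficients.

(** * Exponential growth of the coefficients in |k| *)

Section CoefficientBound.
Variable R : realType.
Local Notation C := R[i].
Variable n : nat.
Variable B : 'M[R]_n.

Lemma powfact_le_expR (x : R) m : 0 <= x -> x ^+ m / m`!%:R <= expR x.
Proof.
move=> x0; case: m => [|m].
  by rewrite expr0 fact0 divr1 -expR0 ler_expR.
by apply: le_trans (expR_ge1Dxn m x0); rewrite lerDr.
Qed.

Lemma det_bound_real (A : 'M[R]_n) (a : R) : (forall i j, `|A i j| <= a) ->
  `|\det A| <= (n`!)%:R * a ^+ n.
Proof.
move=> ha; rewrite -cabs_real -det_map_mx; apply: det_bound => i j.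
by rewrite mxE cabs_real.
Qed.

(** All factors are at most Y, affine in N = |k|, and Y^m/m! <= e^Y. The n one-variable factors and
    the determinant cost n + 1 such exponentials. The growth rate K does not depend on the bound rho
    for a, so the radius of convergence is common to all a. *)
Lemma lag_coef_bound : exists2 K : R, 1 <= K & forall rho : R, 0 <= rho ->
  exists2 M : R, 0 <= M & forall (a : 'cV[R]_n) (k : 'I_n -> nat),
    (forall i, `|a i 0| <= rho) -> `|lag_coef B a k| <= M * K ^+ (\sum_i k i).
Proof.
pose b := \sum_i \sum_j `|B i j|.
have b0 : 0 <= b by apply: sumr_ge0 => i _; apply: sumr_ge0.
have hb i j : `|B i j| <= b.
  rewrite /b (bigD1 i) //= (bigD1 j) //= -addrA lerDl.
  rewrite addr_ge0 //; first by apply: sumr_ge0 => k _.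
  by apply: sumr_ge0 => k _; apply: sumr_ge0 => l _.
exists (expR (n.+1%:R * (b + 1))).
  by rewrite -expR0 ler_expR mulr_ge0 // addr_ge0.
move=> rho rho0; exists (n`!%:R * 2 ^+ n * n`!%:R * expR (n.+1%:R * (1 + rho))).
  by rewrite !mulr_ge0 ?exprn_ge0 ?expR_ge0.
move=> a k ha; set N := (\sum_i k i)%N.
set A := a + B *m natcol R k.
have kN i : (k i <= N)%N by rewrite /N (bigD1 i) //= leq_addr.
have hBk i : `|(B *m natcol R k) i 0| <= b * N%:R.
  rewrite mxE; apply: le_trans (ler_norm_sum _ _ _) _.
  rewrite /N natr_sum mulr_sumr; apply: ler_sum => j _.
  by rewrite !mxE normrM (ger0_norm (ler0n R _)) ler_wpM2r.
have hA i : `|A i 0| <= rho + b * N%:R.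
  by rewrite /A mxE; apply: le_trans (ler_normD _ _) _; rewrite lerD.
pose Y := 1 + rho + (b + 1) * N%:R.
have Nn : 0 <= N%:R :> R by [].
have bN : 0 <= b * N%:R by rewrite mulr_ge0.
have Y1 : 1 <= Y by rewrite /Y mulrDl; lra.
have Y0 : 0 <= Y by lra.
have -> : n`!%:R * 2 ^+ n * n`!%:R * expR (n.+1%:R * (1 + rho)) * expR (n.+1%:R * (b + 1)) ^+ N
   = expR Y ^+ n * (n`!%:R * (2 ^+ n * (n`!%:R * expR Y))).
  rewrite -[expR (_ * (b + 1)) ^+ N]expRM_natl -mulrA -expRD.
  have -> : n.+1%:R * (1 + rho) + N%:R * (n.+1%:R * (b + 1)) = n%:R * Y + Y.
    by rewrite /Y -natr1; ring.
  by rewrite expRD expRM_natl; ring.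
rewrite /lag_coef -/A /ck_at normrM; apply: ler_pM => //.
  rewrite normrM normrM normrX normrN1 expr1n mul1r.
  rewrite normfV normr_nat. rewrite natr_prod -prodfV normr_prod.
  rewrite [X in _ * X]big_mkcond -big_split /=.
  rewrite -[X in _ ^+ X]card_ord -prodr_const; apply: ler_prod => i _.
  apply/andP; split; first by rewrite mulr_ge0 ?invr_ge0 //; case: ifP.
  apply: le_trans (powfact_le_expR (k i) Y0); rewrite mulrC ler_wpM2r //.
  case: eqP => [->|ki] /=; first by rewrite expr0.
  rewrite normr_prod; apply: (@le_trans _ _ (\prod_(1 <= j < k i) Y)).
    rewrite !big_nat; apply: ler_prod => j /andP[j1 j2].
    rewrite normr_ge0 /=; apply: le_trans (ler_normB _ _) _.
    rewrite (ger0_norm (ler0n R j)).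
    have : (j%:R : R) <= N%:R by rewrite ler_nat (leq_trans (ltnW j2)).
    by have := hA i; rewrite /Y mulrDl mul1r; lra.
  rewrite prodr_const_nat; apply: ler_weXn2l => //; lia.
apply: le_trans (@det_bound_real _ (2 * Y) _) _.
  move=> i j; rewrite mxE; case: eqP => _.
    by rewrite normr_nat; apply: le_trans (_ : 1 <= _); [case: (i == j) | lra].
  apply: le_trans (ler_normB _ _) _; rewrite !normrM !normr_nat.
  have h1 : (i == j)%:R * `|A j 0| <= Y.
    apply: le_trans (_ : `|A j 0| <= _).
      by rewrite -[leRHS]mul1r ler_wpM2r //; case: (i == j).
    by have := hA j; rewrite /Y mulrDl mul1r; lra.
  have h2 : `|B i j| * (k j)%:R <= Y.
    apply: le_trans (_ : b * N%:R <= _); first by apply: ler_pM; rewrite ?ler_nat.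
    by rewrite /Y mulrDl mul1r; lra.
  lra.
rewrite exprMn; apply: ler_wpM2l => //; apply: ler_wpM2l => //.
have := powfact_le_expR n Y0; rewrite ler_pdivrMr ?ltr0n ?fact_gt0 // mulrC; exact.
Qed.

End CoefficientBound.

(** * Sums over boxes of multi-indices, sorted by degree *)

Section BoxSums.
Variable R : realType.
Local Notation C := R[i].
Variable n : nat.

Lemma box_geo (q : R) N : 0 <= q -> q <= 2^-1 ->
  \sum_(f : {ffun 'I_n -> 'I_N}) q ^+ (\sum_i f i)%N <= 2 ^+ n.
Proof.
move=> q0 q1.
have -> : \sum_(f : {ffun 'I_n -> 'I_N}) q ^+ (\sum_i f i)%N
   = \prod_(i < n) \sum_(j < N) q ^+ j.
  rewrite bigA_distr_bigA /=; apply: eq_bigr => f _; by rewrite expr_sum.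
rewrite -[X in _ <= _ ^+ X]card_ord -prodr_const; apply: ler_prod => _ _.
rewrite sumr_ge0 /= => [|j _]; last by rewrite exprn_ge0.
have : (1 - q) * \sum_(j < N) q ^+ j <= 1.
  rewrite -[1 - q]opprB mulNr -subrX1 opprB gerBl; exact: exprn_ge0.
have : 0 <= \sum_(j < N) q ^+ j by apply: sumr_ge0 => j _; rewrite exprn_ge0.
nra.
Qed.

Lemma degree_slice (t : ('I_n -> nat) -> C) N m : (m < N)%N ->
  \sum_(f : {ffun 'I_n -> 'I_N} | (\sum_i f i == m)%N) t (fun i => nat_of_ord (f i))
  = \sum_(f : {ffun 'I_n -> 'I_m.+1} | (\sum_i f i == m)%N) t (fun i => nat_of_ord (f i)).
Proof.
case: N => // N mN.
pose up (f : {ffun 'I_n -> 'I_m.+1}) : {ffun 'I_n -> 'I_N.+1} := [ffun j => inord (f j)].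
pose dn (f : {ffun 'I_n -> 'I_N.+1}) : {ffun 'I_n -> 'I_m.+1} := [ffun j => inord (f j)].
have upE f j : up f j = f j :> nat.
  by rewrite ffunE inordK //; have := ltn_ord (f j); lia.
rewrite (reindex_onto up dn) /=; last first.
  move=> f /eqP fm; apply/ffunP => j; apply: ord_inj; rewrite upE ffunE inordK //.
  by rewrite ltnS -fm (bigD1 j) //= leq_addr.
apply: eq_big => [f|f _]; last by congr t; apply/funext => i; rewrite upE.
under eq_bigr do rewrite upE.
rewrite andb_idr // => _; apply/eqP/ffunP => j; apply: ord_inj.
by rewrite ffunE inordK upE // ltn_ord.
Qed.

Lemma box_low_degree (t : ('I_n -> nat) -> C) N :
  \sum_(f : {ffun 'I_n -> 'I_N} | (\sum_i f i < N)%N) t (fun i => nat_of_ord (f i))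
  = \sum_(0 <= m < N)
     \sum_(f : {ffun 'I_n -> 'I_m.+1} | (\sum_i f i == m)%N) t (fun i => nat_of_ord (f i)).
Proof.
rewrite big_mkord.
rewrite (eq_bigr (fun m : 'I_N => \sum_(f : {ffun 'I_n -> 'I_N} | (\sum_i f i == m)%N)
   t (fun i => nat_of_ord (f i)))); last first.
  by move=> m _; rewrite degree_slice.
case: N => [|N]; first by rewrite big_ord0 big_pred0.
rewrite (partition_big (fun f : {ffun 'I_n -> 'I_N.+1} => inord (\sum_i f i)%N : 'I_N.+1) xpredT) //=.
apply: eq_bigr => m _; apply: eq_bigl => f.
case: ltnP => h /=; first by rewrite -(inj_eq val_inj) /= inordK.
by apply/esym/eqP => e; move: h; rewrite e leqNgt ltn_ord.
Qed.

End BoxSums.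

(** * Logarithms and characters *)

Section Logarithm.
Variable R : realType.
Local Notation C := R[i].
Implicit Types z w : C.

Lemma cabs_geo0 z (M : R) : (forall k, cabs z <= M / 2 ^+ k) -> z = 0.
Proof.
by move=> /le0_geo h; apply/eqP; rewrite -cabs_eq0 eq_le h cabs_ge0.
Qed.

Lemma cexp_near0 z w : cabs z <= 128^-1 -> cabs w <= 128^-1 ->
  cabs (cexp z - cexp w - (z - w)) <= 2^-1 * cabs (z - w).
Proof.
move=> hz hw; have := @cexp_strict R 1 128^-1 0 z w.
rewrite !subr0 !cexp0 cabs1 mul1r => /(_ ltac:(lra) (lexx _) hz hw).
by move/le_trans; apply; rewrite ler_wpM2r ?cabs_ge0 //; lra.
Qed.

Lemma cexp_inj_near0 z w : cabs z <= 128^-1 -> cabs w <= 128^-1 ->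
  cabs (z - w) <= 2 * cabs (cexp z - cexp w).
Proof.
move=> hz hw; have := cexp_near0 hz hw.
have := ler_cabs_sub (z - w) (cexp z - cexp w).
rewrite (cabsBC (z - w)); lra.
Qed.

Definition clog z : C := xget 0 [set t | cexp t = z /\ cabs t <= 2 * cabs (z - 1)]%classic.

Lemma clogP z : cabs (z - 1) <= 512^-1 ->
  cexp (clog z) = z /\ cabs (clog z) <= 2 * cabs (z - 1).
Proof.
move=> hz; rewrite /clog; case: xgetP => [t -> //|/(_ _)] H.
pose f (t : 'I_1 -> C) : 'I_1 -> C := fun i => cexp (t i).
have E (t : 'I_1 -> C) : vnorm t = cabs (t ord0).
  apply/eqP; rewrite eq_le le_vnorm andbT; apply: vnorm_le => [|i]; first exact: cabs_ge0.
  by rewrite ord1.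
have NL : near_linear f (fun _ => 0) 1%:M 128^-1 1.
  split => //; first by rewrite unitmx1.
    by move=> v; rewrite invmx1 mv1 mul1r.
  move=> s t; rewrite !vsubx0 mv1 !E mulr1 => hs ht.
  exact: cexp_near0.
(* Inversion in dimension one with radius 1/128 and K = 1 reaches every z within 1/512 of 1. *)
have [||t ht ft] := near_linear_surj NL (x := fun _ => z).
- by rewrite invr_ge0.
- rewrite E /vsub /f cexp0; apply: le_trans hz _.
  by rewrite mulr1; lra.
have e : cexp (t ord0) = z by move/(congr1 (@^~ ord0)): ft.
exfalso; apply: (H (t ord0)); split => //.
have := @cexp_inj_near0 (t ord0) 0; rewrite cabs0 subr0 cexp0 e; apply.
  by rewrite -E -[t]vsubx0.
by rewrite invr_ge0.
Qed.

Lemma clog_dist z w : cabs (z - 1) <= 512^-1 -> cabs (w - 1) <= 512^-1 ->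
  cabs (clog z - clog w) <= 2 * cabs (z - w).
Proof.
move=> hz hw; have [ez lz] := clogP hz; have [ew lw] := clogP hw.
rewrite -{2}ez -{2}ew; apply: cexp_inj_near0; lra.
Qed.

(** Near 1 the factor |y + 1| is at least 3/2, so each squaring moves a power further from 1. Two
    squarings at least double the distance, which stays bounded only if it is 0. *)
Lemma no_small_powers z : (forall m, cabs (z ^+ m - 1) <= 2^-1) -> z = 1.
Proof.
move=> h.
have step m : 3 / 2 * cabs (z ^+ m - 1) <= cabs (z ^+ (m * 2) - 1).
  rewrite exprM; move: (h m); move: (z ^+ m) => y hy.
  rewrite (_ : y ^+ 2 - 1 = (2 + (y - 1)) * (y - 1)); last by ring.
  rewrite (cabsM (2 + (y - 1))) ler_wpM2r ?cabs_ge0 //.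
  have := ler_cabs_sub 2 (- (y - 1)); rewrite opprK cabsN cabs_nat; lra.
apply/eqP; rewrite -subr_eq0; apply/eqP; apply: (@cabs_geo0 _ 1) => k.
suff G : cabs (z - 1) <= cabs (z ^+ (4 ^ k) - 1) / 2 ^+ k.
  apply: le_trans G _; rewrite ler_pM2r ?invr_gt0 ?exprn_gt0 //.
  by apply: le_trans (h _) _; lra.
elim: k => [|k IH]; first by rewrite expn0 expr1 expr0 divr1.
apply: le_trans IH _; rewrite exprS invfM mulrA ler_pM2r ?invr_gt0 ?exprn_gt0 //.
have s1 := step (4 ^ k)%N; have s2 := step (4 ^ k * 2)%N.
have -> : (4 ^ k.+1 = 4 ^ k * 2 * 2)%N by rewrite expnS; lia.
have := cabs_ge0 (z ^+ (4 ^ k) - 1); lra.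
Qed.

End Logarithm.

Section Characters.
Variable R : realType.
Local Notation C := R[i].
Variable n : nat.
Implicit Types a b : 'cV[R]_n.

Definition pairing a (t : 'I_n -> C) : C := \sum_i (a i 0)%:C * t i.

Lemma pairingD a b t : pairing (a + b) t = pairing a t + pairing b t.
Proof. by rewrite /pairing -big_split; apply: eq_bigr => i _; rewrite mxE rmorphD mulrDl. Qed.

Lemma pairing_dcol i t : pairing (dcol R i) t = t i.
Proof.
rewrite /pairing (bigD1 i) //= big1 ?addr0 => [|j ji].
  by rewrite !mxE !eqxx mul1r.
by rewrite !mxE (negbTE ji) mul0r.
Qed.

(* Integer periodicity spreads the bound from the unit cube to all [a]; then all
   powers of [h a] stay near 1, which forces [h a = 1]. *)
Lemma trivial_char (h : 'cV[R]_n -> C) :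
  (forall a b, h (a + b) = h a * h b) -> (forall i, h (dcol R i) = 1) ->
  (forall a, (forall i, `|a i 0| <= 1) -> cabs (h a - 1) <= 2^-1) ->
  forall a, h a = 1.
Proof.
move=> hD h1 hnear.
have h00 : h 0 = 1.
  have e : h 0 * h 0 = h 0 by rewrite -hD addr0.
  have n0 : h 0 != 0.
    apply/eqP => e0; have hz i : `|(0 : 'cV[R]_n) i 0| <= 1 by rewrite mxE normr0.
    by have := hnear 0 hz; rewrite e0 sub0r cabsN cabs1; lra.
  by apply: (mulfI n0); rewrite e mulr1.
have hnat a i m : h (a + m%:R *: dcol R i) = h a.
  elim: m => [|m IH]; first by rewrite scale0r addr0.
  by rewrite -natr1 scalerDl scale1r addrA hD IH h1 mulr1.
have hint a i (m : int) : h (a + m%:~R *: dcol R i) = h a.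
  case: m => m; first by rewrite hnat.
  by rewrite -[LHS](hnat _ i m.+1) NegzE mulrNz scaleNr addrNK.
have hall a : cabs (h a - 1) <= 2^-1.
  have -> : h a = h (\sum_i (a i 0 - (Num.floor (a i 0))%:~R) *: dcol R i).
    have -> : \sum_i (a i 0 - (Num.floor (a i 0))%:~R) *: dcol R i
      = a + \sum_i (- Num.floor (a i 0))%:~R *: dcol R i.
      rewrite {3}[a]matrix_sum_delta -big_split /=; apply: eq_bigr => i _.
      by rewrite big_ord1 scalerBl mulrNz scaleNr.
    by elim/big_rec: _ => [|i x _]; [rewrite addr0 | rewrite [_ *: _ + _]addrC addrA hint].
  apply: hnear => i; rewrite summxE (bigD1 i) //= big1 ?addr0; last first.
    by move=> j ji; rewrite !mxE eq_sym (negbTE ji) mulr0.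
  rewrite !mxE !eqxx mulr1 ger0_norm ?subr_ge0 ?real_floor_le ?num_real //.
  by rewrite lerBlDl; have := real_floorD1_gt (num_real (a i 0)); rewrite intrD => /ltW; rewrite addrC.
move=> a; apply: no_small_powers => m.
have <- : h (m%:R *: a) = h a ^+ m.
  elim: m => [|m IH]; first by rewrite scale0r expr0.
  by rewrite -natr1 scalerDl scale1r hD IH exprSr.
exact: hall.
Qed.

(** With t_i a logarithm of G(e_i), the quotient of G by e^{<a, t>} is a character trivial on the
    e_i and near 1 on the unit cube. The factor n + 1 in the threshold keeps <a, t> small on that
    cube. *)
Lemma char_exp : exists2 dl : R, 0 < dl & forall (G : 'cV[R]_n -> C) (e : R), e <= dl ->
  (forall a b, G (a + b) = G a * G b) ->
  (forall a, (forall i, `|a i 0| <= 1) -> cabs (G a - 1) <= e) ->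
  exists2 t : 'I_n -> C, vnorm t <= 2 * e & forall a, G a = cexp (pairing a t).
Proof.
exists (512 * n.+1%:R)^-1; first by rewrite invr_gt0; apply: mulr_gt0; rewrite ltr0n.
move=> G e he GD Gnear.
have dn (i j : 'I_n) : `|dcol R i j 0| <= 1.
  by rewrite !mxE andbT normr_nat; case: (j == i).
have e0 : 0 <= e.
  apply: le_trans (Gnear 0 _); first exact: cabs_ge0.
  by move=> i; rewrite mxE normr0.
have n1 : (1 : R) <= n.+1%:R by rewrite ler1n.
have he' : e * n.+1%:R <= 512^-1.
  by rewrite -ler_pdivlMr // -invfM.
have he1 : e <= 512^-1 by apply: le_trans he' ; rewrite ler_peMr.
pose t i := clog (G (dcol R i)).
have Ht i : cexp (t i) = G (dcol R i) /\ cabs (t i) <= 2 * e.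
  have h := Gnear (dcol R i) (dn i).
  by have [h1 h2] := clogP (le_trans h he1); split => //; lra.
have tn : vnorm t <= 2 * e by apply: vnorm_le => [|i]; [lra | have [] := Ht i].
exists t => // a.
pose h a := G a * cexp (- pairing a t).
suff /(_ a) : forall a, h a = 1.
  move=> H; apply: (mulIf (cexp_neq0 (- pairing a t))).
  by rewrite -cexpD subrr cexp0; exact: H.
apply: trivial_char => [x y|i|x hx].
- by rewrite /h GD pairingD opprD cexpD; ring.
- by rewrite /h pairing_dcol -(Ht i).1 -cexpD subrr cexp0.
have hp : cabs (pairing x t) <= 2 * (e * n%:R).
  apply: le_trans (ler_cabs_sum _ _ _) _.
  apply: (@le_trans _ _ (\sum_(i < n) 2 * e)); last first.
    by rewrite sumr_const card_ord -[leLHS]mulr_natl mulrC mulrA.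
  apply: ler_sum => i _; rewrite cabsM cabs_real -[leRHS]mul1r.
  by apply: ler_pM; rewrite ?cabs_ge0 //; have [] := Ht i.
have hp2 : cabs (- pairing x t) <= 256^-1.
  rewrite cabsN; apply: le_trans hp _.
  have : e * n%:R <= e * n.+1%:R by rewrite ler_wpM2l // ler_nat.
  lra.
have hc : cabs (cexp (- pairing x t) - 1) <= 5 / 256.
  by apply: le_trans (cexp_taylor1 _) _; lra.
have hG := le_trans (Gnear x hx) he1.
rewrite /h; set c := cexp _ in hc *; set gx := G x in hG *.
have -> : gx * c - 1 = (gx - 1) * (c - 1) + ((gx - 1) + (c - 1)) by ring.
apply: le_trans (ler_cabsD _ _) _.
have := ler_cabsD (gx - 1) (c - 1).
have : cabs ((gx - 1) * (c - 1)) <= 1 * (5/256).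
  by rewrite (cabsM (gx - 1)); apply: ler_pM; rewrite ?cabs_ge0 //; lra.
lra.
Qed.

End Characters.

Section CauchyProduct.
Variable R : realType.
Local Notation C := R[i].

(** The product of partial sums exceeds the triangle m + l < N by at most N^2 terms, each at most A
    A' 8^-N; N <= 2^N leaves a factor 2^-N. *)
Lemma cauchy_product (u v w : nat -> C) (A A' q : R) N : 0 <= q -> q <= 8^-1 ->
  (forall m, cabs (u m) <= A * q ^+ m) -> (forall m, cabs (v m) <= A' * q ^+ m) ->
  (forall m, \sum_(0 <= l < m.+1) u l * v (m - l)%N = w m) ->
  cabs ((\sum_(0 <= m < N) u m) * (\sum_(0 <= m < N) v m) - \sum_(0 <= m < N) w m)
    <= A * A' / 2 ^+ N.
Proof.
move=> q0 q1 hu hv hw.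
have A0 : 0 <= A by have := le_trans (cabs_ge0 _) (hu 0%N); rewrite expr0 mulr1.
have A'0 : 0 <= A' by have := le_trans (cabs_ge0 _) (hv 0%N); rewrite expr0 mulr1.
have -> : \sum_(0 <= m < N) w m = \sum_(0 <= m < N) \sum_(0 <= l < N - m) u m * v l.
  elim: N => [|N IH]; first by rewrite !big_geq.
  rewrite big_nat_recr //= IH -hw [RHS]big_nat_recr //= subSn // subnn big_nat1.
  rewrite [\sum_(0 <= l < N.+1) _]big_nat_recr //= subnn addrA; congr (_ + _).
  rewrite -big_split /=; apply: eq_big_nat => i /andP[_ iN].
  by rewrite subSn 1?ltnW // big_nat_recr.
rewrite mulr_suml -sumrB.
apply: le_trans (ler_cabs_sum _ _ _) _.
apply: (@le_trans _ _ (\sum_(0 <= m < N) A * A' * (8^-1) ^+ N * N%:R)); last first.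
  rewrite big_const_nat iter_addr_0 subn0 -[leLHS]mulr_natr -!mulrA !ler_wpM2l //.
  have hN : (N%:R : R) <= 2 ^+ N by rewrite -natrX ler_nat ltnW // ltn_expl.
  apply: (@le_trans _ _ (8^-1 ^+ N * (2 ^+ N * 2 ^+ N))).
    by rewrite ler_wpM2l ?exprn_ge0 ?invr_ge0 //; apply: ler_pM.
  rewrite -!exprMn -exprVn.
  by rewrite (_ : 8^-1 * (2 * 2) = 2^-1 :> R) //; field.
apply: ler_sum_nat => m /andP[_ mN].
rewrite mulr_sumr (big_cat_nat (n := (N - m)%N)) ?leq_subr //=. rewrite addrAC subrr add0r.
apply: le_trans (ler_cabs_sum _ _ _) _.
apply: (@le_trans _ _ (\sum_(N - m <= l < N) A * A' * (8^-1) ^+ N)); last first.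
  rewrite big_const_nat iter_addr_0 -[leLHS]mulr_natr ler_wpM2l //.
    by rewrite !mulr_ge0 // exprn_ge0 ?invr_ge0.
  by rewrite ler_nat leq_subr.
apply: ler_sum_nat => l /andP[lN _].
rewrite (cabsM (u m)); apply: (@le_trans _ _ ((A * q ^+ m) * (A' * q ^+ l))).
  by apply: ler_pM; rewrite ?cabs_ge0.
rewrite mulrACA -exprD; apply: ler_wpM2l; first exact: mulr_ge0.
apply: (@le_trans _ _ (8^-1 ^+ (m + l))).
  by rewrite lerXn2r // nnegrE.
apply: ler_wiXn2l; rewrite ?invr_ge0 //; last by lia.
by rewrite invf_le1 //; lra.
Qed.

End CauchyProduct.

(** * Lagrange inversion *)

Section Lagrange.
Variable R : realType.
Local Notation C := R[i].
Variable n : nat.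
Variable B : 'M[R]_n.

Definition amax (a : 'cV[R]_n) : R := \big[Num.max/1]_i `|a i 0|.

Lemma amax_ge1 a : 1 <= amax a. Proof. exact: bigmax_ge_id. Qed.
Lemma le_amax (a : 'cV[R]_n) i : `|a i 0| <= amax a.
Proof. exact: (le_bigmax _ (fun i => `|a i 0|)). Qed.
Lemma amax1 (a : 'cV[R]_n) : (forall i, `|a i 0| <= 1) -> amax a = 1.
Proof. by move=> h; apply/eqP; rewrite eq_le amax_ge1 andbT; apply: bigmax_le. Qed.

(* The amplitude depends on [a] only through [amax a], hence is the same for
   all [a] in the unit cube. *)
Lemma gterm_bound : exists2 K : R, 1 <= K & exists2 Ma : R -> R,
  forall r, 0 <= Ma r &
  forall (a : 'cV[R]_n) (q : R) (X : 'I_n -> C) k, 0 <= q -> vnorm X <= q / K ->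
    cabs (gterm B X a k) <= Ma (amax a) * q ^+ (\sum_i k i)%N.
Proof.
have [K K1 HK] := lag_coef_bound B.
have H (r : R) : exists M : R, 0 <= M /\ (1 <= r -> forall (a : 'cV[R]_n) (k : 'I_n -> nat),
    (forall i, `|a i 0| <= r) -> `|lag_coef B a k| <= M * K ^+ (\sum_i k i)).
  have [r1|r1] := leP 1 r; last by exists 0.
  have [M M0 hM] := HK r (le_trans ler01 r1); by exists M; split.
have [Ma hMa] := choice H.
have K0 : 0 < K by apply: lt_le_trans K1.
exists K => //; exists Ma => [r|a q X k q0 hX]; first by have [] := hMa r.
have [M0 hM] := hMa (amax a).
rewrite /gterm cabsM cabs_real cabs_prod.
apply: (@le_trans _ _ (Ma (amax a) * K ^+ (\sum_i k i) * (q / K) ^+ (\sum_i k i))).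
  apply: ler_pM => //.
  - by apply: prodr_ge0 => i _; exact: cabs_ge0.
  - by apply: hM; [exact: amax_ge1 | exact: le_amax].
  rewrite expr_sum; apply: ler_prod => i _; rewrite cabs_ge0 /= cabsX.
  by rewrite lerXn2r // ?nnegrE ?cabs_ge0 ?divr_ge0 ?(ltW K0) // (le_trans (le_vnorm _ _) hX).
by rewrite -mulrA -exprMn mulrCA mulfV ?mulr1 // gt_eqF.
Qed.

(** Halving the admissible radius leaves the summable weight 2^-|k| after th^m has been extracted
    from terms of degree at least m. *)
Lemma gterm_box (K : R) (Ma : R -> R) : 1 <= K -> (forall r, 0 <= Ma r) ->
  (forall (a : 'cV[R]_n) (q : R) (X : 'I_n -> C) k, 0 <= q -> vnorm X <= q / K ->
    cabs (gterm B X a k) <= Ma (amax a) * q ^+ (\sum_i k i)%N) ->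
  forall (a : 'cV[R]_n) (th : R) (X : 'I_n -> C) N (P : pred {ffun 'I_n -> 'I_N}) m,
    0 <= th -> th <= 1 -> vnorm X <= th / (2 * K) ->
    (forall f, P f -> (m <= \sum_i f i)%N) ->
  \sum_(f : {ffun 'I_n -> 'I_N} | P f) cabs (gterm B X a (fun i => nat_of_ord (f i)))
   <= Ma (amax a) * 2 ^+ n * th ^+ m.
Proof.
move=> K1 M0 H a th X N P m th0 th1 hX hP.
have K0 : 0 < K by apply: lt_le_trans K1.
apply: (@le_trans _ _ (\sum_(f : {ffun 'I_n -> 'I_N} | P f)
   Ma (amax a) * th ^+ m * 2^-1 ^+ (\sum_i f i)%N)).
  apply: ler_sum => f Pf; apply: le_trans (H a (th / 2) X _ _ _) _.
  - by rewrite divr_ge0.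
  - by rewrite -mulrA -invfM.
  rewrite exprMn mulrA; apply: ler_wpM2r; first by rewrite exprn_ge0 ?invr_ge0.
  by apply: ler_wpM2l => //; apply: ler_wiXn2l => //; exact: hP.
rewrite -mulr_sumr -mulrA -mulrA ler_wpM2l // mulrC ler_wpM2r ?exprn_ge0 //.
apply: le_trans (_ : \sum_(f : {ffun 'I_n -> 'I_N}) 2^-1 ^+ (\sum_i f i)%N <= _).
  rewrite big_mkcond /=; apply: ler_sum => f _; case: ifP => _ //.
by apply: box_geo; rewrite ?invr_ge0.
Qed.

Definition psum X a N : C := \sum_(0 <= m < N) hom_part B X a m.

Lemma psum_step X a i N :
  psum X a N.+1 - psum X (a + dcol R i) N.+1 = X i * psum X (a + B *m dcol R i) N.
Proof.
rewrite /psum -sumrB big_nat_recl // !hom_part0 subrr add0r mulr_sumr.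
by apply: eq_bigr => m _; rewrite hom_part_step.
Qed.

Lemma limit_unique (x y : C) (u : nat -> C) (M M' : R) :
  (forall k, cabs (x - u k) <= M / 2 ^+ k) -> (forall k, cabs (y - u k) <= M' / 2 ^+ k) ->
  x = y.
Proof.
move=> hx hy; apply/eqP; rewrite -subr_eq0; apply/eqP; apply: (@cabs_geo0 _ _ (M + M')) => k.
apply: le_trans (ler_cabs_dist (u k) _ _) _; rewrite mulrDl.
by apply: lerD; [exact: hx | rewrite cabsBC].
Qed.

(* The sum of the series is a character of [a]; by [char_exp] it is [cexp <a, t>],
   and the recurrence at [a = 0] says that [t] solves [Emap B^T t = X]. *)
Lemma lagrange_series : exists2 r0 : R, 0 < r0 & forall (X : 'I_n -> C) (th : R),
  0 <= th -> th <= 1 -> vnorm X <= r0 * th ->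
  exists2 t : 'I_n -> C, vnorm t <= th & Emap B^T t = X /\
   forall a, abs_summable (gterm B X a) /\ has_sum (gterm B X a) (cexp (pairing a t)).
Proof.
have [K K1 [Ma M0 H]] := gterm_bound.
have K0 : 0 < K by apply: lt_le_trans K1.
have [dl dl0 Hchar] := char_exp R n.
have box := gterm_box K1 M0 H.
pose c := 4 * (Ma 1 * 2 ^+ n).
have c0 : 0 <= c by rewrite !mulr_ge0 ?exprn_ge0.
(* 1/8 serves the Cauchy product and [dl] the passage to an exponential; 1/2 makes the resulting t
   at most th'. The factor c converts the size of X into |G a - 1| on the unit cube. *)
pose e0 := Num.min 8^-1 (Num.min dl 2^-1 / (c + 1)).
have e00 : 0 < e0.
  by rewrite lt_min invr_gt0 ltr0n /= divr_gt0 ?ltr_wpDl // lt_min dl0 invr_gt0 ltr0n.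
exists (e0 / (2 * K)); first by rewrite divr_gt0 // mulr_gt0.
move=> X th' th'0 th'1 hX.
pose th := e0 * th'.
have th0 : 0 <= th by rewrite mulr_ge0 // ltW.
have the0 : th <= e0 by rewrite -[leRHS]mulr1 ler_wpM2l // ltW.
have th8 : th <= 8^-1 by apply: le_trans the0 _; rewrite ge_min lexx.
have th1 : th <= 1 by lra.
have {}hX : vnorm X <= th / (2 * K) by rewrite /th mulrAC.
pose A a := Ma (amax a) * 2 ^+ n.
have A0 a : 0 <= A a by rewrite mulr_ge0 ?exprn_ge0.
have hom_bound a m : cabs (hom_part B X a m) <= A a * th ^+ m.
  apply: le_trans (ler_cabs_sum _ _ _) _; apply: (box a th X) => // f /eqP ->; exact: leqnn.
have Glim a : exists l, forall k, cabs (l - psum X a k.+1) <= 4 * (A a * th) / 2 ^+ k.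
  apply: (@geo_cauchy _ (fun k => psum X a k.+1)) => k.
  have -> : psum X a k.+2 - psum X a k.+1 = hom_part B X a k.+1.
    by rewrite /psum (big_nat_recr k.+1) //=; ring.
  apply: le_trans (hom_bound a k.+1) _; rewrite exprS mulrA; apply: ler_wpM2l; first exact: mulr_ge0.
  by rewrite -exprVn lerXn2r // ?nnegrE ?invr_ge0 //; lra.
have [G hG] := choice Glim.
have hG' a : exists M', forall k, cabs (G a - psum X a k) <= M' / 2 ^+ k.
  exists (cabs (G a) + 8 * (A a * th)) => -[|k].
    rewrite /psum big_geq // subr0 expr0 divr1 lerDl.
    by rewrite mulr_ge0 // mulr_ge0.
  apply: le_trans (hG a k) _; rewrite exprS.
  have -> : 4 * (A a * th) / 2 ^+ k = 8 * (A a * th) / (2 * 2 ^+ k).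
    by field; rewrite expf_neq0.
  by rewrite ler_pM2r ?invr_gt0 ?mulr_gt0 ?exprn_gt0 // lerDr cabs_ge0.
have GD a b : G (a + b) = G a * G b.
  have [Ma' hMa] := hG' a; have [Mb' hMb] := hG' b; have [Mc hMc] := hG' (a + b).
  apply: (limit_unique hMc (M' := A a * A b + Ma' * Mb' + Ma' * (cabs (G b)) + (cabs (G a)) * Mb')) => k.
  have cp := cauchy_product k th0 th8 (hom_bound a) (hom_bound b) (fun m => hom_part_conv B X m a b).
  rewrite -/(psum X a k) -/(psum X b k) -/(psum X (a + b) k) in cp.
  have -> : G a * G b - psum X (a + b) k =
    (psum X a k * psum X b k - psum X (a + b) k)
    + (- ((G a - psum X a k) * (G b - psum X b k)) + (G a - psum X a k) * G b
    + G a * (G b - psum X b k)) by ring.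
  apply: le_trans (ler_cabsD _ _) _; rewrite -!addrA [leRHS]mulrDl; apply: lerD => //.
  apply: le_trans (ler_cabsD _ _) _; rewrite [leRHS]mulrDl; apply: lerD.
    rewrite cabsN (cabsM (G a - _)).
    apply: (@le_trans _ _ ((Ma' / 2 ^+ k) * (Mb' / 2 ^+ 0))).
      apply: ler_pM; rewrite ?cabs_ge0 //; apply: le_trans (hMb k) _.
      rewrite expr0 ler_wpM2l ?invf_le1 ?exprn_gt0 ?exprn_ege1 ?ler1n //.
        by have := le_trans (cabs_ge0 _) (hMb 0%N); rewrite expr0 divr1.
      by rewrite invr1 invf_le1 ?exprn_gt0 // exprn_ege1 // ler1n.
    by rewrite expr0 divr1 mulrAC.
  apply: le_trans (ler_cabsD _ _) _; rewrite [leRHS]mulrDl; apply: lerD.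
    by rewrite (cabsM (G a - _)) mulrAC ler_wpM2r ?cabs_ge0.
  by rewrite (cabsM (G a)) -mulrA ler_wpM2l ?cabs_ge0.
have Gnear (a : 'cV[R]_n) : (forall i, `|a i 0| <= 1) -> cabs (G a - 1) <= c * th.
  move=> ha; have := hG a 0%N; rewrite /psum big_nat1 hom_part0 expr0 divr1.
  by rewrite /A amax1 // mulrA.
have m0 : 0 <= Num.min dl 2^-1.
  by rewrite le_min; apply/andP; split; [exact: ltW | rewrite invr_ge0].
have cth : c * th <= Num.min dl 2^-1 * th'.
  rewrite /th mulrA ler_wpM2r //.
  apply: le_trans (_ : c * (Num.min dl 2^-1 / (c + 1)) <= _).
    by rewrite ler_wpM2l // ge_min lexx orbT.
  rewrite mulrCA -[leRHS]mulr1; apply: ler_wpM2l.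
    exact: m0.
  by rewrite ler_pdivrMr ?ltr_wpDl // mul1r lerDl.
have c1 : c * th <= dl.
  apply: le_trans cth _; apply: (@le_trans _ _ (Num.min dl 2^-1)); last by rewrite ge_min lexx.
  by rewrite -[leRHS]mulr1 ler_wpM2l.
have c2 : 2 * (c * th) <= th'.
  have : Num.min dl 2^-1 * th' <= 2^-1 * th' by rewrite ler_wpM2r // ge_min lexx orbT.
  lra.
have [t ht Gt] := Hchar G _ c1 GD Gnear.
exists t; first exact: le_trans ht c2.
split.
  apply/funext => i.
  have G0 : G 0 = 1 by rewrite Gt /pairing big1 ?cexp0 // => j _; rewrite mxE mul0r.
  have E : G 0 - G (0 + dcol R i) = X i * G (0 + B *m dcol R i).
    have [M1 h1] := hG' 0; have [M2 h2] := hG' (0 + dcol R i).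
    have [M3 h3] := hG' (0 + B *m dcol R i).
    apply: (@limit_unique _ _ (fun k => psum X 0 k.+1 - psum X (0 + dcol R i) k.+1)
       (M1 + M2) (cabs (X i) * M3)) => k.
      rewrite mulrDl (_ : _ - _ - _ = (G 0 - psum X 0 k.+1)
         - (G (0 + dcol R i) - psum X (0 + dcol R i) k.+1)); last by ring.
      have M1p : 0 <= M1 by have := le_trans (cabs_ge0 _) (h1 0%N); rewrite expr0 divr1.
      have M2p : 0 <= M2 by have := le_trans (cabs_ge0 _) (h2 0%N); rewrite expr0 divr1.
      have le2 (M : R) : 0 <= M -> M / 2 ^+ k.+1 <= M / 2 ^+ k.
        move=> Mp; apply: ler_wpM2l => //; rewrite -!exprVn.
        by apply: ler_wiXn2l; rewrite ?invr_ge0 ?invf_le1 //; lra.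
      apply: le_trans (ler_cabsB _ _) _; apply: lerD.
        exact: le_trans (h1 k.+1) (le2 _ M1p).
      exact: le_trans (h2 k.+1) (le2 _ M2p).
    by rewrite psum_step -mulrBr cabsM -mulrA ler_wpM2l ?cabs_ge0.
  move: E; rewrite !add0r G0 !Gt pairing_dcol /Emap => ->.
  have -> : lf B^T t i = pairing (B *m dcol R i) t.
    rewrite /lf /mv /pairing; apply: eq_bigr => j _; rewrite !mxE; congr (_%:C * _).
    rewrite (bigD1 i) //= big1 ?addr0 ?mxE ?eqxx ?mulr1 // => l li.
    by rewrite mxE (negbTE li) mulr0.
  by rewrite -mulrA -cexpD subrr cexp0 mulr1.
move=> a; split.
  exists (A a) => N; apply: le_trans (box a th X N xpredT 0%N th0 th1 hX _) _ => //.
  by rewrite expr0 mulr1.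
move=> e ep; rewrite -Gt; have [M' hM'] := hG' a.
have [N0 hN0] := geo_small (A a + M') ep.
exists N0 => N NN; apply: le_lt_trans (hN0 N NN).
(* The box of side N contains every multi-index of degree below N, which is [psum]; the remaining
   ones have degree at least N and contribute a multiple of 2^-N. *)
rewrite /box_sum (bigID (fun f : {ffun 'I_n -> 'I_N} => (\sum_i f i < N)%N)) /=.
rewrite box_low_degree -/(psum X a N).
set T := \sum_(f | _) _.
rewrite (_ : _ + T - _ = T + (psum X a N - G a)); last by rewrite /psum /hom_part /gterm; ring.
apply: le_trans (ler_cabsD _ _) _; rewrite mulrDl; apply: lerD; last by rewrite cabsBC.
apply: le_trans (ler_cabs_sum _ _ _) _.
apply: le_trans (box a th X N _ N th0 th1 hX _) _ => [f|]; first by rewrite -leqNgt.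
rewrite -exprVn; apply: ler_wpM2l; first exact: A0.
by rewrite lerXn2r // ?nnegrE ?invr_ge0 //; lra.
Qed.

(** The series is known to represent some small solution for X. Here t is prescribed, and
    injectivity of [Emap B^T] near 0 identifies it with that solution. *)
Theorem lagrange_inversion : exists2 r : R, 0 < r & forall t : 'I_n -> C, vnorm t <= r ->
  forall a, abs_summable (gterm B (Emap B^T t) a) /\
            has_sum (gterm B (Emap B^T t) a) (cexp (pairing a t)).
Proof.
have [rho [K [rho0 K0 NL]]] := Emap_local (det_dE_0 B^T).
have [r0 r00 H] := lagrange_series.
pose th := Num.min 1 rho.
have th0 : 0 < th by rewrite lt_min ltr01.
have [sr sr0 /(_ 0) [L L0 HL]] := Emap_strict B^T.
have [Ld Ld0 HLd] := mv_bounded (dE B^T (fun _ : 'I_n => 0 : C)).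
pose r := Num.min (Num.min sr rho) (r0 * th / (Ld + L * sr + 1)).
have d0 : 0 < Ld + L * sr + 1 by rewrite ltr_wpDl // addr_ge0 // mulr_ge0 // ltW.
exists r; first by rewrite !lt_min sr0 rho0 divr_gt0 // mulr_gt0.
move=> t ht a.
have t1 : vnorm t <= sr by apply: le_trans ht _; rewrite !ge_min lexx.
have t2 : vnorm t <= rho by apply: le_trans ht _; rewrite !ge_min lexx orbT.
have t3 : vnorm t * (Ld + L * sr + 1) <= r0 * th.
  by rewrite -ler_pdivlMr //; apply: le_trans ht _; rewrite !ge_min lexx orbT.
have hX : vnorm (Emap B^T t) <= r0 * th.
  apply: le_trans t3.
  have := HL (fun _ => 0) _ sr (lexx _) t (fun _ => 0).
  rewrite vnorm0 vsubxx !vsubx0 Emap0 vsubx0 => /(_ (lexx _) t1 (ltW sr0)) h.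
  rewrite -[Emap _ _]vsubx0; apply: le_trans (ler_vdist (mv (dE B^T (fun _ => 0)) t) _ _) _.
  rewrite vsubx0; have := HLd t; have := vnorm_ge0 t; nra.
have th1 : th <= 1 by rewrite ge_min lexx.
have [s hs [Es Hs]] := H _ th (ltW th0) th1 hX.
suff -> : t = s by rewrite Es; exact: Hs.
apply: vnorm_le0; have := near_linear_inj NL (s := t) (t := s).
rewrite !vsubx0 Es vsubxx mulr0; apply => //.
by apply: le_trans hs _; rewrite ge_min lexx orbT.
Qed.

End Lagrange.

(** * The domain of the continuation *)

Section Connected.
Variable R : realType.
Local Notation C := R[i].
Variable n : nat.
Local Notation V := ('I_n -> C).

Definition line (s t : V) (x : R) : V := fun i => s i + x%:C * (t i - s i).

Lemma line_dist s t x y : vnorm (vsub (line s t x) (line s t y)) = `|x - y| * vnorm (vsub t s).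
Proof.
rewrite -cabs_real -vnormZ; congr vnorm; apply/funext => i.
by rewrite /vsub /line rmorphB; ring.
Qed.

Lemma line0 s t : line s t 0 = s.
Proof. by apply/funext => i; rewrite /line mul0r addr0. Qed.
Lemma line1 s t : line s t 1 = t.
Proof. by apply/funext => i; rewrite /line mul1r; ring. Qed.

Variables (E : V -> V) (P : V -> Prop).
Hypothesis Econt : forall t (e : R), 0 < e ->
  exists2 d : R, 0 < d & forall s, vnorm (vsub s t) < d -> vnorm (vsub (E s) (E t)) < e.

Definition seg (s t : V) : Prop := forall x : R, 0 <= x -> x <= 1 -> P (line s t x).

Let D x := exists2 t, P t & E t = x.

Section Separation.
Variables (U W : V -> Prop).
Hypotheses (Uo : open_set U) (Wo : open_set W).
Hypothesis cov : forall x, D x -> U x \/ W x.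
Hypothesis disj : forall x, D x -> U x -> W x -> False.

Lemma preim_open (O : V -> Prop) s t x : open_set O -> O (E (line s t x)) ->
  exists2 d : R, 0 < d & forall y, `|y - x| < d -> O (E (line s t y)).
Proof.
move=> Oo Ox; have [e e0 he] := Oo _ Ox; have [d d0 hd] := Econt (line s t x) e0.
exists (d / (vnorm (vsub t s) + 1)) => [|y hy].
  by rewrite divr_gt0 // ltr_wpDl ?vnorm_ge0.
apply: he; apply: hd; rewrite line_dist.
move: hy; rewrite ltr_pdivlMr ?ltr_wpDl ?vnorm_ge0 //; apply: le_lt_trans.
by rewrite ler_wpM2l // lerDl.
Qed.

(** The supremum of the parameters with image in U can lie neither in U, which would extend beyond
    it, nor in W, whose neighbourhood would contain parameters of U. *)
Lemma seg_sep s t : seg s t -> U (E s) -> W (E t) -> False.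
Proof.
move=> hst Us Wt.
pose S := [set x : R | [/\ 0 <= x, x <= 1 & U (E (line s t x))]]%classic.
have S0 : S 0 by split => //; rewrite line0.
have ubS : ubound S 1 by move=> x [].
have hS : has_sup S by split; [exists 0 | exists 1].
set c := sup S.
have c0 : 0 <= c by apply: ub_le_sup => //; exists 1.
have c1 : c <= 1 by apply: ge_sup => //; exists 0.
have Dc : D (E (line s t c)) by exists (line s t c) => //; exact: hst.
case: (cov Dc) => hc.
  have [d d0 hd] := preim_open Uo hc.
  have [c1'|c1'] := ltP c 1; last first.
    have e : c = 1 by apply/eqP; rewrite eq_le c1.
    by apply: (disj Dc hc); rewrite e line1.
  pose y := Num.min 1 (c + d / 2).
  have yc : c < y by rewrite lt_min c1' ltrDl divr_gt0.
  have yd : y <= c + d / 2 by rewrite ge_min lexx orbT.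
  have : S y.
    split; [by rewrite ltW // (le_lt_trans c0) | by rewrite ge_min lexx |].
    by apply: hd; rewrite ger0_norm ?subr_ge0 ?ltW //; lra.
  move=> /(ub_le_sup (ex_intro _ 1 ubS)); rewrite -/c; lra.
have [d d0 hd] := preim_open Wo hc.
have [y [y0 y1 Uy] hy] := sup_adherent d0 hS.
have yc : y <= c by apply: ub_le_sup => //; exists 1.
apply: (@disj (E (line s t y))) => //; first by exists (line s t y) => //; exact: hst.
apply: hd; rewrite ler0_norm; rewrite -/c in hy; lra.
Qed.

End Separation.

(** Three segments suffice for the later domain: inside the ball, along the ray, and across the
    tube. *)
Lemma connected_image (o : V) : P o ->
  (forall t, P t -> exists s1 s2, [/\ seg o s1, seg s1 s2 & seg s2 t]) -> connected_set D.
Proof.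
move=> Po reach U W Uo Wo cov disj [x [[s Ps Es] Ux]] [y [[t Pt Et] Wy]].
have key (U' W' : V -> Prop) : open_set U' -> open_set W' ->
    (forall x, D x -> U' x \/ W' x) -> (forall x, D x -> U' x -> W' x -> False) ->
    U' (E o) -> forall t, P t -> W' (E t) -> False.
  move=> Uo' Wo' cov' disj' Uo'' t' Pt' Wt'.
  have [s1 [s2 [h1 h2 h3]]] := reach t' Pt'.
  have end1 a b : seg a b -> D (E b).
    by move=> h; exists b => //; rewrite -(line1 a b); apply: h.
  case: (cov' _ (end1 _ _ h1)) => [U1|]; last exact: (seg_sep Uo' Wo' cov' disj' h1).
  case: (cov' _ (end1 _ _ h2)) => [U2|]; last exact: (seg_sep Uo' Wo' cov' disj' h2).
  exact: (seg_sep Uo' Wo' cov' disj' h3).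
have Do : D (E o) by exists o.
case: (cov _ Do) => ho.
  by apply: (key U W _ _ _ _ ho t Pt) => //; rewrite Et.
apply: (key W U _ _ _ _ ho s Ps) => //; last by rewrite Es.
  by move=> z /cov [|]; [right|left].
by move=> z Dz Wz Uz; exact: (disj z).
Qed.

End Connected.

Section Path.
Variable R : realType.
Local Notation C := R[i].
Variable n : nat.
Local Notation V := ('I_n -> C).
Variables (M : 'M[R]_n) (la : 'I_n -> R).
Hypothesis laP : forall i, la i \in [:: -1; 0; 1].

(* The path, in logarithmic coordinates [t = log y^omega], is the shifted ray
   [(t + i e) la]. *)
Definition zt (e t : R) : C := t +i* e.
Definition gam (e t : R) : V := fun i => (la i)%:C * zt e t.

Lemma la_le1 i : `|la i| <= 1.
Proof.
have := laP i; rewrite !inE => /or3P[] /eqP ->; by rewrite ?normrN ?normr1 ?normr0.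
Qed.

Lemma cabs_zt_le e t : cabs (zt e t) <= `|t| + `|e|.
Proof. by apply: le_trans (cabs_le_ReIm _) _. Qed.

Lemma gam_norm e t : vnorm (gam e t) <= `|t| + `|e|.
Proof.
apply: vnorm_le => [|i]; first by rewrite addr_ge0.
rewrite cabsM cabs_real; apply: le_trans (cabs_zt_le e t).
by rewrite -[leRHS]mul1r ler_wpM2r ?cabs_ge0 ?la_le1.
Qed.

Lemma gam_dist e t t' : vnorm (vsub (gam e t) (gam e t')) <= `|t - t'|.
Proof.
apply: vnorm_le => // i.
have -> : vsub (gam e t) (gam e t') i = (la i)%:C * (t - t')%:C.
  by rewrite /vsub /gam -mulrBr; congr (_ * _); apply: complex_eq => //=; rewrite ?subrr.
by rewrite cabsM !cabs_real -[leRHS]mul1r ler_wpM2r ?la_le1.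
Qed.

Definition mla i : R := \sum_j M i j * la j.

Lemma lf_gam e t i : lf M (gam e t) i = (mla i)%:C * zt e t.
Proof.
rewrite /lf /mv /mla /gam rmorph_sum mulr_suml; apply: eq_bigr => j _.
by rewrite mxE rmorphM mulrA.
Qed.

Lemma cexp_zt (a e t : R) : cexp (a%:C * zt e t) = expR (a * t) * cos (a * e) +i* (expR (a * t) * sin (a * e)).
Proof.
rewrite /cexp /zt; apply: complex_eq => /=;
by rewrite !(mul0r, subr0, mul1r, mulr0, add0r, addr0).
Qed.

Section OneCoordinate.
Variables (i : 'I_n) (tm e : R).
Hypothesis lai : la i != 0.

Lemma lai_cases : la i = -1 \/ la i = 1.
Proof.
have := laP i; rewrite !inE => /or3P[] /eqP h; [by left| |by right].
by move: lai; rewrite h eqxx.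
Qed.

Lemma sin_lai : 0 < e -> e < 1 -> sin (la i * e) != 0.
Proof.
move=> e0 e1; have s0 : 0 < sin e by apply: sin2_gt0; lra.
case: lai_cases => ->; rewrite ?mulN1r ?mul1r ?sinN ?oppr_eq0; exact: lt0r_neq0.
Qed.

Lemma expR_lai_dist t t' : 0 <= t <= tm -> 0 <= t' <= tm ->
  expR (- tm) * `|t - t'| <= `|expR (la i * t) - expR (la i * t')|.
Proof.
have H (x y : R) : - tm <= y -> y <= x -> expR (- tm) * (x - y) <= expR x - expR y.
  move=> hy hx; have -> : expR x - expR y = expR y * (expR (x - y) - 1).
    by rewrite mulrBr -expRD mulr1 [y + _]addrC subrK.
  apply: ler_pM; rewrite ?expR_ge0 ?subr_ge0 ?ler_expR //.
  by rewrite lerBrDl expR_ge1Dx.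
wlog h : t t' / la i * t' <= la i * t.
  move=> W ht ht'; have [h|/ltW h] := leP (la i * t') (la i * t); first exact: W.
  by rewrite distrC [leRHS]distrC; apply: W.
move=> /andP[t0 t1] /andP[t0' t1'].
have h2 : - tm <= la i * t' by case: lai_cases => ->; lra.
rewrite [leRHS]ger0_norm ?subr_ge0 ?ler_expR //.
apply: le_trans (H _ _ h2 h); rewrite ler_wpM2l ?expR_ge0 //.
rewrite -mulrBr; have : 0 <= la i * (t - t') by rewrite mulrBr subr_ge0.
by case: lai_cases => -> h3; [rewrite ler0_norm|rewrite ger0_norm]; lra.
Qed.

(* The argument of [1 - rho e^{i theta}] is monotone in [rho]. *)
Lemma cross_ineq (A A' p q c s : R) :
  0 < A -> A * `|p - q| * `|s| <=
   cabs (A%:C * ((1 - p * c) +i* (- (p * s))) - A'%:C * ((1 - q * c) +i* (- (q * s))))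
   * cabs ((1 - q * c) +i* (- (q * s))).
Proof.
move=> A0; set v := (1 - q * c) +i* _; set d := _ - _.
rewrite mulrC -[cabs v]cabsN.
have cj : cabs (- v) = cabs ((1 - q * c) +i* (q * s)).
  by rewrite cabsN /cabs /v !normc_def /= sqrrN.
rewrite cj -cabsM; apply: le_trans (Im_le_cabs _).
rewrite [leLHS](_ : _ = `|A * (q - p) * s|); last first.
  by rewrite !normrM (ger0_norm (ltW A0)) (distrC q) mulrC.
by rewrite le_eqVlt; apply/orP; left; apply/eqP; congr `|_|; rewrite /d /v /=; ring.
Qed.

Lemma gam_coord t : Emap M (gam e t) i = cexp ((- mla i)%:C * zt e 0) *
   ((expR (- mla i * t))%:C *
    ((1 - expR (la i * t) * cos (la i * e)) +i* (- (expR (la i * t) * sin (la i * e))))).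
Proof.
rewrite /Emap lf_gam /gam cexp_zt mulrC mulrA; congr (_ * _); last first.
  by apply: complex_eq => /=; rewrite ?sub0r.
rewrite -cexp_real -cexpD; congr cexp; apply: complex_eq => /=; ring.
Qed.

(** Injectivity of the ray in quantitative form, needed to thicken it to a tube. The constant
    contains sin e, positive for 0 < e < 1; Q bounds the second factor in [cross_ineq]. *)
Lemma gam_inj_coord : 0 < e -> e < 1 -> exists2 c : R, 0 < c & forall t t',
  0 <= t <= tm -> 0 <= t' <= tm ->
  c * `|t - t'| <= cabs (Emap M (gam e t) i - Emap M (gam e t') i).
Proof.
move=> e0 e1.
have s0 : 0 < `|sin (la i * e)| by rewrite normr_gt0 sin_lai.
pose Q : R := 2 * (1 + expR tm).
have Q0 : 0 < Q by rewrite mulr_gt0 // addr_gt0 ?expR_gt0.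
exists (expR (- `|mla i| * tm) * expR (- tm) * `|sin (la i * e)| / Q).
  by rewrite divr_gt0 // mulr_gt0 // mulr_gt0 ?expR_gt0.
move=> t t' ht ht'.
rewrite !gam_coord -mulrBr cabsM.
have -> : cabs (cexp ((- mla i)%:C * zt e 0)) = 1.
  by rewrite cabs_cexp /= !(mulr0, mul0r, subr0) expR0.
rewrite mul1r mulrAC ler_pdivrMr //.
apply: le_trans (_ : expR (- mla i * t) * `|expR (la i * t) - expR (la i * t')|
   * `|sin (la i * e)| <= _).
  rewrite mulrAC ler_wpM2r // -mulrA; apply: ler_pM; rewrite ?expR_ge0 ?mulr_ge0 ?expR_ge0 //.
    rewrite ler_expR; case/andP: ht => t0 t1.
    apply: le_trans (_ : - `|mla i| * t <= _); first by rewrite ler_wnM2l // oppr_le0.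
    by rewrite ler_wpM2r // lerN2 ler_norm.
  exact: expR_lai_dist.
apply: le_trans (cross_ineq _ _ _ _ _ (expR_gt0 _)) _.
apply: ler_wpM2l; first exact: cabs_ge0.
apply: le_trans (cabs_le_ReIm _) _ => /=.
have r1 : expR (la i * t') <= expR tm.
  by rewrite ler_expR; case/andP: ht' => a b'; case: lai_cases => ->; lra.
have r0 := expR_ge0 (la i * t').
have h1 : `|expR (la i * t') * cos (la i * e)| <= expR tm.
  rewrite normrM (ger0_norm r0) -[leRHS]mulr1; apply: ler_pM => //; exact: cos_max.
have h2 : `|expR (la i * t') * sin (la i * e)| <= expR tm.
  rewrite normrM (ger0_norm r0) -[leRHS]mulr1; apply: ler_pM => //; exact: sin_max.
rewrite normrN /Q; have := ler_normB 1 (expR (la i * t') * cos (la i * e)); rewrite normr1; lra.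
Qed.

Lemma gam_lower_coord t1 t : 0 < t1 -> t1 <= t -> t <= tm ->
  expR (- `|mla i| * tm) * (1 - expR (- t1)) <= cabs (Emap M (gam e t) i).
Proof.
move=> t10 h1 h2; rewrite /Emap lf_gam /gam cabsM mulrC.
have E : expR (- `|mla i| * tm) <= cabs (cexp (- ((mla i)%:C * zt e t))).
  rewrite cabs_cexp ler_expR /= mul0r subr0.
  have t0 : 0 <= t by lra.
  apply: le_trans (_ : - `|mla i| * t <= _); first by rewrite ler_wnM2l // oppr_le0.
  by rewrite mulNr lerN2 ler_wpM2r // ler_norm.
have p1 : expR (- t1) <= 1 by rewrite -expR0 ler_expR; lra.
rewrite mulrC [leRHS]mulrC; apply: ler_pM => //; rewrite ?expR_ge0 ?subr_ge0 //.
have := ler_cabs_sub 1 (cexp ((la i)%:C * zt e t)).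
have := ler_cabs_sub (cexp ((la i)%:C * zt e t)) 1.
rewrite (cabsBC _ 1) cabs1 cabs_cexp /= mul0r subr0.
case: lai_cases => ->; rewrite ?mulN1r ?mul1r.
  have : expR (- t) <= expR (- t1) by rewrite ler_expR lerN2.
  lra.
have h3 : expR t1 <= expR t by rewrite ler_expR.
have h4 : expR t1 * expR (- t1) = 1 by rewrite -expRD subrr expR0.
have := expR_gt0 (- t1); have h5 := expR_ge1Dx t1; nra.
Qed.

End OneCoordinate.
End Path.

(** * Choosing a shift for which the ray avoids finitely many points *)

Section OffRay.
Variable R : realType.
Local Notation C := R[i].

(** Either z is off the whole line through e^{ie}, or z = 0, which lies on that line but not on the
    part e^{s + ie}, s >= 0, of modulus at least 1. *)
Definition offray (e : R) (z : C) : Prop :=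
  z = 0 \/ complex.Im z * cos e - complex.Re z * sin e != 0.

(** A nonzero z is met by at most one angle in (0, 1), as two lines through 0 with such angles meet
    only at 0. For each z the interval is cut at the bad angle, if there is one. *)
Lemma offray_exists (rs : seq C) (a b : R) : 0 < a -> a < b -> b < 1 ->
  exists a' b', [/\ a <= a', a' < b', b' <= b &
    forall e, a' < e -> e < b' -> forall z, z \in rs -> offray e z].
Proof.
move=> a0 ab b1; elim: rs => [|z rs [a' [b' [h1 h2 h3 IH]]]]; first by exists a, b.
have [[e1 [e11 e12 /eqP bad]]|good] :=
  pselect (exists e1, [/\ a' < e1, e1 < b' &
    complex.Im z * cos e1 - complex.Re z * sin e1 == 0]); last first.
  exists a', b'; split => // e ea eb y; rewrite inE => /orP[/eqP ->|]; last exact: IH.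
  by right; apply/negP => h; apply: good; exists e.
exists a', e1; split => //; first exact: le_trans (ltW e12) h3.
move=> e ea eb y; rewrite inE => /orP[/eqP ->|]; last by apply: IH => //; exact: lt_trans eb e12.
have [[x0 y0]|nz] := pselect (complex.Re z = 0 /\ complex.Im z = 0).
  by left; apply: complex_eq.
right; apply/negP => /eqP bad2; apply: nz.
have s0 : 0 < sin (e1 - e) by apply: sin2_gt0; lra.
rewrite sinB in s0; move: bad bad2 s0.
move: (complex.Re z) (complex.Im z) (sin e1) (cos e1) (sin e) (cos e) => x u s c s' c'.
move=> b1' b2' s0; split.
  have : x * (s * c' - c * s') = (u * c' - x * s') * c - (u * c - x * s) * c' by ring.
  rewrite b1' b2' !mul0r subrr => /eqP; rewrite mulf_eq0 (gt_eqF s0) orbF.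
  by move/eqP.
have : u * (s * c' - c * s') = (u * c' - x * s') * s - (u * c - x * s) * s' by ring.
rewrite b1' b2' !mul0r subrr => /eqP; rewrite mulf_eq0 (gt_eqF s0) orbF.
by move/eqP.
Qed.

(** Multiplication by e^{-ie} makes the ray real, so the imaginary part of the rotated z bounds the
    distance from below, for all t at once. *)
Lemma offray_gap (e : R) z : offray e z -> exists2 c : R, 0 < c & forall t, 0 <= t ->
  c <= cabs (cexp (zt e t) - z).
Proof.
have cexpE t : cexp (zt e t) = (expR t * cos e) +i* (expR t * sin e).
  by rewrite -[zt e t]mul1r (cexp_zt 1) !mul1r.
case=> [->|h].
  by exists 1 => // t t0; rewrite subr0 cabs_cexp /= -expR0 ler_expR.
exists `|complex.Im z * cos e - complex.Re z * sin e|; first by rewrite normr_gt0.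
move=> t _; rewrite cexpE.
have u1 : cabs (cos e -i* sin e) = 1.
  by rewrite /cabs normc_def /= sqrrN cos2Dsin2 sqrtr1.
rewrite -[leRHS]mulr1 -u1 -cabsM; apply: le_trans (Im_le_cabs _).
rewrite -normrN le_eqVlt; apply/orP; left; apply/eqP; congr `|_|.
by case: z h => x y /= _; ring.
Qed.

Lemma offray_prod_gap (e : R) (rs : seq C) : (forall z, z \in rs -> offray e z) ->
  exists2 c : R, 0 < c & forall t, 0 <= t ->
  c <= cabs (\prod_(z <- rs) (cexp (zt e t) - z)).
Proof.
elim: rs => [|z rs IH] h; first by exists 1 => // t _; rewrite big_nil cabs1.
have [|c c0 hc] := IH; first by move=> y hy; apply: h; rewrite inE hy orbT.
have [|c' c'0 hc'] := @offray_gap e z; first by apply: h; rewrite mem_head.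
exists (c' * c) => [|t t0]; first by rewrite mulr_gt0.
by rewrite big_cons cabsM; apply: ler_pM; [exact: ltW | exact: ltW | exact: hc' | exact: hc].
Qed.

End OffRay.

Section Domain.
Variable R : realType.
Local Notation C := R[i].
Variable n : nat.
Local Notation V := ('I_n -> C).
Variables (M : 'M[R]_n) (la : 'I_n -> R).
Hypothesis laP : forall i, la i \in [:: -1; 0; 1].

(* Up to powers of [w = cexp (zt e t)] and the factors [- cexp (- lf M t i)], the
   rows of [dE] along the path, as polynomials in [w]. *)
Definition Qmx : 'M[{poly C}]_n := \matrix_(i, j)
  (if la i == 0 then (i == j)%:R
   else if la i == -1 then ('X - 1) * ((M i j)%:C)%:P + (i == j)%:R
   else (1 - 'X) * ((M i j)%:C)%:P + 'X * (i == j)%:R).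

Lemma horner_delta (i j : 'I_n) (w : C) : ((i == j)%:R : {poly C}).[w] = (i == j)%:R.
Proof. by case: (i == j); rewrite ?hornerC ?horner0. Qed.

Lemma det_dE_gam e t : \det (dE M (gam la e t)) =
  \prod_i (- cexp (- lf M (gam la e t) i) * (if la i == -1 then (cexp (zt e t))^-1 else 1))
  * (\det Qmx).[cexp (zt e t)].
Proof.
set w := cexp (zt e t).
pose r : 'rV[C]_n := \row_i (- cexp (- lf M (gam la e t) i) * (if la i == -1 then w^-1 else 1)).
have w0 : w != 0 by exact: cexp_neq0.
have -> : dE M (gam la e t) = diag_mx r *m map_mx (horner_eval w) Qmx.
  apply/matrixP => i j; rewrite mul_diag_mx !mxE /horner_eval -mulrA; congr (_ * _).
  rewrite /gam; have := laP i; rewrite !inE => /or3P[] /eqP ->.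
  - have -> : cexp ((-1)%:C * zt e t) = w^-1.
      by rewrite -cexpN; congr cexp; apply: complex_eq => /=; ring.
    move: w w0 {r} => w w0.
    rewrite oppr_eq0 oner_eq0 eqxx hornerD !hornerM hornerD hornerN !hornerC hornerX horner_delta.
    by field.
  - rewrite eqxx [0 == -1]eq_sym oppr_eq0 oner_eq0 mul0r cexp0 subrr mul0r add0r.
    by rewrite mulr1 mul1r horner_delta.
  - have -> : cexp (1%:C * zt e t) = w by rewrite mul1r.
    have -> : (1 == -1 :> R) = false by rewrite gt_eqF //; lra.
    move: w w0 {r} => w w0.
    rewrite oner_eq0 mul1r hornerD !hornerM hornerD hornerN !hornerC hornerX horner_delta.
    by ring.
rewrite det_mulmx det_diag det_map_mx; congr (_ * _).
by apply: eq_bigr => i _; rewrite mxE.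
Qed.

(** At w = 1, the value at t = 0, the matrix is the identity. *)
Lemma detQ_neq0 : \det Qmx != 0.
Proof.
apply/negP => /eqP e; have : (\det Qmx).[1] = 1.
  rewrite -[LHS]/(horner_eval 1 (\det Qmx)) -det_map_mx.
  rewrite (_ : map_mx _ _ = 1%:M) ?det1 //; apply/matrixP => i j.
  rewrite !mxE /= /horner_eval; case: eqP => _; first by rewrite horner_delta.
  case: eqP => _; rewrite hornerD !hornerM hornerD hornerN ?hornerX !hornerC horner_delta subrr mul0r add0r ?mul1r //.
by rewrite e horner0 => /eqP; rewrite eq_sym oner_eq0.
Qed.

(** The determinant splits into exponentials, bounded below on [0, tm], and linear factors w - z
    over the roots z; the shift is chosen to keep w off these roots. *)
Lemma det_dE_gam_gap (tm e1 : R) : 0 < e1 -> exists e : R, [/\ 0 < e, e < e1, e < 1 &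
  exists2 c : R, 0 < c & forall t, 0 <= t <= tm -> c <= cabs (\det (dE M (gam la e t)))].
Proof.
move=> e10; have [rs hrs] := closed_field_poly_normal (\det Qmx).
pose b : R := Num.min e1 2^-1.
have b0 : 0 < b by rewrite lt_min e10 invr_gt0 ltr0n.
have b1 : b <= e1 by rewrite ge_min lexx.
have b2 : b <= 2^-1 by rewrite ge_min lexx orbT.
have [|||a' [b' [h1 h2 h3 H]]] := @offray_exists R rs (b / 2) b; try lra.
pose e := (a' + b') / 2.
have ea : a' < e by rewrite /e; lra.
have eb : e < b' by rewrite /e; lra.
exists e; split; try lra.
have [c c0 hc] := offray_prod_gap (H e ea eb).
pose s := \sum_i `|mla M la i|.
have s0 : 0 <= s by apply: sumr_ge0.
pose d := expR (- (s * `|tm|)) * expR (- `|tm|).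
have d0 : 0 < d by rewrite mulr_gt0 ?expR_gt0.
exists (d ^+ n * (cabs (lead_coef (\det Qmx)) * c)).
  rewrite !mulr_gt0 ?exprn_gt0 // lt_neqAle cabs_ge0 andbT eq_sym cabs_eq0.
  by rewrite lead_coef_eq0 detQ_neq0.
move=> t /andP[t0 t1]; rewrite det_dE_gam cabsM; apply: ler_pM.
- by rewrite exprn_ge0 // ltW.
- by rewrite mulr_ge0 ?cabs_ge0 ?ltW.
- rewrite cabs_prod -[X in _ ^+ X]card_ord -prodr_const; apply: ler_prod => i _.
  rewrite (ltW d0) /= cabsM cabsN; apply: ler_pM; rewrite ?expR_ge0 //.
    rewrite cabs_cexp lf_gam ler_expR /= mul0r subr0 lerN2.
    apply: le_trans (ler_norm _) _; rewrite normrM; apply: ler_pM => //.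
      rewrite /s (bigD1 i) //= lerDl; exact: sumr_ge0.
    by rewrite !ger0_norm //; lra.
  case: ifP => _.
    by rewrite -cexpN cabs_cexp /= ler_expR lerN2; apply: le_trans t1 (ler_norm _).
  by rewrite cabs1 -expR0 ler_expR oppr_le0.
rewrite {2}hrs hornerZ (cabsM (lead_coef _)); apply: ler_wpM2l; first exact: cabs_ge0.
rewrite horner_prod; under eq_bigr do rewrite hornerD hornerN hornerX hornerC.
exact: hc.
Qed.

Lemma Emap_continuous t (e : R) : 0 < e ->
  exists2 d : R, 0 < d & forall s, vnorm (vsub s t) < d ->
    vnorm (vsub (Emap M s) (Emap M t)) < e.
Proof.
move=> e0; have [sr sr0 /(_ (vnorm t)) [L L0 HL]] := Emap_strict M.
have [Ld Ld0 HLd] := mv_bounded (dE M t).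
have p0 : 0 < Ld + L * sr + 1 by rewrite ltr_wpDl // addr_ge0 // mulr_ge0 // ltW.
exists (Num.min sr (e / (Ld + L * sr + 1))); first by rewrite lt_min sr0 divr_gt0.
move=> s; rewrite lt_min => /andP[s1]; rewrite ltr_pdivlMr // => s2.
have := HL t (lexx _) sr (lexx _) s t (ltW s1).
rewrite vsubxx => /(_ (ltW sr0)) h.
rewrite -[vsub (Emap _ _) _]vsubx0.
apply: le_lt_trans (ler_vdist (mv (dE M t) (vsub s t)) _ _) _.
rewrite vsubx0; have := HLd (vsub s t); have := vnorm_ge0 (vsub s t); nra.
Qed.

Lemma Emap_lipschitz (Rb : R) : exists d L : R, [/\ 0 < d, 0 < L & forall t, vnorm t <= Rb ->
  forall s, vnorm (vsub s t) <= d ->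
    vnorm (vsub (Emap M s) (Emap M t)) <= L * vnorm (vsub s t)].
Proof.
have [sr sr0 /(_ Rb) [L L0 HL]] := Emap_strict M.
have [a ha] := dE_bound M Rb.
have a1 : 0 < n%:R * `|a| + L * sr + 1 by rewrite ltr_wpDl // addr_ge0 // mulr_ge0 // ltW.
exists sr, (n%:R * `|a| + L * sr + 1); split => // t ht s hs.
have := HL t ht sr (lexx _) s t hs.
rewrite vsubxx => /(_ (ltW sr0)) h.
rewrite -[vsub (Emap _ _) _]vsubx0.
apply: le_trans (ler_vdist (mv (dE M t) (vsub s t)) _ _) _.
rewrite vsubx0.
have := @mv_bound _ _ (dE M t) `|a| (vsub s t) (fun i j => le_trans (ha t ht i j) (ler_norm _)).
by have := vnorm_ge0 (vsub s t); lra.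
Qed.

Lemma gam_separated (tm e : R) : 0 < e -> e < 1 -> exists2 c : R, 0 < c & forall t t',
  0 <= t <= tm -> 0 <= t' <= tm ->
  c * vnorm (vsub (gam la e t) (gam la e t'))
    <= vnorm (vsub (Emap M (gam la e t)) (Emap M (gam la e t'))).
Proof.
move=> e0 e1.
have [[i lai]|h] := pselect (exists i, la i != 0).
  have [c c0 hc] := gam_inj_coord M laP tm lai e0 e1; exists c => // t t' ht ht'.
  apply: le_trans (le_vnorm _ i); apply: le_trans (hc t t' ht ht').
  by rewrite ler_wpM2l ?gam_dist // ltW.
exists 1 => // t t' _ _; have -> : gam la e t = gam la e t'.
  apply/funext => i; rewrite /gam.
  suff -> : la i = 0 by rewrite !mul0r.
  by apply/eqP; apply/negP => /negP li; apply: h; exists i.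
by rewrite !vsubxx mulr0.
Qed.

(** A norm of at least 2r with e <= r forces t >= r. There e^{la_i (t + ie)} has modulus bounded
    away from 1 whatever the angle, so c does not depend on e. *)
Lemma gam_away (tm r : R) : 0 < r -> exists2 c : R, 0 < c & forall e t,
  0 <= e <= r -> 0 <= t <= tm -> 2 * r <= vnorm (gam la e t) ->
  c <= vnorm (Emap M (gam la e t)).
Proof.
move=> r0.
have [[i lai]|h] := pselect (exists i, la i != 0); last first.
  exists 1 => // e t _ _; have -> : gam la e t = fun _ => 0.
    apply/funext => i; rewrite /gam.
    suff -> : la i = 0 by rewrite !mul0r.
    by apply/eqP; apply/negP => /negP li; apply: h; exists i.
  by rewrite vnorm0; lra.
exists (expR (- `|mla M la i| * tm) * (1 - expR (- r))).
  by rewrite mulr_gt0 ?expR_gt0 // subr_gt0 -expR0 ltr_expR; lra.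
move=> e t /andP[e0 e1] /andP[t0 t1] h; apply: le_trans (le_vnorm _ i).
apply: gam_lower_coord => //.
by have := le_trans h (gam_norm laP e t); rewrite !ger0_norm //; lra.
Qed.

(* [P] is a ball around 0 together with a thin tube around the path. The path
   may return to points [x] near 0, but stays at a distance [c1] that does not
   depend on the shift [e], so the ball can be chosen before [e]. *)
Lemma branch_domain (tm e0 : R) : 0 <= tm -> 0 < e0 ->
  exists (e r : R) (P : V -> Prop), [/\ 0 < e, e < e0 & 0 < r] /\
   [/\ open_set P, (forall t, vnorm t < r -> P t), P (gam la e tm),
     (forall t, P t -> \det (dE M t) != 0) &
     (forall s t, P s -> P t -> Emap M s = Emap M t -> s = t)]
   /\ (forall t, P t -> exists s1 s2, [/\ seg P (fun _ => 0) s1, seg P s1 s2 & seg P s2 t]).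
Proof.
move=> tm0 e00.
have [r1' [K1 [r1'0 K10 NL1']]] := Emap_local (det_dE_0 M).
pose r1 := Num.min 1 r1'.
have r10 : 0 < r1 by rewrite lt_min ltr01.
have r11 : r1 <= 1 by rewrite ge_min lexx.
have NL1 : near_linear (Emap M) (fun _ => 0) (dE M (fun _ => 0)) r1 K1.
  by apply: near_linear_sub NL1'; rewrite ge_min lexx orbT.
have inj1 s t : vnorm s <= r1 -> vnorm t <= r1 -> Emap M s = Emap M t -> s = t.
  move=> hs ht est; apply: vnorm_le0; have := near_linear_inj NL1 (s := s) (t := t).
  by rewrite !vsubx0 est vsubxx mulr0; apply.
have r40 : 0 < r1 / 4 by rewrite divr_gt0.
have [c1 c10 hc1] := gam_away tm r40.
have [d2 d20 hd2] := Emap_continuous (fun _ => 0) (divr_gt0 c10 (ltr0n _ 4) : 0 < c1 / 4).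
pose r2 := Num.min d2 (r1 / 4).
have r20 : 0 < r2 by rewrite lt_min d20.
have r21 : r2 <= r1 / 4 by rewrite ge_min lexx orbT.
have hr2 t : vnorm t < r2 -> vnorm (Emap M t) <= c1 / 4.
  rewrite lt_min => /andP[h _]; have := hd2 t; rewrite Emap0 !vsubx0 => H.
  exact: ltW (H h).
have m0 : 0 < Num.min e0 r2 by rewrite lt_min e00.
have [e [ep em e1 [c c0 hc]]] := det_dE_gam_gap tm m0.
have ee0 : e < e0 by apply: lt_le_trans em _; rewrite ge_min lexx.
have er2 : e < r2 by apply: lt_le_trans em _; rewrite ge_min lexx orbT.
pose Rb := tm + 1.
have gb t : 0 <= t <= tm -> vnorm (gam la e t) <= Rb.
  move=> /andP[t0 t1]; apply: le_trans (gam_norm laP e t) _.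
  by rewrite !ger0_norm // ?(ltW ep) //; rewrite /Rb; lra.
have [ro [K [ro0 K0 NL]]] := @Emap_near_linear R n M Rb c c0.
have [dl [L [dl0 L0 lip]]] := Emap_lipschitz Rb.
have [ci ci0 hci] := gam_separated tm ep e1.
(* In turn: validity of the Lipschitz bound; a tube point of norm above r1 has its axis point of
   norm at least r1/2; images move by at most c1/4 across the tube; two tube points with equal image
   have axis points within 2 L rho/ci, so both lie in one ball of radius [ro] where [Emap] is
   injective. *)
pose rho := Num.min (Num.min dl (r1 / 4)) (Num.min (c1 / (4 * L)) (ro / (1 + 2 * L / ci))).
have q0 : 0 < 1 + 2 * L / ci by rewrite addr_gt0 // divr_gt0 // mulr_gt0.
have rho0 : 0 < rho.
  by rewrite !lt_min dl0 r40 !divr_gt0 // mulr_gt0.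
have rho1 : rho <= dl by rewrite !ge_min lexx.
have rho2 : rho <= r1 / 4 by rewrite !ge_min lexx !orbT.
have rho3 : L * rho <= c1 / 4.
  have : rho <= c1 / (4 * L) by rewrite !ge_min lexx !orbT.
  by rewrite ler_pdivlMr ?mulr_gt0 // => h; rewrite ler_pdivlMr //; lra.
have rho4 : rho * (1 + 2 * L / ci) <= ro.
  by rewrite -ler_pdivlMr // !ge_min lexx !orbT.
have rho5 : rho <= ro.
  apply: le_trans rho4; rewrite -[leLHS]mulr1; apply: ler_wpM2l; first exact: ltW.
  by rewrite lerDl ltW // divr_gt0 // mulr_gt0.
pose T t tau := 0 <= tau <= tm /\ vnorm (vsub t (gam la e tau)) < rho.
pose P t := vnorm t < r2 \/ exists tau, T t tau.
have lipT t tau : T t tau -> vnorm (vsub (Emap M t) (Emap M (gam la e tau))) <= c1 / 4.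
  move=> [htau ht]; apply: le_trans (lip _ (gb _ htau) _ _) _.
    exact: le_trans (ltW ht) rho1.
  by apply: le_trans rho3; rewrite ler_wpM2l // ltW.
(* If t is outside the ball of radius r1, its image has norm at least 3 c1/4, while images of the
   ball of radius r2 have norm at most c1/4. *)
have injBT s t tau : vnorm s < r2 -> T t tau -> Emap M s = Emap M t -> s = t.
  move=> hs ht est; have [h|h] := leP (vnorm t) r1.
    by apply: inj1 => //; apply: le_trans (ltW hs) _; lra.
  have [htau ht1] := ht.
  have g1 : 2 * (r1 / 4) <= vnorm (gam la e tau).
    have := ler_vdist (gam la e tau) t (fun _ => 0); rewrite !vsubx0; lra.
  have h1 := hc1 e tau _ htau g1.
  have {}h1 : c1 <= vnorm (Emap M (gam la e tau)) by apply: h1; rewrite ltW //=; lra.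
  have h2 := lipT _ _ ht; have h3 := hr2 _ hs; rewrite est in h3.
  have := ler_vdist (Emap M t) (Emap M (gam la e tau)) (fun _ => 0).
  rewrite !vsubx0 (vnormBC (Emap M (gam la e tau))); move=> h4; clear est; exfalso; lra.
have injTT s t tau tau' : T s tau -> T t tau' -> Emap M s = Emap M t -> s = t.
  move=> [hs1 hs2] [ht1 ht2] est.
  have NLt := NL _ (gb _ hs1) (hc _ hs1).
  have h0 := hci _ _ hs1 ht1.
  have ls : vnorm (vsub (Emap M s) (Emap M (gam la e tau))) <= L * rho.
    apply: le_trans (lip _ (gb _ hs1) _ _) _; first exact: le_trans (ltW hs2) rho1.
    by rewrite ler_wpM2l // ltW.
  have lt : vnorm (vsub (Emap M t) (Emap M (gam la e tau'))) <= L * rho.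
    apply: le_trans (lip _ (gb _ ht1) _ _) _; first exact: le_trans (ltW ht2) rho1.
    by rewrite ler_wpM2l // ltW.
  have ez : vnorm (vsub (Emap M s) (Emap M t)) = 0 by rewrite est vsubxx.
  rewrite est in ls; clear est.
  have h1 : ci * vnorm (vsub (gam la e tau) (gam la e tau')) <= 2 * (L * rho).
    apply: le_trans h0 _; apply: le_trans (ler_vdist (Emap M t) _ _) _.
    rewrite vnormBC; lra.
  have h2 : vnorm (vsub (gam la e tau) (gam la e tau')) <= 2 * L / ci * rho.
    rewrite mulrAC ler_pdivlMr // mulrC; lra.
  have h3 : vnorm (vsub t (gam la e tau)) <= ro.
    apply: le_trans (ler_vdist (gam la e tau') _ _) _.
    rewrite (vnormBC (gam la e tau')); lra.
  apply: vnorm_le0; have := near_linear_inj NLt (le_trans (ltW hs2) rho5) h3.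
  by rewrite ez mulr0.
have gam0 : vnorm (gam la e 0) < r2.
  apply: le_lt_trans (gam_norm laP e 0) _.
  by rewrite normr0 add0r ger0_norm // ltW.
exists e, r2, P; split => //; split.
  split.
  - move=> t [ht|[tau [h1 ht]]].
      exists (r2 - vnorm t); first by rewrite subr_gt0.
      move=> y hy; left.
      have := ler_vdist t y (fun _ => 0); rewrite !vsubx0; lra.
    exists (rho - vnorm (vsub t (gam la e tau))); first by rewrite subr_gt0.
    move=> y hy; right; exists tau; split => //.
    have := ler_vdist t y (gam la e tau); lra.
  - by move=> t ht; left.
  - by right; exists tm; split; [rewrite tm0 lexx | rewrite vsubxx].
  - move=> t [ht|[tau [h1 ht]]].
      by apply: (Emap_det_neq0 NL1); rewrite vsubx0; lra.
    exact: (Emap_det_neq0 (NL _ (gb _ h1) (hc _ h1))) (lt_le_trans ht rho5).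
  move=> s t [hs|[tau hs]] [ht|[tau' ht]] est.
  - by apply: inj1 => //; lra.
  - exact: injBT hs ht est.
  - by apply/esym; apply: injBT ht hs _.
  - exact: injTT hs ht est.
have segB s t : vnorm s < r2 -> vnorm t < r2 -> seg P s t.
  move=> hs ht x x0 x1; left.
  apply: (@le_lt_trans _ _ ((1 - x) * vnorm s + x * vnorm t)); last first.
    have [h|/ltW h] := leP (vnorm s) (vnorm t).
      have : 0 <= (1 - x) * (vnorm t - vnorm s) by rewrite mulr_ge0 ?subr_ge0.
      by move=> h'; apply: le_lt_trans ht; lra.
    have : 0 <= x * (vnorm s - vnorm t) by rewrite mulr_ge0 ?subr_ge0.
    by move=> h'; apply: le_lt_trans hs; lra.
  have -> : line s t x = vadd (fun i => (1 - x)%:C * s i) (fun i => x%:C * t i).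
    by apply/funext => i; rewrite /line /vadd rmorphB rmorph1; ring.
  apply: le_trans (ler_vnormD _ _) _; rewrite !vnormZ !cabs_real !ger0_norm //.
  by rewrite subr_ge0.
move=> t [ht|[tau [htau ht]]].
  exists (fun _ => 0), (fun _ => 0); split; apply: segB => //; by rewrite vnorm0.
exists (gam la e 0), (gam la e tau); split.
- by apply: segB => //; rewrite vnorm0.
- move=> x x0 x1; right; exists (x * tau); split.
    case/andP: htau => t0 t1; rewrite mulr_ge0 //=.
    by apply: le_trans t1; rewrite -[leRHS]mul1r ler_wpM2r.
  have -> : line (gam la e 0) (gam la e tau) x = gam la e (x * tau).
    by apply/funext => i; rewrite /line /gam /zt; apply: complex_eq => /=; ring.
  by rewrite vsubxx.
move=> x x0 x1; right; exists tau; split => //.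
have -> : vsub (line (gam la e tau) t x) (gam la e tau)
  = fun i => x%:C * vsub t (gam la e tau) i.
  by apply/funext => i; rewrite /line /vsub; ring.
rewrite vnormZ cabs_real ger0_norm //; apply: le_lt_trans ht.
by rewrite -[leRHS]mul1r ler_wpM2r ?vnorm_ge0.
Qed.

End Domain.

(** * Exponents of the Puiseux series *)

Section LinearAlgebra.
Variable R : realType.
Local Notation C := R[i].
Variable n : nat.
Implicit Types (A B : 'M[R]_n) (a : 'cV[R]_n) (t : 'I_n -> C).

Lemma lfM A B t : lf (A *m B) t = lf A (lf B t).
Proof. by rewrite /lf map_mxM mvM. Qed.

Lemma lf1 t : lf 1%:M t = t.
Proof. by rewrite /lf map_mx1 mv1. Qed.

Lemma lfE A t i : lf A t i = \sum_j (A i j)%:C * t j.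
Proof. by apply: eq_bigr => j _; rewrite mxE. Qed.

Lemma lfD A (s t : 'I_n -> C) i : lf A (fun j => s j + t j) i = lf A s i + lf A t i.
Proof. by rewrite !lfE -big_split /=; apply: eq_bigr => j _; rewrite mulrDr. Qed.

Lemma pairingM A a t : pairing (A *m a) t = pairing a (lf A^T t).
Proof.
rewrite /pairing.
under eq_bigr do rewrite mxE rmorph_sum mulr_suml.
rewrite exchange_big /=; apply: eq_bigr => j _.
rewrite lfE mulr_sumr; apply: eq_bigr => i _.
by rewrite mxE rmorphM mulrCA mulrA.
Qed.

Lemma pairing_vD a (s t : 'I_n -> C) : pairing a (fun j => s j + t j) = pairing a s + pairing a t.
Proof. by rewrite /pairing -big_split /=; apply: eq_bigr => j _; rewrite mulrDr. Qed.

Lemma pairing_natcol (k : 'I_n -> nat) t : pairing (natcol R k) t = \sum_i (k i)%:R * t i.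
Proof. by apply: eq_bigr => i _; rewrite mxE rmorph_nat. Qed.

Lemma cexp_pairing_natcol (k : 'I_n -> nat) t :
  cexp (pairing (natcol R k) t) = mono (fun i => cexp (t i)) k.
Proof. by rewrite pairing_natcol cexp_sum; apply: eq_bigr => i _; rewrite cexpMn. Qed.

End LinearAlgebra.

Section Exponents.
Variable R : realType.
Local Notation C := R[i].
Variable n : nat.
Variables (om sg : 'I_n -> 'I_n -> nat) (kd : 'I_n -> kind) (d : 'I_n -> nat).
Hypothesis Hk : \det (kappa R om sg kd) != 0.
Hypothesis Ho : \det (omega_mx R om) != 0.
Local Notation kap := (kappa R om sg kd).
Local Notation bet := (betabar R om sg kd).
Local Notation B := (Bmx R om sg kd).
Local Notation av := (avec R om sg kd d).
Local Notation ki := (kinv R om sg kd).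

Lemma kap_unit : kap \in unitmx. Proof. by rewrite unitmxE unitfE. Qed.
Lemma om_unit : omega_mx R om \in unitmx. Proof. by rewrite unitmxE unitfE. Qed.

(** For c in T, column c of kappa is omega^(c) - sigma^(c), so kappa^{-1} kappa = 1 gives Phi = Psi
    - 1 in that column. This trades -Phi for -Psi and produces the extra k_i. *)
Lemma avecE k i : av k i 0 = dkinv R om sg kd d i
  + rowdot kd isJ (Phi R om sg kd) i k + rowdot kd isL (Psi R om sg kd) i k
  - rowdot kd Defs.isT (Psi R om sg kd) i k + (if Defs.isT (kd i) then (k i)%:R else 0).
Proof.
have psiphi c : Defs.isT (kd c) -> Phi R om sg kd i c = Psi R om sg kd i c - (i == c)%:R.
  move=> hc; have : (ki *m kap) i c = (i == c)%:R by rewrite mulVmx ?kap_unit // mxE.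
  move=> <-; rewrite !mxE -sumrB; apply: eq_bigr => r _.
  by rewrite !mxE /mu_col /nu_col; case: (kd c) hc => // _; ring.
rewrite /avec mxE.
have -> : (ki *m natcol R d) i 0 = dkinv R om sg kd d i.
  by rewrite mxE; apply: eq_bigr => c _; rewrite mxE mulrC.
have -> : (if Defs.isT (kd i) then (k i)%:R else 0) =
   \sum_c (if Defs.isT (kd c) then (i == c)%:R * (k c)%:R else 0) :> R.
  rewrite (bigD1 i) //= eqxx mul1r big1 ?addr0 // => c ci.
  by rewrite eq_sym (negbTE ci) mul0r; case: ifP.
rewrite -!addrA; congr (_ + _).
rewrite /rowdot (big_mkcond (fun c => isJ (kd c))) (big_mkcond (fun c => isL (kd c)))
  (big_mkcond (fun c => Defs.isT (kd c))) /= -sumrN -!big_split /= mxE.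
rewrite -/B; apply: eq_bigr => c _.
have -> : (ki *m bet) i c * natcol R k c 0 = (\sum_r ki i r * bet r c) * (k c)%:R.
  by rewrite !mxE.
have h := psiphi c; rewrite !mxE in h *.
case e: (kd c) h => /= h.
- rewrite oppr0 !addr0; congr (_ * _); apply: eq_bigr => r _.
  by rewrite !mxE /beta_col /nu_col e subr0.
- rewrite oppr0 !addr0 add0r; congr (_ * _); apply: eq_bigr => r _.
  by rewrite !mxE /beta_col /nu_col e subr0.
rewrite !add0r -mulNr -mulrDl; congr (_ * _).
rewrite -[RHS]opprK opprD opprK -h // -sumrN; apply: eq_bigr => r _.
by rewrite !mxE /beta_col /nu_col e; ring.
Qed.

(** All exponents are expressed by the argument of the Gamma function; the phase exponent k_t +
    m_t(k) becomes its entry a_t, so the phase can be absorbed into a shift of log x_t by i pi. *)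
Lemma mexpE k i : mexp R om sg kd d k i =
  match kd i with KJ => (k i)%:R | KL => - av k i 0 | KT => av k i 0 - (k i)%:R end.
Proof.
rewrite avecE /mexp; case: (kd i) => //=; ring.
Qed.

Definition Mx : 'M[R]_n := (sigma_mx R sg)^T *m invmx (omega_mx R om)^T.
(** As log y = omega^{-T} t, the monomial y^d is the exponential of the pairing of this vector with
    t. *)
Definition acoef : 'cV[R]_n := invmx (omega_mx R om) *m natcol R d.

Variables (t T ell : 'I_n -> C).

(* [T], [ell] and the point [t] are related as [log p], [log x] and [log y^omega]. *)
Hypothesis HJ : forall i, kd i = KJ -> T i = t i.
Hypothesis HL : forall i, kd i = KL -> ell i = T i - lf Mx t i.
Hypothesis HT : forall i, kd i = KT -> ell i = - ('i * (pi : R)%:C) + t i - T i - lf Mx t i.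

(** A logarithm of 1 - p_i, which is x y^sigma, y^omega or 1/(x y^sigma) according to the kind; in
    the last case it equals -p_i y^{-omega}. *)
Definition Zlog i : C := match kd i with
  | KJ => ell i + lf Mx t i | KL => t i | KT => 'i * (pi : R)%:C - t i + T i end.

(** u is log y, while v and w are the contributions of log x to log p and log(1 - p). The i pi in v
    is the sign in p = -y^(omega - sigma)/x. *)
Let u := lf (invmx (omega_mx R om)^T) t.
Let v i : C := match kd i with
  | KJ => 0 | KL => ell i | KT => - (ell i + 'i * (pi : R)%:C) end.
Let w i : C := match kd i with KJ => ell i | KL => 0 | KT => - ell i end.

Lemma tE : t = lf (omega_mx R om)^T u.
Proof. by rewrite /u -lfM mulmxV ?lf1 // unitmx_tr om_unit. Qed.

Lemma MxE : lf Mx t = lf (sigma_mx R sg)^T u.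
Proof. by rewrite /Mx lfM. Qed.

Lemma TE : T = fun i => lf kap^T u i + v i.
Proof.
apply/funext => i; rewrite /v.
have hS : lf Mx t i = \sum_j (sg i j)%:R * u j.
  by rewrite MxE lfE; apply: eq_bigr => j _; rewrite !mxE rmorph_nat.
have hO : t i = \sum_j (om i j)%:R * u j.
  by rewrite {1}tE lfE; apply: eq_bigr => j _; rewrite !mxE rmorph_nat.
rewrite lfE; under eq_bigr do rewrite !mxE /mu_col /nu_col.
have := HJ (i := i); have := HL (i := i); have := HT (i := i).
case: (kd i) => h1 h2 h3.
- rewrite h3 // hO addr0; apply: eq_bigr => j _.
  by rewrite subr0 rmorph_nat.
- rewrite h2 // hS; under eq_bigr do rewrite subr0 rmorph_nat.
  by ring.
rewrite h1 // hS hO.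
under [X in _ = X + _]eq_bigr do rewrite rmorphB !rmorph_nat mulrBl.
rewrite sumrB; ring.
Qed.

Lemma ZE i : Zlog i = lf bet^T u i + w i.
Proof.
have hS : lf Mx t i = \sum_j (sg i j)%:R * u j.
  by rewrite MxE lfE; apply: eq_bigr => j _; rewrite !mxE rmorph_nat.
have hO : t i = \sum_j (om i j)%:R * u j.
  by rewrite {1}tE lfE; apply: eq_bigr => j _; rewrite !mxE rmorph_nat.
rewrite /Zlog /w (lfE bet^T); under eq_bigr do rewrite !mxE /beta_col /nu_col.
have := HT (i := i).
case: (kd i) => h1.
- rewrite hS; under eq_bigr do rewrite subr0 rmorph_nat.
  by rewrite addrC.
- rewrite hO addr0; apply: eq_bigr => j _; by rewrite subr0 rmorph_nat.
rewrite h1 // hS.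
under [X in _ = X + _]eq_bigr do rewrite sub0r rmorphN rmorph_nat mulNr.
rewrite sumrN; ring.
Qed.

(** Both sides become linear in v and w once u = log y is eliminated by kappa^{-T} kappa^T = 1. The
    identity holds between logarithms, which fixes the branches of the noninteger powers and the
    phase together. *)
Lemma exponent_identity k :
  'i * (pi * \sum_(i < n | Defs.isT (kd i)) ((k i)%:R + mexp R om sg kd d k i))%:C
    + \sum_i (mexp R om sg kd d k i)%:C * ell i
  = pairing acoef t - pairing (ki *m natcol R d) T
    + \sum_i (k i)%:R * (Zlog i - lf B^T T i).
Proof.
have uk : kap^T \in unitmx by rewrite unitmx_tr kap_unit.
have kiT : ki^T = invmx kap^T by rewrite /kinv trmx_inv.
have e1 : pairing acoef t = pairing (natcol R d) u.
  by rewrite /acoef pairingM trmx_inv.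
have e2 : lf ki^T T = fun i => u i + lf ki^T v i.
  apply/funext => i; rewrite TE lfD -lfM kiT mulVmx // lf1 //.
have e3 : lf B^T T = fun i => lf bet^T u i + lf B^T v i.
  rewrite /Bmx trmx_mul lfM e2; apply/funext => i; by rewrite lfD -lfM.
have -> : pairing acoef t - pairing (ki *m natcol R d) T = - pairing (ki *m natcol R d) v.
  by rewrite e1 !pairingM e2 pairing_vD; ring.
have -> : \sum_i (k i)%:R * (Zlog i - lf B^T T i)
    = \sum_i (k i)%:R * w i - pairing (B *m natcol R k) v.
  rewrite pairingM pairing_natcol -sumrB; apply: eq_bigr => i _.
  by rewrite e3 ZE; ring.
have -> : - pairing (ki *m natcol R d) v +
   (\sum_i (k i)%:R * w i - pairing (B *m natcol R k) v)
   = \sum_i ((k i)%:R * w i - (av k i 0)%:C * v i).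
  rewrite sumrB -/(pairing (av k) v) /avec pairingD -/B; ring.
rewrite rmorphM rmorph_sum !mulr_sumr big_mkcond -big_split /=; apply: eq_bigr => i _.
rewrite /w /v mexpE; case: (kd i) => /=.
- by rewrite add0r rmorph_nat; ring.
- by rewrite add0r rmorphN; ring.
rewrite !rmorphD rmorphN !rmorph_nat; ring.
Qed.

(** The factor in front does not depend on k: it is y^d divided by p^a for a = kappa^{-1} d. The
    Puiseux series is thus a multiple of the series for p^a. *)
Lemma puiseux_gterm (X : 'I_n -> C) k :
  (forall i, X i = cexp (Zlog i - lf B^T T i)) ->
  puiseux_term om sg kd d ell k =
  cexp (pairing acoef t - pairing (ki *m natcol R d) T) * gterm B X (ki *m natcol R d) k.
Proof.
move=> hX; rewrite /puiseux_term /ctilde -cexp_sum mulrAC -cexpD exponent_identity cexpD.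
rewrite -mulrA /gterm; congr (_ * _); rewrite mulrC; congr (_ * _).
by rewrite cexp_sum; apply: eq_bigr => i _; rewrite cexpMn hX.
Qed.

End Exponents.

(** * Continuity of the functions entering the logarithms *)

Section Continuity.
Variable R : realType.
Local Notation C := R[i].
Variable n : nat.
Local Notation V := ('I_n -> C).
Variable Q : V -> Prop.
Implicit Types f g : V -> C.

Lemma cont_lip f (L : R) : (forall s t, cabs (f s - f t) <= L * vnorm (vsub s t)) ->
  continuous_on Q f.
Proof.
move=> h t _ e e0; exists (e / (`|L| + 1)) => [|s _].
  by rewrite divr_gt0 // ltr_wpDl.
rewrite ltr_pdivlMr ?ltr_wpDl // => hs; apply: le_lt_trans (h s t) _.
have := ler_norm L; have := vnorm_ge0 (vsub s t); nra.
Qed.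

Lemma cont_cst (c : C) : continuous_on Q (fun _ => c).
Proof. by apply: (@cont_lip _ 0) => s t; rewrite subrr cabs0 mul0r. Qed.

Lemma cont_coord i : continuous_on Q (fun t => t i).
Proof. by apply: (@cont_lip _ 1) => s t; rewrite mul1r; exact: (le_vnorm (vsub s t)). Qed.

Lemma cont_lf (M : 'M[R]_n) i : continuous_on Q (fun t => lf M t i).
Proof.
have [m m0 hm] := lf_bound M.
by apply: (@cont_lip _ m) => s t; rewrite -lfB.
Qed.

Lemma cont_add f g : continuous_on Q f -> continuous_on Q g ->
  continuous_on Q (fun t => f t + g t).
Proof.
move=> hf hg t Qt e e0.
have [d1 d10 h1] := hf t Qt (e / 2) (divr_gt0 e0 (ltr0n _ 2)).
have [d2 d20 h2] := hg t Qt (e / 2) (divr_gt0 e0 (ltr0n _ 2)).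
exists (Num.min d1 d2) => [|s Qs]; first by rewrite lt_min d10.
rewrite lt_min => /andP[s1 s2].
rewrite (_ : _ - _ = (f s - f t) + (g s - g t)); last by ring.
apply: le_lt_trans (ler_cabsD _ _) _.
by have := h1 s Qs s1; have := h2 s Qs s2; lra.
Qed.

Lemma cont_scale (c : C) f : continuous_on Q f -> continuous_on Q (fun t => c * f t).
Proof.
move=> hf t Qt e e0.
have p : 0 < cabs c + 1 by rewrite ltr_wpDl ?cabs_ge0.
have [d1 d10 h1] := hf t Qt (e / (cabs c + 1)) (divr_gt0 e0 p).
exists d1 => // s Qs hs; rewrite -mulrBr cabsM.
have := h1 s Qs hs; rewrite ltr_pdivlMr //.
have := cabs_ge0 (f s - f t); have := cabs_ge0 c; nra.
Qed.

Lemma cont_opp f : continuous_on Q f -> continuous_on Q (fun t => - f t).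
Proof.
move=> hf t Qt e e0; have [d1 d10 h1] := hf t Qt e e0.
by exists d1 => // s Qs hs; rewrite -opprD cabsN; exact: h1.
Qed.

Lemma cont_cexp f : continuous_on Q f -> continuous_on Q (fun t => cexp (f t)).
Proof.
move=> hf t Qt e e0.
have p : 0 < 5 * cabs (cexp (f t)) + 1 by rewrite ltr_wpDl // mulr_ge0 ?cabs_ge0.
have m0 : 0 < Num.min 2^-1 (e / (5 * cabs (cexp (f t)) + 1)).
  by rewrite lt_min invr_gt0 ltr0n divr_gt0.
have [d1 d10 h1] := hf t Qt _ m0.
exists d1 => // s Qs hs; have := h1 s Qs hs; rewrite lt_min => /andP[h2].
rewrite ltr_pdivlMr // => h3.
have -> : cexp (f s) - cexp (f t) = cexp (f t) * (cexp (f s - f t) - 1).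
  by rewrite mulrBr mulr1 -cexpD [f t + _]addrC subrK.
rewrite cabsM.
have := cexp_taylor1 (ltW h2); have := cabs_ge0 (cexp (f t)).
have := cabs_ge0 (f s - f t); nra.
Qed.

Lemma cont_clog f : (forall t, Q t -> cabs (f t - 1) <= 512^-1) ->
  continuous_on Q f -> continuous_on Q (fun t => clog (f t)).
Proof.
move=> h hf t Qt e e0; have [d1 d10 h1] := hf t Qt _ (divr_gt0 e0 (ltr0n _ 2)).
exists d1 => // s Qs hs; apply: le_lt_trans (clog_dist (h s Qs) (h t Qt)) _.
by have := h1 s Qs hs; lra.
Qed.

End Continuity.

Section Sums.
Variable R : realType.
Local Notation C := R[i].
Variable n : nat.

Lemma finite_min (f : 'I_n -> R) : (forall i, 0 < f i) ->
  exists2 m : R, 0 < m & forall i, m <= f i.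
Proof.
move=> h; have s0 : 0 <= \sum_i (f i)^-1.
  by apply: sumr_ge0 => i _; rewrite invr_ge0 ltW.
exists (\sum_i (f i)^-1 + 1)^-1 => [|i]; first by rewrite invr_gt0 ltr_wpDl.
rewrite -[leRHS]invrK lef_pV2 ?posrE ?invr_gt0 ?ltr_wpDl //.
rewrite (bigD1 i) //= -addrA lerDl addr_ge0 //.
by apply: sumr_ge0 => j _; rewrite invr_ge0 ltW.
Qed.

Lemma abs_summableZ (t : ('I_n -> nat) -> C) (c : C) :
  abs_summable t -> abs_summable (fun k => c * t k).
Proof.
move=> [M hM]; exists (cabs c * M) => N.
under eq_bigr do rewrite cabsM.
by rewrite -mulr_sumr ler_wpM2l ?cabs_ge0.
Qed.

Lemma has_sumZ (t : ('I_n -> nat) -> C) (c s : C) :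
  has_sum t s -> has_sum (fun k => c * t k) (c * s).
Proof.
move=> h e e0; have p : 0 < cabs c + 1 by rewrite ltr_wpDl ?cabs_ge0.
have [N0 hN] := h _ (divr_gt0 e0 p); exists N0 => N NN.
rewrite /box_sum -mulr_sumr -mulrBr cabsM.
have := hN N NN; rewrite ltr_pdivlMr // /box_sum.
set z := cabs (_ - _); have : 0 <= z by exact: cabs_ge0.
have := cabs_ge0 c; nra.
Qed.

Lemma holomorphic_cont0 (r0 : R) (F : ('I_n -> C) -> C) : 0 < r0 ->
  holomorphic_on (fun x => vnorm x < r0) F -> forall e : R, 0 < e ->
  exists2 dl : R, 0 < dl & forall x, vnorm x < dl -> cabs (F x - F (fun _ => 0)) <= e.
Proof.
move=> r00 /(_ (fun _ => 0)); rewrite vnorm0 => /(_ r00) [a /(_ 1 ltr01) [dl dl0 h]] e e0.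
pose s := \sum_i cabs (a i).
have s0 : 0 <= s by apply: sumr_ge0 => i _; exact: cabs_ge0.
exists (Num.min dl (e / (s + 1))) => [|x]; first by rewrite lt_min dl0 divr_gt0 // ltr_wpDl.
rewrite lt_min ltr_pdivlMr ?ltr_wpDl // => /andP[h1 h2].
have := h x h1; have -> : vadd (fun _ => 0) x = x by apply/funext => i; rewrite /vadd add0r.
rewrite mul1r => h3.
have h4 : cabs (\sum_i a i * x i) <= s * vnorm x.
  apply: le_trans (ler_cabs_sum _ _ _) _; rewrite /s mulr_suml.
  by apply: ler_sum => i _; rewrite cabsM ler_wpM2l ?cabs_ge0 ?le_vnorm.
have := ler_cabsD (F x - F (fun=> 0) - \sum_i a i * x i) (\sum_i a i * x i).
rewrite subrK; lra.
Qed.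

End Sums.

(** * The principal branch near the origin *)

Section NearOrigin.
Variable R : realType.
Local Notation C := R[i].
Variable n : nat.
Variables (om sg : 'I_n -> 'I_n -> nat) (d : 'I_n -> nat).
Hypothesis Ho : \det (omega_mx R om) != 0.

Lemma lf_natmx (v : 'I_n -> 'I_n -> nat) (u : 'I_n -> C) i :
  lf (mx_of R v)^T u i = \sum_j (v i j)%:R * u j.
Proof. by rewrite lfE; apply: eq_bigr => j _; rewrite !mxE rmorph_nat. Qed.

Lemma cexp_lf_natmx (v : 'I_n -> 'I_n -> nat) (u : 'I_n -> C) i :
  cexp (lf (mx_of R v)^T u i) = mono (fun j => cexp (u j)) (v i).
Proof. by rewrite lf_natmx cexp_sum; apply: eq_bigr => j _; rewrite cexpMn. Qed.

(** Continuity of Y at 0 keeps every Y_i near 1, where logarithms exist; the system then says that t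
    = omega^T log Y is a preimage of x under [Emap]. *)
Lemma principal_near0 (r0 : R) (Y : ('I_n -> C) -> 'I_n -> C) (r2 : R) :
  0 < r0 -> 0 < r2 -> principal_solution om sg r0 Y ->
  exists2 r : R, 0 < r /\ r <= r0 & forall x, vnorm x < r -> exists t : 'I_n -> C,
    [/\ vnorm t < r2, Emap (Mx R om sg) t = x &
        cexp (pairing (acoef R om d) t) = mono (Y x) d].
Proof.
move=> r00 r20 [hol Y0 sys].
have [m m0 hm] := lf_bound (omega_mx R om)^T.
(* 1/512 is the range of [clog]; since |log Y| <= 2e and omega^T has bound m, the other term gives
   |t| <= r2/2. *)
pose e := Num.min 512^-1 (r2 / (4 * m)).
have e0 : 0 < e by rewrite lt_min invr_gt0 ltr0n divr_gt0 // mulr_gt0.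
have H i : exists dl : R, 0 < dl /\ forall x, vnorm x < dl -> cabs (Y x i - 1) <= e.
  have [dl dl0 h] := holomorphic_cont0 r00 (hol i) e0; exists dl; split => // x hx.
  by have := h x hx; rewrite Y0.
have [f hf] := choice H.
have [dm dm0 hdm] := finite_min (fun i => (hf i).1).
exists (Num.min r0 dm); first by rewrite lt_min r00 dm0 ge_min lexx.
move=> x; rewrite lt_min => /andP[x1 x2].
have hY i : cabs (Y x i - 1) <= e by apply: (hf i).2; apply: lt_le_trans x2 (hdm i).
have e1 : e <= 512^-1 by rewrite ge_min lexx.
have e2 : e <= r2 / (4 * m) by rewrite ge_min lexx orbT.
pose u i := clog (Y x i).
have hu i : cexp (u i) = Y x i /\ cabs (u i) <= 2 * e.
  have [h1 h2] := clogP (le_trans (hY i) e1); split => //.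
  by have := hY i; lra.
have eY : (fun i => cexp (u i)) = Y x by apply/funext => i; have [] := hu i.
have un : vnorm u <= 2 * e.
  by apply: vnorm_le => [|i]; [rewrite mulr_ge0 // ltW | have [] := hu i].
have uo : omega_mx R om \in unitmx by rewrite unitmxE unitfE.
pose t := lf (omega_mx R om)^T u.
have tu : lf (invmx (omega_mx R om)^T) t = u.
  by rewrite /t -lfM mulVmx ?lf1 // unitmx_tr.
exists t; split.
- apply: (@le_lt_trans _ _ (m * (2 * e))).
    apply: vnorm_le => [|i]; first by rewrite mulr_ge0 ?mulr_ge0 // ltW.
    by apply: le_trans (hm u i) _; rewrite ler_wpM2l // ltW.
  move: e2; rewrite ler_pdivlMr ?mulr_gt0 // => e2; lra.
- apply/funext => i; rewrite /Emap /Mx lfM tu cexpN.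
  rewrite /t !cexp_lf_natmx eY.
  have s0 : mono (Y x) (sg i) != 0.
    by rewrite -eY -cexp_lf_natmx; exact: cexp_neq0.
  apply: (mulIf s0); rewrite divfK //.
  by have /eqP := sys x x1 i; rewrite subr_eq0 => /eqP <-; ring.
by rewrite /acoef pairingM trmx_inv tu cexp_pairing_natcol eY.
Qed.

End NearOrigin.

(** * The end of the path *)

Section EndRegion.
Variable R : realType.
Local Notation C := R[i].
Variable n : nat.
Local Notation V := ('I_n -> C).
Variables (om sg : 'I_n -> 'I_n -> nat) (kd : 'I_n -> kind) (d : 'I_n -> nat).
Hypothesis Hk : \det (kappa R om sg kd) != 0.
Hypothesis Ho : \det (omega_mx R om) != 0.
Local Notation M := (Mx R om sg).
Local Notation B := (Bmx R om sg kd).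

(** Along this direction y^omega^(i) remains of modulus 1, tends to 0 or to infinity for J, L, T; in
    the last two cases x y^sigma, respectively -y^(omega - sigma)/x, tends to 1. *)
Definition lam i : R := match kd i with KJ => 0 | KL => -1 | KT => 1 end.

Lemma lamP i : lam i \in [:: -1; 0; 1].
Proof. by rewrite /lam !inE; case: (kd i); rewrite eqxx ?orbT. Qed.

Variables (l0 : C) (Q : V -> Prop) (r q : R).
Hypothesis qp : 0 < q.
Hypothesis q0 : q <= 1024^-1.
Hypothesis qr : 2 * q <= r.
Hypothesis QJ : forall t i, Q t -> kd i = KJ ->
  cabs (t i) <= q /\ cabs ((1 - cexp (t i)) * cexp (- l0) - 1) <= 512^-1.
Hypothesis QL : forall t i, Q t -> kd i = KL -> cabs (cexp (t i)) <= q.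
Hypothesis QT : forall t i, Q t -> kd i = KT -> cabs (cexp (- t i)) <= q.

(** log p written in t alone: p is e^{t_i} for J, x y^sigma = 1 - e^{t_i} for L, and -y^(omega -
    sigma)/x = 1/(1 - e^{-t_i}) for T. *)
Definition Tlog (t : V) : V := fun i => match kd i with
  | KJ => t i | KL => clog (1 - cexp (t i)) | KT => - clog (1 - cexp (- t i)) end.

(** The branches of log x on the end region. For J, 1 - e^{t_i} is small and not near 1, so its
    logarithm is taken relative to a base value [l0]. For T the summand -i pi is the choice that
    yields the phase of the theorem. *)
Definition elog (t : V) : V := fun i => match kd i with
  | KJ => l0 + clog ((1 - cexp (t i)) * cexp (- l0)) - lf M t i
  | KL => clog (1 - cexp (t i)) - lf M t i
  | KT => - ('i * (pi : R)%:C) + t i + clog (1 - cexp (- t i)) - lf M t i end.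

Lemma clog1B (z : C) : cabs z <= q ->
  cexp (clog (1 - z)) = 1 - z /\ cabs (clog (1 - z)) <= 2 * q.
Proof.
move=> hz; have e : 1 - z - 1 = - z by ring.
have z1 : cabs (1 - z - 1) <= q by rewrite e cabsN.
have q1 : q <= 512^-1 by move: q0; lra.
have [h1 h2] := clogP (le_trans z1 q1).
by split => //; apply: le_trans h2 _; rewrite ler_pM2l.
Qed.

Lemma Tlog_small t : Q t -> vnorm (Tlog t) <= r.
Proof.
move=> Qt; apply: le_trans qr; apply: vnorm_le => [|i]; first by rewrite mulr_ge0 // ltW.
rewrite /Tlog; have := QJ (i := i) Qt; have := QL (i := i) Qt; have := QT (i := i) Qt.
case: (kd i) => h1 h2 h3.
- have [h _] := h3 erefl; move: h qp; lra.
- by have [] := clog1B (h2 erefl).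
- by rewrite cabsN; have [] := clog1B (h1 erefl).
Qed.

Lemma elog_cont i : continuous_on Q (fun t => elog t i).
Proof.
have cexp_co (s : C) : continuous_on Q (fun t => cexp (s * t i)).
  by apply: cont_cexp; apply: cont_scale; exact: cont_coord.
have c1 (s : C) : continuous_on Q (fun t => 1 - cexp (s * t i)).
  by apply: cont_add; [exact: cont_cst | apply: cont_opp; exact: cexp_co].
rewrite /elog; case e : (kd i).
- apply: cont_add; last by apply: cont_opp; exact: cont_lf.
  apply: cont_add; first exact: cont_cst.
  apply: cont_clog => [t Qt|]; first by have [] := QJ Qt e.
  under eq_fun do rewrite mulrC -[X in cexp X]mul1r.
  by apply: cont_scale; have := c1 1; under eq_fun do rewrite mul1r.
- apply: cont_add; last by apply: cont_opp; exact: cont_lf.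
  apply: cont_clog => [t Qt|].
    rewrite (_ : 1 - _ - 1 = - cexp (t i)); last by ring.
    by rewrite cabsN; apply: le_trans (QL Qt e) _; move: q0; lra.
  by have := c1 1; under eq_fun do rewrite mul1r.
- apply: cont_add; last by apply: cont_opp; exact: cont_lf.
  apply: cont_add.
    by apply: cont_add; [exact: cont_cst | exact: cont_coord].
  apply: cont_clog => [t Qt|].
    rewrite (_ : 1 - _ - 1 = - cexp (- t i)); last by ring.
    by rewrite cabsN; apply: le_trans (QT Qt e) _; move: q0; lra.
  by have := c1 (-1); under eq_fun do rewrite mulN1r.
Qed.

Lemma ratio_neq0 t i : Q t -> kd i = KJ -> cexp (clog ((1 - cexp (t i)) * cexp (- l0)))
  = (1 - cexp (t i)) * cexp (- l0).
Proof. by move=> Qt e; have [_ h] := QJ Qt e; have [] := clogP h. Qed.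

Lemma one_sub_expN (z : C) : (1 - cexp (- z)) * cexp z = - (1 - cexp z).
Proof. by rewrite mulrBl mul1r -cexpD addNr cexp0; ring. Qed.

Lemma elog_exp t i : Q t -> cexp (elog t i) = Emap M t i.
Proof.
move=> Qt; rewrite /elog /Emap; case e : (kd i); rewrite cexpD; congr (_ * _).
- by rewrite cexpD ratio_neq0 // mulrCA -cexpD subrr cexp0 mulr1.
- by have [] := clog1B (QL Qt e).
rewrite !cexpD (cexpN ('i * _)) cexp_ipi invrN invr1.
have [-> _] := clog1B (QT Qt e).
by rewrite mulN1r mulNr mulrC one_sub_expN opprK.
Qed.

Lemma X_Zlog t i : Q t ->
  Emap B^T (Tlog t) i
  = cexp (Zlog om sg kd t (Tlog t) (elog t) i - lf B^T (Tlog t) i).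
Proof.
move=> Qt; rewrite /Emap cexpD; congr (_ * _); rewrite /Zlog /Tlog /elog; case e : (kd i).
- by rewrite subrK cexpD ratio_neq0 // mulrCA -cexpD subrr cexp0 mulr1.
- by have [-> _] := clog1B (QL Qt e); ring.
have [h _] := clog1B (QT Qt e).
have nz : 1 - cexp (- t i) != 0 by rewrite -h; exact: cexp_neq0.
rewrite cexpD cexpD cexp_ipi (cexpN (clog _)) h mulN1r.
by move: nz; set z := cexp (- t i) => nz; field.
Qed.

Lemma puiseux_end t (F : C) : Q t ->
  F = cexp (pairing (acoef R om d) t) ->
  (forall a, abs_summable (gterm B (Emap B^T (Tlog t)) a) /\
             has_sum (gterm B (Emap B^T (Tlog t)) a) (cexp (pairing a (Tlog t)))) ->
  abs_summable (puiseux_term om sg kd d (elog t)) /\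
  has_sum (puiseux_term om sg kd d (elog t)) F.
Proof.
move=> Qt -> /(_ (kinv R om sg kd *m natcol R d)) [H1 H2].
set c := cexp (pairing (acoef R om d) t - pairing (kinv R om sg kd *m natcol R d) (Tlog t)).
have -> : puiseux_term om sg kd d (elog t) =
    fun k => c * gterm B (Emap B^T (Tlog t)) (kinv R om sg kd *m natcol R d) k.
  apply/funext => k; apply: puiseux_gterm => //.
  - by move=> i e; rewrite /Tlog e.
  - by move=> i e; rewrite /Tlog /elog e.
  - by move=> i e; rewrite /Tlog /elog e; ring.
  by move=> i; exact: X_Zlog.
have -> : cexp (pairing (acoef R om d) t) =
    c * cexp (pairing (kinv R om sg kd *m natcol R d) (Tlog t)).
  by rewrite /c -cexpD subrK.
by split; [exact: abs_summableZ | exact: has_sumZ].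
Qed.

End EndRegion.

Section EndBall.
Variable R : realType.
Local Notation C := R[i].
Variable n : nat.
Local Notation V := ('I_n -> C).
Variable kd : 'I_n -> kind.

(* A centre off the hyperplanes [x_j = 0], [j] in J, close to the end of the path. *)
Definition endpoint (e tm eta : R) : V :=
  fun i => if kd i is KJ then eta%:C else gam (lam R kd) e tm i.

Lemma endpoint_dist e tm eta : 0 <= eta ->
  vnorm (vsub (endpoint e tm eta) (gam (lam R kd) e tm)) <= eta.
Proof.
move=> h; apply: vnorm_le => // i; rewrite /endpoint /vsub.
case E : (kd i); rewrite ?subrr ?cabs0 //.
by rewrite /gam /lam E mul0r subr0 cabs_real ger0_norm.
Qed.

Variables (e q eta : R).
Hypothesis q0 : 0 < q.
Hypothesis q1 : q <= 1024^-1.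
Hypothesis eta0 : 0 < eta.
Hypothesis etaq : 2 * eta <= q.

(** The base logarithm for the J coordinates, that of the negative number 1 - e^eta. *)
Definition lneg : C := (ln (expR eta - 1))%:C + 'i * (pi : R)%:C.

Lemma cexp_lneg : cexp lneg = 1 - cexp eta%:C.
Proof.
rewrite /lneg cexpD cexp_ipi cexp_real cexp_real lnK; first by rewrite rmorphB rmorph1; ring.
by rewrite posrE subr_gt0 expR_gt1.
Qed.

(** e^{-1/q} <= q, and the extra 1 absorbs the deviation within the end ball. *)
Definition tmax := q^-1 + 1.
(** A radius small relative to eta: |e^eta - e^{t_j}| <= 2 eta/2048 and |1 - e^eta| >= eta/2, so the
    ratio of 1 - e^{t_j} to 1 - e^eta stays within 1/512 of 1, the range of [clog]. *)
Definition endball (t : V) : Prop := vnorm (vsub t (endpoint e tmax eta)) < eta / 2048.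

Lemma expR_tm : expR (- q^-1) <= q.
Proof.
rewrite expRN -[leRHS]invrK lef_pV2 ?posrE ?expR_gt0 ?invr_gt0 //.
by apply: le_trans (expR_ge1Dx _); rewrite lerDr.
Qed.

Lemma end_J t i : endball t -> kd i = KJ ->
  cabs (t i) <= q /\ cabs ((1 - cexp (t i)) * cexp (- lneg) - 1) <= 512^-1.
Proof.
move=> Qt ei.
have h1 : cabs (t i - eta%:C) <= eta / 2048.
  have := le_vnorm (vsub t (endpoint e tmax eta)) i; rewrite {1}/vsub /endpoint ei.
  by move/le_trans; apply; exact: ltW.
have ce : cabs (eta%:C : C) = eta by rewrite cabs_real ger0_norm // ltW.
have h2 : cabs (t i) <= eta + eta / 2048.
  have := ler_cabs_sub (t i) eta%:C; rewrite ce; lra.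
split; first by move: h2 eta0 etaq; lra.
have e1 : eta <= 2048^-1 by move: q1 etaq; lra.
have n0 : 1 - cexp eta%:C != 0 :> C by rewrite -cexp_lneg; exact: cexp_neq0.
have -> : (1 - cexp (t i)) * cexp (- lneg) - 1
  = (cexp eta%:C - cexp (t i)) * cexp (- lneg).
  by rewrite cexpN cexp_lneg; move: n0; set z := cexp (eta%:C) => n0; field.
have b1 : cabs (cexp eta%:C - cexp (t i)) <= 2 * (eta / 2048).
  have := @cexp_near0 _ eta%:C (t i); rewrite ce => /(_ ltac:(move: eta0 e1; lra) ltac:(move: h2 eta0 e1; lra)).
  have := ler_cabs_sub (cexp eta%:C - cexp (t i)) (eta%:C - t i).
  rewrite (cabsBC eta%:C); move: eta0; lra.
have b2 : eta <= 2 * cabs (1 - cexp (eta%:C : C)).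
  have := @cexp_inj_near0 _ 0 eta%:C; rewrite cabs0 sub0r cabsN ce cexp0; apply; move: eta0 e1; lra.
rewrite cexpN cexp_lneg (cabsM (_ - _)) cabsV ler_pdivrMr; move: b1 b2 eta0; lra.
Qed.

Lemma end_Re t i : endball t -> kd i <> KJ ->
  `|complex.Re (t i) - lam R kd i * tmax| <= 1.
Proof.
move=> Qt ei; apply: le_trans (_ : eta / 2048 <= _); last by move: eta0 etaq q1; lra.
apply: le_trans (ltW Qt); apply: le_trans (le_vnorm _ i); apply: le_trans (Re_le_cabs _).
rewrite /vsub /endpoint ReD ReN.
have -> : (match kd i with KJ => eta%:C | _ => gam (lam R kd) e tmax i end)
   = gam (lam R kd) e tmax i by case: (kd i) ei.
by rewrite /gam /= mul0r subr0.
Qed.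

Lemma end_L t i : endball t -> kd i = KL -> cabs (cexp (t i)) <= q.
Proof.
move=> Qt ei; have h := end_Re Qt (i := i).
rewrite /lam ei mulN1r opprK in h.
apply: le_trans expR_tm; rewrite cabs_cexp ler_expR.
by have := le_trans (ler_norm _) (h ltac:(by [])); rewrite /tmax; lra.
Qed.

Lemma end_T t i : endball t -> kd i = KT -> cabs (cexp (- t i)) <= q.
Proof.
move=> Qt ei; have h := end_Re Qt (i := i).
rewrite /lam ei mul1r -normrN in h.
apply: le_trans expR_tm; rewrite cabs_cexp ler_expR ReN.
by have := le_trans (ler_norm _) (h ltac:(by [])); rewrite /tmax; lra.
Qed.

End EndBall.

(** * Assembly of the continuation *)

Theorem theorem2 (R : realType) (n : nat) (Hn : (1 <= n)%N)
  (om sg : 'I_n -> 'I_n -> nat)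
  (HA : forall i, [/\ om i <> sg i, om i <> (fun _ => 0%N) & sg i <> (fun _ => 0%N)])
  (Hom : \det (omega_mx R om) != 0)
  (kd : 'I_n -> kind)
  (Hkappa : \det (kappa R om sg kd) != 0)
  (d : 'I_n -> nat) (Hd : forall i, (0 < d i)%N)
  (r0 : R) (Hr0 : 0 < r0) (Y : ('I_n -> R[i]) -> 'I_n -> R[i])
  (HY : principal_solution om sg r0 Y) :
  exists (D : ('I_n -> R[i]) -> Prop) (F : ('I_n -> R[i]) -> R[i]),
    [/\ open_set D, connected_set D, holomorphic_on D F,
        (exists2 r : R, 0 < r /\ r <= r0 &
           forall x, vnorm x < r -> D x /\ F x = mono (Y x) d) &
        (exists (U : ('I_n -> R[i]) -> Prop) (ell : ('I_n -> R[i]) -> 'I_n -> R[i]),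
          [/\ open_set U /\ (exists x, U x), (forall x, U x -> D x),
              (forall i, continuous_on U (fun x => ell x i)),
              (forall x i, U x -> cexp (ell x i) = x i) &
              forall x, U x ->
                abs_summable (puiseux_term om sg kd d (ell x)) /\
                has_sum (puiseux_term om sg kd d (ell x)) (F x)])].
Proof.
pose M := Mx R om sg.
have [rl rl0 Hlag] := @lagrange_inversion R n (Bmx R om sg kd).
(* 1/1024 keeps 1 - e^{t_i} and 1 - e^{-t_i} within the range of [clog] for L and T; rl/2 keeps log
   p inside the ball of [lagrange_inversion]. *)
pose q : R := Num.min 1024^-1 (rl / 2).
have q0 : 0 < q by rewrite lt_min invr_gt0 ltr0n divr_gt0.
have q1 : q <= 1024^-1 by rewrite ge_min lexx.
have q2 : 2 * q <= rl by rewrite mulrC -ler_pdivlMr // ge_min lexx orbT.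
have tm0 : 0 <= tmax q by rewrite /tmax addr_ge0 // invr_ge0 ltW.
have [e [r2 [P [[e0 e1 r20] [[Popen Pball Pend Pdet Pinj] Pseg]]]]] :=
  branch_domain M (lamP R kd) tm0 ltr01.
have [rP rP0 hrP] := Popen _ Pend.
(* q/2 bounds the J coordinates on the end ball, and rP/2 keeps that ball inside [P]. *)
pose eta := Num.min (q / 2) (rP / 2).
have eta0 : 0 < eta by rewrite lt_min !divr_gt0.
have eta1 : 2 * eta <= q by rewrite mulrC -ler_pdivlMr // ge_min lexx.
have eta2 : eta <= rP / 2 by rewrite ge_min lexx orbT.
pose c := endpoint kd e (tmax q) eta.
have Pc t : endball kd e q eta t -> P t.
  rewrite /endball => ht; apply: hrP.
  apply: le_lt_trans (ler_vdist c _ _) _.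
  have := endpoint_dist kd e (tmax q) (ltW eta0); rewrite -/c in ht *.
  have : eta / 2048 <= eta by lra.
  lra.
pose Q t := endball kd e q eta t.
have Qopen : open_set Q.
  move=> t ht; exists (eta / 2048 - vnorm (vsub t c)); first by rewrite subr_gt0.
  move=> y hy; rewrite /Q /endball -/c.
  have := ler_vdist t y c; rewrite -/c in ht; lra.
have Qc : Q c.
  rewrite /Q /endball -/c (vsubxx c).
  apply: divr_gt0; first exact: eta0.
  by rewrite ltr0n.
pose D x := exists2 t, P t & Emap M t = x.
pose U x := exists2 t, Q t & Emap M t = x.
(* A total inverse by choice, with x itself as a dummy witness off [D]; on [D] injectivity on [P]
   makes it the inverse of [Emap]. *)
have inv_ex x : exists t, D x -> P t /\ Emap M t = x.
  by have [[t Pt Et]|nD] := pselect (D x); [exists t | exists x => /nD].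
have [inv hinv] := choice inv_ex.
have invE t : P t -> inv (Emap M t) = t.
  move=> Pt; have [h1 h2] := hinv (Emap M t) (ex_intro2 _ _ t Pt erefl).
  exact: Pinj h1 Pt h2.
have F_E t : P t -> cexp (pairing (acoef R om d) (inv (Emap M t))) = cexp (pairing (acoef R om d) t).
  by move=> Pt; rewrite invE.
exists D, (fun x => cexp (pairing (acoef R om d) (inv x))).
have UD x : U x -> D x by move=> [t Qt <-]; exists t => //; exact: Pc.
have Qdet t : Q t -> \det (dE M t) != 0 by move=> Qt; apply: Pdet; exact: Pc.
have P0 : P (fun _ => 0) by apply: Pball; rewrite vnorm0.
split.
- exact: Emap_image_open Popen Pdet.
- exact: (connected_image (@Emap_continuous R n M) P0 Pseg).
- exact: (Emap_inverse_holo Popen Pdet F_E).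
- have [r rr hr] := principal_near0 d Hom Hr0 r20 HY.
  exists r => // x /hr [t [ht tx te]].
  have Pt := Pball _ ht.
  by split; [exists t | rewrite -te -tx F_E].
have QJ := @end_J R n kd e q eta q1 eta0 eta1.
have QL := @end_L R n kd e q eta q0 q1 eta0 eta1.
have QT := @end_T R n kd e q eta q0 q1 eta0 eta1.
exists U, (fun x => elog om sg kd (lneg eta) (inv x)); split.
- split; first exact: Emap_image_open Qopen Qdet.
  by exists (Emap M c); exists c.
- exact: UD.
- move=> i x [t Qt <-] eps eps0.
  have [d1 d10 h1] := elog_cont om sg q1 QJ QL QT i Qt eps0.
  (* The local inverse has Lipschitz constant 2K at this point, which carries continuity of [elog]
     in t over to x. *)
  have [K K0 /(_ 1 ltr01) [d2 d20 h2]] := Emap_image_near Qopen Qdet Qt.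
  exists (Num.min d2 (d1 / (2 * K))) => [|y _].
    by rewrite lt_min d20 divr_gt0 // mulr_gt0.
  rewrite lt_min ltr_pdivlMr ?mulr_gt0 // => /andP[y2 y1].
  have [s [Qs _ sy] hs] := h2 y y2.
  rewrite -sy !invE; [|exact: Pc|exact: Pc].
  by apply: h1 => //; apply: le_lt_trans hs _; rewrite mulrC.
- move=> x i [t Qt <-]; rewrite invE; last exact: Pc.
  exact: (elog_exp om sg q1 QJ QL QT i Qt).
move=> x [t Qt <-]; rewrite invE; last exact: Pc.
apply: (puiseux_end Hkappa Hom q1 QJ QL QT Qt erefl) => a; apply: Hlag.
exact: (Tlog_small q0 q1 q2 QJ QL QT Qt).
Qed.
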